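(* Let $G$ be a finite abelian group with dual group $\Gamma$, and let $\theta_G:\mathrm{MR}(\mathbb Z\Gamma)\to\mathrm{Rep}(G)$ be the Solomon homomorphism. Then: (a) $\theta_G$ is a surjective homomorphism of graded bialgebras (for the external products $*$ and coproducts $\Delta$); its kernel is the two-sided ideal generated by the elements $y_{m,\gamma}*y_{n,\delta}-y_{n,\delta}*y_{m,\gamma}$ with $m,n\geq1$ and $\gamma,\delta\in\Gamma$. (b) For every $n$, the restriction $\theta_G:\mathrm{MR}_n(\mathbb Z\Gamma)\to R(G\wr\mathfrak S_n)$ is a surjective ring homomorphism (for the internal product on $\mathrm{MR}_n(\mathbb Z\Gamma)$ and the pointwise product of characters on $R(G\wr\mathfrak S_n)$); its kernel is the Jacobson radical of the ring $\mathrm{MR}_n(\mathbb Z\Gamma)$. (c) $\tau_{\mathrm{tot}}=\varphi_{\mathrm{tot}}\circ\theta_G$ and $\varpi_{\mathrm{tot}}(x,y)=\beta_{\mathrm{tot}}(\theta_G(x),\theta_G(y))$ for all $x,y\in\mathrm{MR}(\mathbb Z\Gamma)$; and $\ker\theta_G=\mathrm{MR}(\mathbb Z\Gamma)\cap\mathrm{MR}(\mathbb Z\Gamma)^\circ$, where $\mathrm{MR}(\mathbb Z\Gamma)^\circ=\{x\in\mathscr F(\mathbb Z\Gamma)\mid\varpi_{\mathrm{tot}}(x,\mathrm{MR}(\mathbb Z\Gamma))=0\}$.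
   Context: $\Gamma=\mathrm{Hom}(G,\mathbb C^\times)$ with pointwise product. $\mathfrak S_n$ is the symmetric group with unit $e_n$; $G\wr\mathfrak S_n=G^n\rtimes\mathfrak S_n$. $\mathscr F(\mathbb Z\Gamma)=\bigoplus_{n\ge0}\mathscr F_n(\mathbb Z\Gamma)$, $\mathscr F_n(\mathbb Z\Gamma)=(\mathbb Z\Gamma)^{\otimes n}\otimes\mathbb Z\mathfrak S_n$, spanned by elements $(\gamma_1\otimes\cdots\otimes\gamma_n)\#\sigma$; it is a graded bialgebra for the external product $[(\gamma_1\otimes\cdots\otimes\gamma_n)\#\sigma]*[(\gamma'_1\otimes\cdots\otimes\gamma'_{n'})\#\sigma']=x_{(n,n')}\cdot[(\gamma_1\otimes\cdots\otimes\gamma'_{n'})\#(\sigma\times\sigma')]$ (left action $\pi\cdot[(\gamma_1\otimes\cdots\otimes\gamma_n)\#\sigma]=[(\gamma_{\pi^{-1}(1)}\otimes\cdots\otimes\gamma_{\pi^{-1}(n)})\#\pi\sigma]$, $x_{(n,n')}$ the sum of permutations increasing on $[1,n]$ and on $[n+1,n+n']$, $\sigma\times\sigma'$ juxtaposition) and coproduct $\Delta((\gamma_1\otimes\cdots\otimes\gamma_n)\#\sigma)=\sum_{n'}[(\gamma_1\otimes\cdots\otimes\gamma_{n'})\#\pi_{n'}]\otimes[(\gamma_{n'+1}\otimes\cdots\otimes\gamma_n)\#\pi'_{n-n'}]$ ($\pi_{n'}$, $\pi'_{n-n'}$ the inverses of the standardizations of $\sigma^{-1}(1)\cdots\sigma^{-1}(n')$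 and $\sigma^{-1}(n'+1)\cdots\sigma^{-1}(n)$). The internal product on $\mathscr F_n(\mathbb Z\Gamma)$ is $[(\gamma_1\otimes\cdots\otimes\gamma_n)\#\sigma]\cdot[(\delta_1\otimes\cdots\otimes\delta_n)\#\tau]=[(\gamma_1\delta_{\sigma^{-1}(1)}\otimes\cdots\otimes\gamma_n\delta_{\sigma^{-1}(n)})\#\sigma\tau]$, making $\mathscr F_n(\mathbb Z\Gamma)\cong\mathbb Z[\Gamma\wr\mathfrak S_n]$. For $n\ge0$, $\gamma\in\Gamma$: $y_{n,\gamma}=(\gamma\otimes\cdots\otimes\gamma)\#e_n$ ($y_{0,\gamma}=1$). $\mathrm{MR}(\mathbb Z\Gamma)$ is the subalgebra of $(\mathscr F(\mathbb Z\Gamma),* )$ generated by the $y_{n,\gamma}$; it is a graded subbialgebra, freely generated as an associative algebra by the $y_{n,\gamma}$ ($n\ge1$), and $\mathrm{MR}_n(\mathbb Z\Gamma)=\mathrm{MR}(\mathbb Z\Gamma)\cap\mathscr F_n(\mathbb Z\Gamma)$ is closed under the internal product. $\tau_{\mathrm{tot}}$ is the linear form on $\mathscr F(\mathbb Z\Gamma)$ with $\tau_{\mathrm{tot}}((\gamma_1\otimes\cdots\otimes\gamma_n)\#\sigma)=1$ if all $\gamma_i=1$ and $\sigma=e_n$, and $0$ otherwise; $\varpi_{\mathrm{tot}}$ is the bilinear form with $\varpi_{\mathrm{tot}}((\gamma_1\otimes\cdots\otimes\gamma_n)\#\sigma,(\delta_1\otimes\cdots\otimes\delta_m)\#\pi)=1$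 if $m=n$, $\sigma=\pi^{-1}$ and $\gamma_{\sigma(i)}=\delta_i^{-1}$ for all $i$, and $0$ otherwise (equivalently $\varpi_{\mathrm{tot}}(x,y)=\tau_{\mathrm{tot}}(x\cdot y)$ in equal degrees). $\mathrm{Rep}(G)=\bigoplus_{n\ge0}R(G\wr\mathfrak S_n)$ ($R$ = virtual character ring) is the graded bialgebra with induction product $\psi*\psi'=\mathrm{Ind}_{(G\wr\mathfrak S_n)\times(G\wr\mathfrak S_{n'})}^{G\wr\mathfrak S_{n+n'}}(\psi\otimes\psi')$ and restriction coproduct $\Delta(\psi)=\sum_{n'=0}^n\mathrm{Res}^{G\wr\mathfrak S_n}_{(G\wr\mathfrak S_{n'})\times(G\wr\mathfrak S_{n-n'})}\psi$. $\varphi_{\mathrm{tot}}(\sum f_n)=\sum\frac1{|G\wr\mathfrak S_n|}\sum_{h}f_n(h)$, $\beta_{\mathrm{tot}}(\sum f_n,\sum g_n)=\sum_n\varphi_{\mathrm{tot}}(f_ng_n)$ (pointwise product). $\eta_n(\gamma)$ is the linear character $(g_1,\dots,g_n)\sigma\mapsto\gamma(g_1\cdots g_n)$ of $G\wr\mathfrak S_n$. The Solomon homomorphism $\theta_G$ is the unique algebra morphism $(\mathrm{MR}(\mathbb Z\Gamma),* )\to(\mathrm{Rep}(G),* )$ with $\theta_G(y_{n,\gamma})=\eta_n(\gamma)$. *)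

(* Defs.v *)
From HB Require Import structures.
From mathcomp Require Import all_boot all_order all_algebra all_fingroup.
From mathcomp Require Import all_solvable all_field all_character.
From mathcomp Require Import finmap monalg.
From mathcomp Require Import classical_sets fsbigop.

Set Implicit Arguments.
Unset Strict Implicit.
Unset Printing Implicit Defensive.

Import Order.TTheory GRing.Theory Num.Theory.
Local Open Scope ring_scope.

(* Wreath g s stands for (g_1,...,g_n) s.  The symmetric group acts on G^n by *)
(* s . (g_1,...,g_n) = (g_{s^-1(1)},...,g_{s^-1(n)}), and permutations are    *)
(* composed as functions, (s t)(i) = s (t i); the product of MathComp         *)
(* permutations goes the other way, so s t is written (t * s)%g below.        *)

Record wreath (gT : finGroupType) (n : nat) : predArgType :=
  Wreath { wr_base : {ffun 'I_n -> gT}; wr_perm : 'S_n }.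

Section WreathGroup.
Variables (gT : finGroupType) (n : nat).
Local Notation W := (wreath gT n).

Definition wr_to_pair (w : W) := (wr_base w, wr_perm w).
Definition wr_of_pair (p : {ffun 'I_n -> gT} * 'S_n) : W := Wreath p.1 p.2.
Lemma wr_to_pairK : cancel wr_to_pair wr_of_pair. Proof. by case. Qed.

HB.instance Definition _ := Finite.copy W (can_type wr_to_pairK).

Definition wr_one : W := Wreath [ffun=> 1%g] 1%g.
Definition wr_mul (v w : W) : W :=
  Wreath [ffun i => (wr_base v i * wr_base w ((wr_perm v)^-1 i))%g]
         (wr_perm w * wr_perm v)%g.
Definition wr_inv (w : W) : W :=
  Wreath [ffun i => ((wr_base w (wr_perm w i))^-1)%g] (wr_perm w)^-1%g.

Lemma wr_mulA : associative wr_mul.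
Proof.
case=> [f r] [g s] [h t]; congr Wreath; last by rewrite /= mulgA.
by apply/ffunP=> i; rewrite !ffunE /= invMg permM mulgA.
Qed.

Lemma wr_mul1 : left_id wr_one wr_mul.
Proof.
case=> g s; congr Wreath; last by rewrite /= mulg1.
by apply/ffunP=> i; rewrite !ffunE /= invg1 perm1 mul1g.
Qed.

Lemma wr_mulV : left_inverse wr_one wr_inv wr_mul.
Proof.
case=> g s; congr Wreath; last by rewrite /= mulgV.
by apply/ffunP=> i; rewrite !ffunE /= invgK mulVg.
Qed.

HB.instance Definition _ :=
  Finite_isGroup.Build W wr_mulA wr_mul1 wr_mulV.
End WreathGroup.

Section Juxtaposition.
Variables (k l : nat).

Definition juxt_fun (s : 'S_k) (t : 'S_l) (i : 'I_(k + l)) : 'I_(k + l) :=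
  match split i with
  | inl a => lshift l (s a)
  | inr b => rshift k (t b)
  end.

Lemma juxt_fun_inj s t : injective (juxt_fun s t).
Proof.
move=> i j; rewrite /juxt_fun.
case: (splitP i) => a ia; case: (splitP j) => b jb H.
- by move/lshift_inj/perm_inj: H => ab; apply: ord_inj; rewrite ia jb ab.
- by have := congr1 val H => /= E; have := ltn_ord (s a); rewrite E ltnNge leq_addr.
- by have := congr1 val H => /= E; have := ltn_ord (s b); rewrite -E ltnNge leq_addr.
- by move/rshift_inj/perm_inj: H => ab; apply: ord_inj; rewrite ia jb ab.
Qed.

Definition juxt_perm (s : 'S_k) (t : 'S_l) : 'S_(k + l) :=
  perm (@juxt_fun_inj s t).

Lemma juxt_permM s1 s2 t1 t2 :
  juxt_perm (s1 * s2)%g (t1 * t2)%g = (juxt_perm s1 t1 * juxt_perm s2 t2)%g.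
Proof.
apply/permP=> i; rewrite permM !permE /juxt_fun.
case: (split_ordP i) => a _.
  by rewrite (unsplitK (inl _ (s1 a) : 'I_k + 'I_l)%type) permM.
by rewrite (unsplitK (inr _ (t1 a) : 'I_k + 'I_l)%type) permM.
Qed.

Lemma juxt_perm1 : juxt_perm 1%g 1%g = 1%g.
Proof.
by apply/permP=> i; rewrite permE perm1 /juxt_fun; case: (split_ordP i) => a ->;
  rewrite perm1.
Qed.

Lemma juxt_permV s t : (juxt_perm s t)^-1%g = juxt_perm s^-1%g t^-1%g.
Proof.
by apply/eqP; rewrite eq_invg_mul -juxt_permM !mulgV juxt_perm1.
Qed.

Variable gT : finGroupType.

Definition juxt (vw : wreath gT k * wreath gT l) : wreath gT (k + l) :=
  Wreath [ffun i => match split i with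
                    | inl a => wr_base vw.1 a
                    | inr b => wr_base vw.2 b
                    end]
         (juxt_perm (wr_perm vw.1) (wr_perm vw.2)).

Lemma juxtM : {morph juxt : v w / (v * w)%g}.
Proof.
move=> [v1 v2] [w1 w2]; congr Wreath; last exact: juxt_permM.
apply/ffunP=> i; rewrite !ffunE /= juxt_permV permE /juxt_fun.
case: (split_ordP i) => a _; rewrite ffunE.
  by rewrite (unsplitK (inl _ _ : 'I_k + 'I_l)%type).
by rewrite (unsplitK (inr _ _ : 'I_k + 'I_l)%type).
Qed.

Canonical juxt_morphism :=
  @Morphism _ _ [set: wreath gT k * wreath gT l] juxt (in2W juxtM).

Lemma juxt_inj : injective juxt.
Proof.
move=> [[g1 s1] [g2 s2]] [[h1 t1] [h2 t2]] [].
move=> /ffunP Eg /permP Es.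
have lK a : split (lshift l a : 'I_(k + l)) = inl a.
  exact: (unsplitK (inl _ a : 'I_k + 'I_l)%type).
have rK a : split (rshift k a : 'I_(k + l)) = inr a.
  exact: (unsplitK (inr _ a : 'I_k + 'I_l)%type).
congr (Wreath _ _, Wreath _ _).
- by apply/ffunP=> a; have := Eg (lshift l a); rewrite !ffunE lK.
- apply/permP=> a; have := Es (lshift l a); rewrite !permE /juxt_fun lK.
  exact: lshift_inj.
- by apply/ffunP=> a; have := Eg (rshift k a); rewrite !ffunE rK.
- apply/permP=> a; have := Es (rshift k a); rewrite !permE /juxt_fun rK.
  exact: rshift_inj.
Qed.

Definition young := (juxt @* [set: wreath gT k * wreath gT l])%G.

Lemma juxt_isom : isom [set: wreath gT k * wreath gT l] young juxt.
Proof. by apply/isomP; split=> //; apply/injmP=> v w _ _; apply: juxt_inj. Qed.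
End Juxtaposition.

(* Over algC, the homomorphisms from a finite group to the multiplicative     *)
(* group of the field are its linear characters; they are indexed by part of  *)
(* Iirr, which makes the dual a finite type.                                  *)
Definition dual (gT : finGroupType) : predArgType :=
  {i : Iirr [set: gT] | 'chi_i \is a linear_char}.

HB.instance Definition _ (gT : finGroupType) := Finite.on (dual gT).

Definition dual_char (gT : finGroupType) (c : dual gT) : 'CF([set: gT]) :=
  'chi_(val c).

Section DualGroup.
Variable gT : finGroupType.
Local Notation Gamma := (dual gT).

Lemma dual_lin (c : Gamma) : dual_char c \is a linear_char.
Proof. exact: (valP c). Qed.

Lemma dual_char_inj : injective (@dual_char gT).
Proof. by move=> c d /irr_inj/val_inj. Qed.

Lemma dual_of_subproof (phi : 'CF([set: gT])) :
  phi \is a linear_char -> 'chi_(cfIirr phi) \is a linear_char.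
Proof. by move=> lphi; rewrite cfIirrE ?lin_char_irr. Qed.

Definition dual_of (phi : 'CF([set: gT])) (lphi : phi \is a linear_char) :
  Gamma := exist _ (cfIirr phi) (dual_of_subproof lphi).

Lemma dual_ofE phi (lphi : phi \is a linear_char) :
  dual_char (dual_of lphi) = phi.
Proof. by rewrite /dual_char /= cfIirrE ?lin_char_irr. Qed.

Definition dual_one : Gamma := dual_of (cfun1_lin_char [set: gT]).
Definition dual_mul (c d : Gamma) : Gamma :=
  dual_of (rpredM (dual_lin c) (dual_lin d)).
Definition dual_inv (c : Gamma) : Gamma :=
  dual_of (rpredVr (dual_lin c)).

Lemma dual_mulA : associative dual_mul.
Proof. by move=> a b c; apply: dual_char_inj; rewrite !dual_ofE mulrA. Qed.

Lemma dual_mul1 : left_id dual_one dual_mul.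
Proof. by move=> a; apply: dual_char_inj; rewrite !dual_ofE mul1r. Qed.

Lemma dual_mulV : left_inverse dual_one dual_inv dual_mul.
Proof.
move=> a; apply: dual_char_inj; rewrite !dual_ofE mulVr //.
exact: lin_char_unitr (dual_lin a).
Qed.

HB.instance Definition _ :=
  Finite_isGroup.Build Gamma dual_mulA dual_mul1 dual_mulV.
End DualGroup.

Section FreeModule.
Variables (K : choiceType) (V : zmodType).

Definition extend1 (f : K -> V) (x : {malg int[K]}) : V :=
  \sum_(k <- msupp x) f k *~ x@_k.

Definition extend2 (f : K -> K -> V) (x y : {malg int[K]}) : V :=
  \sum_(k <- msupp x) \sum_(l <- msupp y) f k l *~ (x@_k * y@_l).
End FreeModule.

Section FQSym.
Variable gT : finGroupType.
Local Notation Gamma := (dual gT).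

(* (gamma_1 (x) ... (x) gamma_n) # s is the basis element indexed by          *)
(* Wreath gamma s, so that F_n is the group ring of the wreath product of     *)
(* Gamma with S_n.                                                            *)
Definition fbasis := {n : nat & wreath Gamma n}.
Definition fbasis_in n (w : wreath Gamma n) : fbasis :=
  Tagged (wreath Gamma) w.
Definition fmod := {malg int[fbasis]}.
(* The free module on pairs of basis elements is F (x) F. *)
Definition fmod2 := {malg int[(fbasis * fbasis)%type]}.

Definition homogeneous (n : nat) (x : fmod) : Prop :=
  {in msupp x, forall b, tag b = n}.

Definition tensor : fmod -> fmod -> fmod2 := extend2 (fun a b => << (a, b) >>).

Definition shuffles (k l : nat) : {set 'S_(k + l)} :=
  [set p : 'S_(k + l) |
    [forall i : 'I_k, forall j : 'I_k,
       (i < j)%N ==> (p (lshift l i) < p (lshift l j))%N] &&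
    [forall i : 'I_l, forall j : 'I_l,
       (i < j)%N ==> (p (rshift k i) < p (rshift k j))%N]].

Definition perm_act n (p : 'S_n) (w : wreath Gamma n) : wreath Gamma n :=
  Wreath [ffun i => wr_base w (p^-1%g i)] (wr_perm w * p)%g.

Definition ext_one : fmod := << fbasis_in (1%g : wreath Gamma 0) >>.
Definition ext_mul : fmod -> fmod -> fmod :=
  extend2 (fun a b => \sum_(p in shuffles (tag a) (tag b))
    << fbasis_in (perm_act p (juxt (tagged a, tagged b))) >>).

(* The permutation whose letters are in the same relative order as those of   *)
(* the word w without repetition.                                             *)
Definition std m (w : 'I_m -> nat) : 'S_m :=
  odflt 1%g [pick s : 'S_m |
    [forall i, forall j, (s i < s j)%N == (w i < w j)%N]].

Definition subword n m (f : 'I_m -> 'I_n) (w : wreath Gamma n) :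
    wreath Gamma m :=
  Wreath [ffun i => wr_base w (f i)]
         (std (fun i => (wr_perm w)^-1%g (f i)))^-1%g.

Definition coprod : fmod -> fmod2 :=
  extend1 (fun a => \sum_(i < (tag a).+1)
    let e := subnKC (leq_ord i) in
    << (fbasis_in (subword (fun j => cast_ord e (lshift _ j)) (tagged a)),
        fbasis_in (subword (fun j => cast_ord e (rshift i j)) (tagged a))) >>).

Definition counit : fmod -> int := extend1 (fun a => (tag a == 0%N)%:R).

(* The product of F_n, extended by 0 between different degrees. *)
Definition int_mul : fmod -> fmod -> fmod :=
  extend2 (fun a b => if tag a == tag b then
    << fbasis_in (tagged a * tagged_as a b)%g >> else 0).

Definition ygen (n : nat) (c : Gamma) : fmod :=
  << fbasis_in (Wreath [ffun=> c] 1%g : wreath Gamma n) >>.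

Definition tau_tot : fmod -> int :=
  extend1 (fun a => (tagged a == 1%g)%:R).

Definition varpi_tot : fmod -> fmod -> int :=
  extend2 (fun a b =>
    let v := tagged a in let w := tagged_as a b in
    [&& tag a == tag b, wr_perm v == (wr_perm w)^-1%g &
      [forall i, wr_base v (wr_perm v i) == (wr_base w i)^-1%g]]%:R).

Inductive MR : fmod -> Prop :=
| MR_one : MR ext_one
| MR_gen n c : MR (ygen n c)
| MR_sub x y : MR x -> MR y -> MR (x - y)
| MR_mul x y : MR x -> MR y -> MR (ext_mul x y).

Definition MRn (n : nat) (x : fmod) : Prop := MR x /\ homogeneous n x.

Definition MR_perp (x : fmod) : Prop := forall y, MR y -> varpi_tot x y = 0.
End FQSym.

(* Ideals of a ring A carried by a subgroup of a Z-module V, with product mul.*)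

Section Ideals.
Variables (V : zmodType) (mul : V -> V -> V) (A : V -> Prop).

Inductive ideal_gen (S : V -> Prop) : V -> Prop :=
| ideal_gen0 : ideal_gen S 0
| ideal_gen_in x : S x -> ideal_gen S x
| ideal_genB x y : ideal_gen S x -> ideal_gen S y -> ideal_gen S (x - y)
| ideal_genMl a x : A a -> ideal_gen S x -> ideal_gen S (mul a x)
| ideal_genMr a x : A a -> ideal_gen S x -> ideal_gen S (mul x a).

Definition left_ideal (I : V -> Prop) : Prop :=
  [/\ forall x, I x -> A x,
      I 0,
      forall x y, I x -> I y -> I (x - y) &
      forall a x, A a -> I x -> I (mul a x)].

Definition maximal_left_ideal (I : V -> Prop) : Prop :=
  [/\ left_ideal I,
      exists x, A x /\ ~ I x &
      forall J : V -> Prop, left_ideal J -> (forall x, I x -> J x) ->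
        (forall x, J x -> I x) \/ (forall x, A x -> J x)].

Definition jacobson_radical (x : V) : Prop :=
  A x /\ forall I, maximal_left_ideal I -> I x.
End Ideals.

Section ClassFunctions.

Lemma cfOuter_subproof (aT bT : finGroupType)
    (phi : 'CF([set: aT])) (psi : 'CF([set: bT])) :
  is_class_fun <<[set: aT * bT]>>%g [ffun x => phi x.1 * psi x.2].
Proof.
rewrite genGid; apply: intro_class_fun => [x y _ _ | x]; last by rewrite inE.
by rewrite !cfunJ ?inE.
Qed.
Definition cfOuter (aT bT : finGroupType)
    (phi : 'CF([set: aT])) (psi : 'CF([set: bT])) : 'CF([set: aT * bT]) :=
  Cfun 0 (cfOuter_subproof phi psi).

Lemma eta_subproof (gT : finGroupType) n (c : dual gT) :
  is_class_fun <<[set: wreath gT n]>>%g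
    [ffun h : wreath gT n => dual_char c (\prod_(i < n) wr_base h i)%g].
Proof.
have lc := dual_lin c.
have etaM (v w : wreath gT n) :
    dual_char c (\prod_(i < n) wr_base (v * w)%g i)%g =
    dual_char c (\prod_(i < n) wr_base v i)%g *
    dual_char c (\prod_(i < n) wr_base w i)%g.
  have prodE (w' : wreath gT n) : dual_char c (\prod_(i < n) wr_base w' i)%g =
      \prod_(i < n) dual_char c (wr_base w' i).
    by rewrite lin_char_prod // => i _; rewrite inE.
  rewrite !prodE [X in _ * X](reindex_perm (wr_perm v)^-1).
  rewrite -big_split.
  by apply: eq_bigr => i _; rewrite ffunE lin_charM ?inE.
rewrite genGid; apply: intro_class_fun => [x y _ _ | x]; last by rewrite inE.
cbv beta; by rewrite conjgE !etaM mulrCA -etaM mulVg -etaM mulg1.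
Qed.
Definition eta_char (gT : finGroupType) n (c : dual gT) :
  'CF([set: wreath gT n]) := Cfun 0 (eta_subproof n c).

End ClassFunctions.

Section Rep.
Variable gT : finGroupType.

Definition cfamily := forall n, 'CF([set: wreath gT n]).

(* Rep(G) is the set of the finitely supported families of virtual characters.*)
Definition in_Rep (r : cfamily) : Prop :=
  (forall n, r n \in 'Z[irr [set: wreath gT n]]%g) /\
  (exists N, forall n, (N <= n)%N -> r n = 0).

Definition rep_in n (phi : 'CF([set: wreath gT n])) : cfamily :=
  dfwith (fun=> 0) phi.

Definition ind2 k l (phi : 'CF([set: wreath gT k])) (psi : 'CF([set: wreath gT l]))
    : 'CF([set: wreath gT (k + l)]) :=
  'Ind[[set: wreath gT (k + l)]] (cfIsom (juxt_isom k l gT) (cfOuter phi psi)).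

Definition rep_mul (r s : cfamily) : cfamily := fun n =>
  \sum_(i < n.+1)
    ecast m 'CF([set: wreath gT m]) (subnKC (leq_ord i))
      (ind2 (r i) (s (n - i)%N)).

(* The component in R(G wr S_k) (x) R(G wr S_l) = R((G wr S_k) x (G wr S_l))  *)
(* of the coproduct.                                                          *)
Definition rep_coprod (r : cfamily) k l :
    'CF([set: wreath gT k * wreath gT l]) :=
  cfMorph ('Res[young k l gT] (r (k + l)%N)).

Definition rep_counit (r : cfamily) : algC := r 0%N 1%g.

Definition phi_tot (r : cfamily) : algC :=
  \sum_(n \in [set: nat]%classic)
    (#|[set: wreath gT n]|%:R^-1 * \sum_(h : wreath gT n) r n h).

Definition beta_tot (r s : cfamily) : algC := phi_tot (fun n => r n * s n).
End Rep.

(* Morphisms from MR to Rep(G).  They are represented by functions on F whose *)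
(* values outside MR are irrelevant.                                          *)

Section Morphisms.
Variables (gT : finGroupType) (theta : fmod gT -> cfamily gT).

Definition algebra_morphism : Prop :=
  [/\ forall x, MR x -> in_Rep (theta x),
      forall x y, MR x -> MR y ->
        forall n, theta (x - y) n = theta x n - theta y n,
      forall n, theta (ext_one gT) n = rep_in (1 : 'CF([set: wreath gT 0])) n &
      forall x y, MR x -> MR y ->
        forall n, theta (ext_mul x y) n = rep_mul (theta x) (theta y) n].

Definition Solomon_morphism : Prop :=
  algebra_morphism /\
  forall n c m, theta (ygen n c) m = rep_in (eta_char n c) m.

Definition preserves_degree : Prop :=
  forall n x, MRn n x -> forall m, m != n -> theta x m = 0.

(* The coproduct maps MR to MR (x) MR, seen in F (x) F, and is compatible     *)
(* with that of Rep(G) through theta (x) theta.                               *)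
Definition coalgebra_morphism : Prop :=
  [/\ forall x, MR x -> exists s : seq (fmod gT * fmod gT),
        {in s, forall p, MR p.1 /\ MR p.2} /\
        coprod x = \sum_(p <- s) tensor p.1 p.2,
      forall x (s : seq (fmod gT * fmod gT)), MR x ->
        {in s, forall p, MR p.1 /\ MR p.2} ->
        coprod x = \sum_(p <- s) tensor p.1 p.2 ->
        forall k l, rep_coprod (theta x) k l =
          \sum_(p <- s) cfOuter (theta p.1 k) (theta p.2 l) &
      forall x, MR x -> rep_counit (theta x) = (counit x)%:~R].

Definition in_kernel (x : fmod gT) : Prop := MR x /\ forall n, theta x n = 0.
End Morphisms.

(* Main.v *)
(******************************************************************************)
(* A word f of length n over a finite alphabet of coloured, ordered letters   *)
(* gives the basis element (colours of f) # (standardization of f)^-1 of F_n, *)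
(* and the function chi(f) on G wr S_n sending (g_1,...,g_n) s to the product *)
(* of the colours of the letters evaluated at the g_j if f s = f, and to 0    *)
(* otherwise.  A product of generators y_{n,c} is the sum of the basis        *)
(* elements of all the words with a given content, and theta_G maps it to the *)
(* sum of the chi(f).  On pairs of words, ordered lexicographically, both     *)
(* constructions are multiplicative, which is (b); both are compatible with   *)
(* shuffling, resp. induction, and with cutting words, which is (a).  A count *)
(* of sorted words gives tau_tot = phi_tot o theta_G, and (c) follows.        *)
(*   Every virtual character is in the image: the characters h_mu indexed by  *)
(* Gamma-multipartitions and the sgn h_mu' pair in a unitriangular way, so    *)
(* that the lattice spanned by the h_mu is unimodular.  An irreducible        *)
(* character has norm 1, so it lies in this lattice or is orthogonal to it;   *)
(* the latter is impossible because the lattice contains a multiple of the    *)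
(* regular character.  The same pairing shows that the h_mu are independent,  *)
(* and modulo commutators every product of generators is some h_mu, whence    *)
(* the kernel.  Elements of the kernel are nilpotent in degree n, because the *)
(* traces of their powers in the regular representation of Gamma wr S_n are   *)
(* values of tau_tot, that is, of phi_tot at 0.                               *)
(******************************************************************************)

From HB Require Import structures.
Require Import Defs.
From mathcomp Require Import all_boot all_order all_algebra all_fingroup.
From mathcomp Require Import all_solvable all_field all_character.
From mathcomp Require Import finmap monalg.
From mathcomp Require boolp classical_sets fsbigop.

Set Implicit Arguments.
Unset Strict Implicit.
Unset Printing Implicit Defensive.

Import Order.TTheory GRing.Theory Num.Theory.
Local Open Scope ring_scope.

(** * Bilinear extensions on free modules *)

(** Both ends of the Solomon homomorphism are governed by words with prescribed letter
    multiplicities: [wsum] adds up basis elements of F_n over such words, [wchar] is the character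
    of the monomial representation on them, and [Theta] matches the two ([Theta_wsum]). The
    operations agree because they are the same counts. The external product and induction count the
    permutations that sort a word over a disjoint union into two blocks ([ext_mul_wsum],
    [ind2_wchar]). The internal product and the pointwise product run over contents on pairs of
    letters ([int_mul_wsum], [wcharM]). Coproduct and restriction cut words ([coprod_wsum],
    [word_char_cut]).

    [Theta] is built from the bilinear form rather than from freeness of MR: by [tau_wsum] and
    [varpi_wsum], [varpi_tot] on MR is a scalar product of characters, so the coordinates of the
    image of x on the irreducible characters are values of [varpi_tot x]. This requires lifts of the
    conjugate irreducible characters, so the spanning result [irr_wspan] comes before the
    construction. [Solomon_unique] then carries every statement over to an arbitrary Solomon
    morphism.

    For [irr_wspan], the unitriangular pairing ([cfdot_echar_diag], [cfdot_echar_tri]) yields a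
    member phi of the lattice with the same scalar products as a given irreducible chi
    ([wspan_unimodular]). Then 1 is the sum of the natural numbers |phi|^2 and |chi - phi|^2, so chi
    = phi or phi = 0, and [wspan_regular] excludes the latter; commutativity of G enters there,
    through [sum_dual].

    The kernel is the commutator ideal because, modulo that ideal, MR is spanned by products indexed
    by multipartitions ([ideal_shape]), whose characters are independent ([hchar_free]). It is the
    radical of the form because a nonzero virtual character pairs nontrivially with its conjugate
    ([kernel_perp]). In degree n its elements are nilpotent by a trace argument, hence lie in the
    Jacobson radical ([kernel_sub_jacobson]). Conversely, positivity in the character ring shows
    that the radical maps to 0 ([jacobson_sub_kernel]). *)

Section FreeModuleTheory.
Variable K : choiceType.

Lemma extend1Ew (V : zmodType) (f : K -> V) (d : {fset K}) (x : {malg int[K]}) :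
  (msupp x `<=` d)%fset -> extend1 f x = \sum_(k <- d) f k *~ x@_k.
Proof.
move=> le; rewrite /extend1; apply: (big_fset_incl _ le) => k _ kx /=.
by rewrite mcoeff_outdom ?mulr0z.
Qed.

Lemma extend1_is_additive (V : zmodType) (f : K -> V) :
  zmod_morphism (extend1 f).
Proof.
move=> x y; set d := (msupp x `|` msupp y)%fset.
rewrite !(@extend1Ew _ f d) ?fsubsetUl ?fsubsetUr //; last exact: msuppB_le.
by rewrite -sumrB; apply: eq_bigr => k _; rewrite mcoeffB mulrzBr.
Qed.

HB.instance Definition _ (V : zmodType) (f : K -> V) :=
  GRing.isZmodMorphism.Build {malg int[K]} V (extend1 f)
    (extend1_is_additive f).

Lemma extend1U (V : zmodType) (f : K -> V) k : extend1 f << k >> = f k.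
Proof. by rewrite /extend1 msuppU oner_eq0 big_seq_fset1 mcoeffUU mulr1z. Qed.

Lemma extend2E (V : zmodType) (f : K -> K -> V) x y :
  extend2 f x y = extend1 (fun k => extend1 (f k) y) x.
Proof.
rewrite /extend2 /extend1; apply: eq_bigr => k _; rewrite mulrz_suml.
by apply: eq_bigr => l _; rewrite mulrC mulrzA.
Qed.

Lemma extend2C (V : zmodType) (f : K -> K -> V) x y :
  extend2 f x y = extend2 (fun k l => f l k) y x.
Proof.
rewrite /extend2 exchange_big; apply: eq_bigr => k _; apply: eq_bigr => l _.
by rewrite mulrC.
Qed.

Lemma extend2_is_additivel (V : zmodType) (f : K -> K -> V) y :
  zmod_morphism (fun x => extend2 f x y).
Proof. by move=> x x'; rewrite !extend2E raddfB. Qed.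

Lemma extend2_is_additiver (V : zmodType) (f : K -> K -> V) x :
  zmod_morphism (extend2 f x).
Proof. by move=> y y'; rewrite !(extend2C f x) extend2_is_additivel. Qed.

HB.instance Definition _ (V : zmodType) (f : K -> K -> V) x :=
  GRing.isZmodMorphism.Build {malg int[K]} V (extend2 f x)
    (extend2_is_additiver f x).

Lemma extend2UU (V : zmodType) (f : K -> K -> V) k l :
  extend2 f << k >> << l >> = f k l.
Proof. by rewrite extend2E !extend1U. Qed.

Lemma extend2_sum (V : zmodType) (f : K -> K -> V) (I J : Type)
    (r : seq I) (P : pred I) (s : seq J) (Q : pred J) F G :
  extend2 f (\sum_(i <- r | P i) F i) (\sum_(j <- s | Q j) G j) =
  \sum_(i <- r | P i) \sum_(j <- s | Q j) extend2 f (F i) (G j).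
Proof.
transitivity (\sum_(i <- r | P i) extend2 f (F i) (\sum_(j <- s | Q j) G j)).
  by rewrite extend2E raddf_sum; apply: eq_bigr => i _; rewrite extend2E.
by apply: eq_bigr => i _; rewrite raddf_sum.
Qed.

Lemma extend2_sumz (V : zmodType) (f : K -> K -> V) (I J : Type)
    (r : seq I) (s : seq J) (a : I -> int) (b : J -> int) F G :
  extend2 f (\sum_(i <- r) F i *~ a i) (\sum_(j <- s) G j *~ b j) =
  \sum_(i <- r) \sum_(j <- s) extend2 f (F i) (G j) *~ (a i * b j).
Proof.
rewrite extend2_sum; apply: eq_bigr => i _; apply: eq_bigr => j _.
rewrite raddfMz /= (extend2C f (_ *~ _)).
by rewrite raddfMz /= -(extend2C f) -mulrzA.
Qed.

Lemma malg_sumE (x : {malg int[K]}) : x = \sum_(k <- msupp x) << k >> *~ x@_k.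
Proof.
rewrite {1}[x]monalgE; apply: eq_bigr => k _.
by rewrite -[in LHS](intz x@_k) (raddfMz (@mkmalgU K int k)).
Qed.
End FreeModuleTheory.

(** * Standardization *)

Section Standardization.
Variable m : nat.
Implicit Types (w : 'I_m -> nat) (s t : 'S_m).

(** The rank of a letter is the number of positions carrying a smaller one; injectivity of [w] makes
    these ranks distinct. *)
Lemma std_exists w : injective w ->
  exists s : 'S_m, forall i j, (s i < s j)%N = (w i < w j)%N.
Proof.
move=> winj; pose below i := [set j | (w j < w i)%N].
have lt_below i : (#|below i| < m)%N.
  rewrite -[X in (_ < X)%N]card_ord -cardsT; apply: proper_card.
  apply/properP; split; first exact: subsetT.
  by exists i; rewrite ?inE ?ltnn.
pose f i := Ordinal (lt_below i).
have f_lt i j : (w i < w j)%N -> (f i < f j)%N.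
  move=> wij; apply: proper_card; apply/properP; split.
    by apply/subsetP=> k; rewrite !inE => /ltn_trans; apply.
  by exists i; rewrite !inE ?ltnn.
have finj : injective f.
  move=> i j fij; apply: winj.
  by case: (ltngtP (w i) (w j)) => // /f_lt; rewrite fij ltnn.
exists (perm finj) => i j; rewrite !permE; apply/idP/idP; last exact: f_lt.
by case: (ltngtP (w i) (w j)) => // [/f_lt /ltnW|/winj ->];
  rewrite ?ltnn // leqNgt => /negbTE->.
Qed.

Lemma std_lt w : injective w -> forall i j, (std w i < std w j)%N = (w i < w j)%N.
Proof.
move=> winj; rewrite /std; case: pickP => [s /= /forallP sP i j | no_s].
  by have /forallP/(_ j)/eqP := sP i.
have [s sP] := std_exists winj; case/idP: (no_s s).
by apply/forallP=> i; apply/forallP=> j; rewrite sP eqxx.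
Qed.

(** The order of the values recovers a permutation, since [s i] is the number of [j] with
    [s j < s i]. *)
Lemma ltn_perm_eq s t :
  (forall i j, (s i < s j)%N = (t i < t j)%N) -> s = t.
Proof.
move=> st; have card_below (u : 'S_m) i : #|[set j | (u j < u i)%N]| = u i.
  rewrite -[RHS](card_ord (u i)) -(card_imset _ (@perm_inj _ u)) -sum1_card.
  have -> : u @: [set j | (u j < u i)%N] = [set k : 'I_m | (k < u i)%N].
    apply/setP=> k; rewrite inE; apply/imsetP/idP=> [[j + ->]|ki].
      by rewrite inE.
    by exists (u^-1%g k); rewrite ?inE permKV.
  rewrite -sum1_card -(big_mkord xpredT (fun=> 1%N)).
  rewrite (big_nat_widen _ _ m) ?(ltnW (ltn_ord _)) //.
  by rewrite big_mkord; apply: eq_bigl => k; rewrite inE.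
apply/permP=> i; apply: ord_inj.
rewrite -(card_below s i) -(card_below t i).
by apply: eq_card => j; rewrite !inE st.
Qed.

Lemma std_unique w s :
  (forall i j, (s i < s j)%N = (w i < w j)%N) -> std w = s.
Proof.
move=> sw; have winj : injective w.
  move=> i j wij; apply: (@perm_inj _ s); apply: ord_inj.
  have := sw i j; have := sw j i; rewrite wij ltnn.
  by case: (ltngtP (s i) (s j)).
by apply: ltn_perm_eq => i j; rewrite std_lt.
Qed.

Lemma eq_std w w' :
  injective w -> (forall i j, (w i < w j)%N = (w' i < w' j)%N) -> std w = std w'.
Proof. by move=> winj ww'; rewrite (@std_unique w' (std w)) // => i j; rewrite std_lt. Qed.

(* The order of the values of [lexw w] is that of w, ties being broken from left to right. *)
Definition lexw w : 'I_m -> nat := fun j => (w j * m + j)%N.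

Lemma lexw_lt w i j :
  (lexw w i < lexw w j)%N = (w i < w j)%N || (w i == w j) && (i < j)%N.
Proof.
rewrite /lexw; case: (ltngtP (w i) (w j)) => [lt_ij|lt_ji|->] /=.
- apply: (@leq_trans ((w i).+1 * m)%N); first by rewrite mulSnr -addnS leq_add2l.
  by rewrite (leq_trans _ (leq_addr _ _)) // leq_mul2r lt_ij orbT.
- apply/negbTE; rewrite -leqNgt (@leq_trans ((w j).+1 * m)%N) //.
    by rewrite mulSnr leq_add2l ltnW.
  by rewrite (leq_trans _ (leq_addr _ _)) // leq_mul2r lt_ji orbT.
- by rewrite ltn_add2l.
Qed.

Lemma lexw_inj w : injective (lexw w).
Proof.
move=> i j eq_ij; apply: ord_inj.
have := lexw_lt w i j; have := lexw_lt w j i; rewrite eq_ij ltnn.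
by case: (ltngtP (w i) (w j)) => // _; case: (ltngtP i j).
Qed.
End Standardization.

(** * Sums over words with a given content *)

Lemma big_bij (V : nmodType) (I J : finType) (P : pred I) (Q : pred J)
    (h : I -> J) (F : J -> V) :
    {in P &, injective h} -> (forall i, P i -> Q (h i)) ->
    (forall j, Q j -> exists2 i, P i & j = h i) ->
  \sum_(i | P i) F (h i) = \sum_(j | Q j) F j.
Proof.
move=> hinj PQ QP; rewrite -(big_imset F (A := P) hinj) /=.
apply: eq_bigl => j; apply/imsetP/idP=> [[i Pi ->]|/QP[i Pi ->]]; first exact: PQ.
by exists i.
Qed.

Section Words.
Variables (n : nat) (T : finType).
Implicit Types (f : {ffun 'I_n -> T}) (a : T -> nat) (s : 'S_n).

Definition has_content a f := [forall t, #|[set j | f j == t]| == a t].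

Lemma has_contentP a f :
  reflect (forall t, #|[set j | f j == t]| = a t) (has_content a f).
Proof. by apply: (iffP forallP) => fa t; apply/eqP. Qed.

Lemma sum_content a f : has_content a f -> \sum_t a t = n.
Proof.
move=> /has_contentP fa; rewrite -[RHS]card_ord -sum1_card.
rewrite (partition_big f xpredT) //=; apply: eq_bigr => t _.
by rewrite -fa -sum1_card; apply: eq_bigl => j; rewrite inE.
Qed.

Definition word_perm s f := [ffun j => f (s j)].

Lemma word_permM s t f : word_perm (s * t)%g f = word_perm s (word_perm t f).
Proof. by apply/ffunP=> j; rewrite !ffunE permM. Qed.

Lemma word_perm1 f : word_perm 1%g f = f.
Proof. by apply/ffunP=> j; rewrite ffunE perm1. Qed.

Lemma word_permK s : cancel (word_perm s) (word_perm s^-1%g).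
Proof. by move=> f; rewrite -word_permM mulVg word_perm1. Qed.

Lemma word_permKV s : cancel (word_perm s^-1%g) (word_perm s).
Proof. by move=> f; rewrite -word_permM mulgV word_perm1. Qed.

Lemma has_content_perm s a f : has_content a (word_perm s f) = has_content a f.
Proof.
apply: eq_forallb => t; congr (_ == _); rewrite -[RHS](card_preimset _ (@perm_inj _ s)).
by apply: eq_card => j; rewrite !inE ffunE.
Qed.

Lemma sum_word_perm (V : nmodType) (P : pred {ffun 'I_n -> T}) s F :
  \sum_(f | P (word_perm s f)) F (word_perm s f) = \sum_(f | P f) F f :> V.
Proof.
by rewrite [RHS](reindex (word_perm s)) //; exists (word_perm s^-1%g) => f _;
  rewrite ?word_permK ?word_permKV.
Qed.
End Words.

Section Relabel.
Variables (n : nat) (T U : finType) (h : T -> U) (a : T -> nat) (b : U -> nat).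
Hypotheses (h_inj : injective h) (ba : forall t, b (h t) = a t).
Hypothesis b_out : forall u, u \notin codom h -> b u = 0%N.

(** Letters outside the image of [h] have multiplicity 0, so a word of content [b] lifts uniquely
    along [h]. *)
Lemma sum_relabel (V : nmodType) (F : {ffun 'I_n -> U} -> V) :
  \sum_(f : {ffun 'I_n -> T} | has_content a f) F [ffun j => h (f j)] =
  \sum_(g | has_content b g) F g.
Proof.
have contE (f : {ffun 'I_n -> T}) :
    has_content b [ffun j => h (f j)] = has_content a f.
  have preim t : [set j | [ffun j => h (f j)] j == h t] = [set j | f j == t].
    by apply/setP=> j; rewrite !inE ffunE inj_eq.
  apply/has_contentP/has_contentP => [fb t|fa u]; first by rewrite -preim fb ba.
  case: (boolP (u \in codom h)) => [/codomP[t ->]|ou]; first by rewrite preim fa ba.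
  rewrite b_out //; apply/eqP; rewrite cards_eq0; apply/eqP/setP=> j.
  by rewrite !inE ffunE; apply: contraNF ou => /eqP <-; apply: codom_f.
rewrite (big_bij (P := has_content a) (Q := has_content b)) //.
- move=> f g _ _ /ffunP fg; apply/ffunP=> j.
  by have := fg j; rewrite !ffunE => /h_inj.
- by move=> f; rewrite contE.
- move=> g gb; have gh j : g j \in codom h.
    apply/negPn/negP => /b_out; move/has_contentP: gb => <- /eqP.
    by rewrite cards_eq0 => /eqP/setP/(_ j); rewrite !inE eqxx.
  have gE : g = [ffun j => h ([ffun j => iinv (gh j)] j)].
    by apply/ffunP=> j; rewrite !ffunE f_iinv.
  by exists [ffun j => iinv (gh j)] => //; rewrite -contE -gE.
Qed.
End Relabel.

(** * Words over a disjoint union *)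

Section Join.
Variables (k l : nat) (T1 T2 : finType).
Implicit Types (u : {ffun 'I_k -> T1}) (v : {ffun 'I_l -> T2}).
Implicit Types (g : {ffun 'I_(k + l) -> T1 + T2}).

Definition is_left (x : T1 + T2) := if x is inl _ then true else false.

Definition join u v : {ffun 'I_(k + l) -> T1 + T2} :=
  [ffun j => match split j with inl i => inl (u i) | inr i => inr (v i) end].

Definition sum_content2 (a1 : T1 -> nat) (a2 : T2 -> nat) (x : T1 + T2) :=
  match x with inl t => a1 t | inr t => a2 t end.

Definition splits g :=
  [forall i, is_left (g (lshift l i))] && [forall i, ~~ is_left (g (rshift k i))].

Lemma split_lshift i : split (lshift l i : 'I_(k + l)) = inl i.
Proof. exact: (unsplitK (inl _ i : 'I_k + 'I_l)%type). Qed.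

Lemma split_rshift i : split (rshift k i : 'I_(k + l)) = inr i.
Proof. exact: (unsplitK (inr _ i : 'I_k + 'I_l)%type). Qed.

Lemma join_lshift u v i : join u v (lshift l i) = inl (u i).
Proof. by rewrite ffunE split_lshift. Qed.

Lemma join_rshift u v i : join u v (rshift k i) = inr (v i).
Proof. by rewrite ffunE split_rshift. Qed.

Lemma splits_join u v : splits (join u v).
Proof.
by apply/andP; split; apply/forallP=> i; rewrite ?join_lshift ?join_rshift.
Qed.

Lemma joinP g : splits g -> exists u v, g = join u v.
Proof.
case/andP=> /forallP gl /forallP gr.
have [u uE] : exists u : {ffun 'I_k -> T1}, forall i, g (lshift l i) = inl (u i).
  have /fin_all_exists[f fE] i : exists t, g (lshift l i) = inl t.
    by have := gl i; case: (g _) => // t; exists t.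
  by exists (finfun f) => i; rewrite ffunE.
have [v vE] : exists v : {ffun 'I_l -> T2}, forall i, g (rshift k i) = inr (v i).
  have /fin_all_exists[f fE] i : exists t, g (rshift k i) = inr t.
    by have := gr i; case: (g _) => // t; exists t.
  by exists (finfun f) => i; rewrite ffunE.
exists u, v; apply/ffunP=> j.
by case: (split_ordP j) => i ->; rewrite ?join_lshift ?join_rshift.
Qed.

Lemma join_inj u v u' v' : join u v = join u' v' -> u = u' /\ v = v'.
Proof.
move=> /ffunP E; split; apply/ffunP=> i.
  by have := E (lshift l i); rewrite !join_lshift => -[].
by have := E (rshift k i); rewrite !join_rshift => -[].
Qed.

Lemma card_set_split (P : pred 'I_(k + l)) :
  #|[set j | P j]| =
  (#|[set i | P (lshift l i)]| + #|[set i | P (rshift k i)]|)%N.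
Proof.
by rewrite -!sum1dep_card big_split_ord.
Qed.

Lemma has_content_join a1 a2 u v :
  has_content (sum_content2 a1 a2) (join u v) =
  has_content a1 u && has_content a2 v.
Proof.
have cl t : #|[set j | join u v j == inl t]| = #|[set i | u i == t]|.
  rewrite card_set_split [X in (_ + X)%N](_ : _ = 0%N) ?addn0.
    by apply: eq_card => i; rewrite !inE join_lshift.
  by apply: eq_card0 => i; rewrite !inE join_rshift.
have cr t : #|[set j | join u v j == inr t]| = #|[set i | v i == t]|.
  rewrite card_set_split [X in (X + _)%N](_ : _ = 0%N) ?add0n.
    by apply: eq_card => i; rewrite !inE join_rshift.
  by apply: eq_card0 => i; rewrite !inE join_lshift.
apply/has_contentP/andP=> [c|[/has_contentP c1 /has_contentP c2] [t|t]].
- by split; apply/has_contentP=> t; rewrite -?cl -?cr c.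
- by rewrite cl c1.
- by rewrite cr c2.
Qed.

Lemma sum_join (V : nmodType) a1 a2 (F : {ffun 'I_(k + l) -> T1 + T2} -> V) :
  \sum_(u | has_content a1 u) \sum_(v | has_content a2 v) F (join u v) =
  \sum_(g | has_content (sum_content2 a1 a2) g && splits g) F g.
Proof.
rewrite pair_big /=.
rewrite -(big_bij
  (P := fun p : {ffun 'I_k -> T1} * {ffun 'I_l -> T2} =>
     has_content a1 p.1 && has_content a2 p.2)
  (h := fun p => join p.1 p.2)) //.
- by move=> [u v] [u' v'] _ _ /join_inj[/= -> ->].
- by move=> [u v] /= c; rewrite has_content_join c splits_join.
- move=> g /andP[gc /joinP[u [v gE]]]; exists (u, v) => //=.
  by rewrite -has_content_join -gE.
Qed.

(** Exchange of summations, shared by the two external products: with [S] the shuffles the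
    multiplicity is 1 ([card_shuffle_splits]), with [S] the whole symmetric group it is k! l!
    ([card_perm_splits]). *)
Lemma sum_perm_join (V : nmodType) a1 a2 (S : {set 'S_(k + l)})
    (F : {ffun 'I_(k + l) -> T1 + T2} -> V) :
  \sum_(p in S) \sum_(u | has_content a1 u) \sum_(v | has_content a2 v)
     F (word_perm p^-1%g (join u v)) =
  \sum_(g | has_content (sum_content2 a1 a2) g)
     F g *+ #|[set p in S | splits (word_perm p g)]|.
Proof.
pose C := has_content (sum_content2 a1 a2) : pred {ffun 'I_(k + l) -> _}.
transitivity (\sum_(p in S) \sum_(g | C g && splits (word_perm p g)) F g).
  apply: eq_bigr => p _; rewrite (sum_join _ _ (fun g => F (word_perm p^-1%g g))).
  rewrite -(sum_word_perm _ p); apply: eq_big => [g|g _].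
    by rewrite has_content_perm.
  by rewrite word_permK.
rewrite (exchange_big_dep C) /=; last by move=> p g _ /andP[].
apply: eq_bigr => g Cg; rewrite sumr_const; congr (_ *+ _).
by apply: eq_card => p; rewrite !inE Cg.
Qed.
End Join.

Lemma card_ord_lt n m : (m <= n)%N -> #|[set i : 'I_n | (i < m)%N]| = m.
Proof.
move=> le_mn; rewrite -[RHS]card_ord -!sum1_card -(big_mkord xpredT (fun=> 1%N)).
by rewrite (big_nat_widen _ _ n) // big_mkord; apply: eq_bigl => i; rewrite inE.
Qed.

Lemma down_closed_ord n (D : {set 'I_n}) :
    (forall i j : 'I_n, (i <= j)%N -> j \in D -> i \in D) ->
  forall i : 'I_n, (i \in D) = (i < #|D|)%N.
Proof.
move=> down i; apply/idP/idP=> [iD|].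
  rewrite -(card_ord_lt (ltn_ord i)); apply: subset_leq_card.
  by apply/subsetP=> j; rewrite inE => /down; apply.
apply: contraLR => iD; rewrite -leqNgt -(card_ord_lt (ltnW (ltn_ord i))).
apply: subset_leq_card; apply/subsetP=> j jD; rewrite inE ltnNge.
by apply: contra iD => /down; apply.
Qed.

(** * Shuffles as representatives modulo a Young subgroup *)

Section Shuffles.
Variables k l : nat.
Implicit Types (s t u p : 'S_(k + l)).

(** A permutation mapping the first block into itself maps it onto itself by finiteness, hence also
    preserves the second block. *)
Lemma perm_juxt u :
  (forall i, (u (lshift l i) < k)%N) -> exists a b, u = juxt_perm (k := k) (l := l) a b.
Proof.
move=> ul.
have /fin_all_exists[f fE] i : exists i', u (lshift l i) = lshift l i' :> 'I_(k + l).
  by exists (Ordinal (ul i)); apply: ord_inj.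
have finj : injective f.
  by move=> i j fij; apply: (@lshift_inj k l); apply: (@perm_inj _ u); rewrite !fE fij.
have /fin_all_exists[g gE] i : exists i', u (rshift k i) = rshift k i' :> 'I_(k + l).
  case: (split_ordP (u (rshift k i))) => j; last by exists j.
  have [f' _ ff'] : bijective f by apply: injF_bij.
  rewrite -[j]ff' -fE => /perm_inj/(congr1 val)/= E.
  by have := ltn_ord (f' j); rewrite -E ltnNge leq_addr.
have ginj : injective g.
  by move=> i j gij; apply: (@rshift_inj k l); apply: (@perm_inj _ u); rewrite !gE gij.
exists (perm finj), (perm ginj); apply/permP=> i; rewrite permE /juxt_fun.
by case: (split_ordP i) => j ->; rewrite permE.
Qed.

Lemma juxt_perm_inj (a a' : 'S_k) (b b' : 'S_l) :
  juxt_perm a b = juxt_perm a' b' -> a = a' /\ b = b'.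
Proof.
move=> /permP E; split; apply/permP=> i.
  have := E (lshift l i); rewrite !permE /juxt_fun split_lshift.
  exact: lshift_inj.
have := E (rshift k i); rewrite !permE /juxt_fun split_rshift.
exact: rshift_inj.
Qed.

Lemma juxt_lshift (a : 'S_k) (b : 'S_l) i : juxt_perm a b (lshift l i) = lshift l (a i).
Proof. by rewrite permE /juxt_fun split_lshift. Qed.

Lemma juxt_rshift (a : 'S_k) (b : 'S_l) i : juxt_perm a b (rshift k i) = rshift k (b i).
Proof. by rewrite permE /juxt_fun split_rshift. Qed.

Variables T1 T2 : finType.
Implicit Types g : {ffun 'I_(k + l) -> T1 + T2}.

(** Standardizing this rank moves the letters of [T1] to the front without reordering either kind,
    so it is the inverse of the only shuffle that can split [g]. *)
Definition right_rank g := fun j => nat_of_bool (~~ is_left (g j)).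

Lemma shufflesP p :
  reflect ((forall i j : 'I_k, (i < j)%N -> (p (lshift l i) < p (lshift l j))%N) /\
           (forall i j : 'I_l, (i < j)%N -> (p (rshift k i) < p (rshift k j))%N))
    (p \in shuffles k l).
Proof.
rewrite inE; apply: (iffP andP) => -[P1 P2]; split.
- by move=> i j; have /forallP/(_ j)/implyP := forallP P1 i.
- by move=> i j; have /forallP/(_ j)/implyP := forallP P2 i.
- by apply/forallP=> i; apply/forallP=> j; apply/implyP; apply: P1.
- by apply/forallP=> i; apply/forallP=> j; apply/implyP; apply: P2.
Qed.

Lemma shuffle_splits_std g p : p \in shuffles k l -> splits (word_perm p g) ->
  p = (std (lexw (right_rank g)))^-1%g.
Proof.
move=> /shufflesP[pl pr] /andP[/forallP gl /forallP gr].
apply: invg_inj; rewrite invgK; apply: esym; apply: std_unique.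
have mono (x y : 'I_(k + l)) : (x < y)%N ->
    (lexw (right_rank g) (p x) < lexw (right_rank g) (p y))%N.
  rewrite lexw_lt /right_rank.
  case: (split_ordP x) => i ->; case: (split_ordP y) => j -> lt_xy.
  - by have := gl i; have := gl j; rewrite !ffunE => -> ->; rewrite pl.
  - by have := gl i; have := gr j; rewrite !ffunE => /negbTE -> ->.
  - by move: lt_xy; rewrite /= ltnNge (leq_trans (ltnW (ltn_ord j)) (leq_addr _ _)).
  - have := gr i; have := gr j; rewrite !ffunE => /negbTE -> /negbTE ->.
    by rewrite pr // -(ltn_add2l k).
move=> i j; rewrite -{2}(permKV p i) -{2}(permKV p j).
case: (ltngtP (p^-1%g i) (p^-1%g j)) => [/mono-> //|/mono/ltnW|/ord_inj->].
  by rewrite leqNgt => /negbTE.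
by rewrite ltnn.
Qed.

Lemma shuffle_exists g : #|[set j | is_left (g j)]| = k ->
  exists2 p, p \in shuffles k l & splits (word_perm p g).
Proof.
move=> gk; pose w := lexw (right_rank g); pose s := std w.
have sE i j : (s i < s j)%N = (w i < w j)%N by apply/std_lt/lexw_inj.
(* The images under [s] of the positions of left letters form an initial segment, of size [k] by
   hypothesis. *)
have leftE j : is_left (g j) = (s j < k)%N.
  have D : forall i j : 'I_(k + l), (i <= j)%N ->
      j \in s @: [set j | is_left (g j)] -> i \in s @: [set j | is_left (g j)].
    move=> x y le_xy /imsetP[y']; rewrite inE => gy yE.
    apply/imsetP; exists (s^-1%g x); rewrite ?permKV // inE.
    move: le_xy; rewrite yE -{1}(permKV s x) leqNgt sE lexw_lt /right_rank gy.
    by case: (is_left _).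
  have := down_closed_ord D (s j); rewrite card_imset; last exact: perm_inj.
  by rewrite gk => <-; rewrite mem_imset ?inE //; apply: perm_inj.
have gl i : is_left (g (s^-1%g (lshift l i))) by rewrite leftE permKV /=.
have gr i : ~~ is_left (g (s^-1%g (rshift k i))).
  by rewrite leftE permKV /= -leqNgt leq_addr.
exists s^-1%g; last by apply/andP; split; apply/forallP=> i; rewrite ffunE.
apply/shufflesP; split=> i j lt_ij.
  have := sE (s^-1%g (lshift l i)) (s^-1%g (lshift l j)).
  by rewrite !permKV lexw_lt /right_rank !gl /= lt_ij.
have := sE (s^-1%g (rshift k i)) (s^-1%g (rshift k j)).
by rewrite !permKV lexw_lt /right_rank !gr /= ltn_add2l lt_ij.
Qed.

Lemma card_shuffle_splits g : #|[set j | is_left (g j)]| = k ->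
  #|[set p in shuffles k l | splits (word_perm p g)]| = 1%N.
Proof.
case/shuffle_exists=> p pS pg; apply/eqP/cards1P; exists p.
apply/setP=> q; rewrite !inE; apply/idP/eqP=> [/andP[qS qg]|->].
  by rewrite (shuffle_splits_std pS pg) -(shuffle_splits_std _ qg) // inE.
by move: pS; rewrite inE => ->.
Qed.

(** The permutations that split [g] are a coset, through any shuffle that does, of the image of S_k
    x S_l under juxtaposition. *)
Lemma card_perm_splits g : #|[set j | is_left (g j)]| = k ->
  #|[set p | splits (word_perm p g)]| = (k`! * l`!)%N.
Proof.
case/shuffle_exists=> p _ /andP[/forallP gl /forallP gr].
pose h (ab : 'S_k * 'S_l) := (juxt_perm ab.1 ab.2 * p)%g.
have hinj : injective h by move=> [a b] [a' b'] /mulIg/juxt_perm_inj[/= -> ->].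
transitivity #|h @: setT|; last by rewrite card_imset // cardsT card_prod !card_Sn.
apply: eq_card => q; rewrite inE; apply/idP/imsetP=> [|[[a b] _ ->]]; last first.
  apply/andP; split; apply/forallP=> i; rewrite ffunE permM.
    by rewrite juxt_lshift; have := gl (a i); rewrite ffunE.
  by rewrite juxt_rshift; have := gr (b i); rewrite ffunE.
case/andP=> /forallP ql _.
have [i|a [b qE]] := @perm_juxt (q * p^-1)%g; last first.
  by exists (a, b) => //; rewrite /h -qE mulgKV.
rewrite permM; case: (split_ordP (p^-1%g (q (lshift l i)))) => j E //.
by have := gr j; have := ql i; rewrite !ffunE -E permKV => ->.
Qed.

Lemma card_is_left (a1 : T1 -> nat) (a2 : T2 -> nat) g :
  has_content (sum_content2 a1 a2) g ->
  #|[set j | is_left (g j)]| = \sum_t a1 t.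
Proof.
move=> /has_contentP gc; rewrite -sum1dep_card.
transitivity (\sum_(j | is_left (g j)) \sum_(t | g j == inl t) 1)%N.
  apply: eq_bigr => j; case: (g j) => // t _.
  by rewrite (big_pred1 t) // => u; rewrite /= eq_sym.
rewrite (exchange_big_dep xpredT) //=; apply: eq_bigr => t _.
rewrite -[RHS](gc (inl t)) -sum1dep_card; apply: eq_bigl => j.
by case: (g j).
Qed.
End Shuffles.

(** * Sorted words and stabilizers *)

Section Sorted.
Variables (n : nat).
Implicit Types (s t : 'S_n) (w : 'I_n -> nat).

Lemma std_lexw1P w :
  reflect (forall i j : 'I_n, (i <= j)%N -> (w i <= w j)%N) (std (lexw w) == 1%g).
Proof.
apply: (iffP eqP) => [E i j|mono].
  rewrite leqNgt => le_ij; rewrite leqNgt; apply: contra le_ij => lt_w.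
  by have := std_lt (@lexw_inj _ w) j i; rewrite E !perm1 lexw_lt lt_w.
apply: std_unique => i j; rewrite !perm1 lexw_lt.
case: (ltngtP (w i) (w j)) => //=; case: (ltngtP i j) => //.
- by move=> /ltnW/mono; rewrite leqNgt => /negbTE->.
- by move=> /ord_inj->; rewrite ltnn.
- by move=> /ltnW/mono; rewrite leqNgt => /negbTE->.
Qed.

Lemma sorted_perm_eq w w' s :
    (forall i j : 'I_n, (i <= j)%N -> (w i <= w j)%N) ->
    (forall i j : 'I_n, (i <= j)%N -> (w' i <= w' j)%N) ->
  (forall i, w' i = w (s i)) -> w =1 w'.
Proof.
move=> mw mw' ws.
have sort (v : 'I_n -> nat) : (forall i j : 'I_n, (i <= j)%N -> (v i <= v j)%N) ->
    sorted leq (codom v).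
  move=> mv; rewrite /codom /image_mem sorted_map.
  apply: (sub_sorted (e := relpre val leq)) => [i j /=|]; first exact: mv.
  rewrite -sorted_map val_enum_ord; exact: iota_sorted.
have E : codom w = codom w'.
  apply: (sorted_eq leq_trans anti_leq); try exact: sort.
  have -> : codom w' = map w (map s (enum 'I_n)).
    by rewrite -map_comp; apply: eq_map.
  rewrite perm_sym; apply: perm_map; apply: uniq_perm; rewrite ?enum_uniq //.
    by rewrite map_inj_uniq ?enum_uniq //; apply: perm_inj.
  by move=> i; rewrite mem_enum; apply/mapP; exists (s^-1%g i); rewrite ?mem_enum ?permKV.
by move: E; rewrite !codomE => /eq_in_map E i; apply: E; rewrite mem_enum.
Qed.

Variables (T : finType) (r : T -> nat).
Hypothesis r_inj : injective r.
Implicit Types f : {ffun 'I_n -> T}.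

Definition stab_word f := [set s : 'S_n | word_perm s f == f].

(* The t such that f t is sorted form a coset of the stabilizer of f. *)
Lemma card_sort_word f :
  #|[set t | std (lexw (r \o word_perm t f)) == 1%g]| = #|stab_word f|.
Proof.
pose t0 := (std (lexw (r \o f)))^-1%g.
have sorted0 : std (lexw (r \o word_perm t0 f)) == 1%g.
  apply/std_lexw1P=> i j; rewrite /= !ffunE leqNgt => le_ij.
  rewrite leqNgt; apply: contra le_ij => lt_r.
  have := std_lt (@lexw_inj _ (r \o f)) (t0 j) (t0 i).
  by rewrite !permKV lexw_lt lt_r.
rewrite -[RHS](card_imset _ (mulgI t0)); apply: eq_card => t; rewrite inE.
apply/idP/imsetP=> [st|[s sf ->]]; last first.
  by move: sf; rewrite inE word_permM => /eqP->.
exists (t0^-1 * t)%g; last by rewrite mulKVg.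
have tE : word_perm t f = word_perm t0 f.
  apply/ffunP=> i; apply: r_inj.
  apply: (@sorted_perm_eq _ _ (t0 * t^-1)%g (std_lexw1P _ st) (std_lexw1P _ sorted0)).
  by move=> j; rewrite /= !ffunE permM permKV.
by rewrite inE word_permM tE word_permK.
Qed.

(** Double count of the pairs (s, f) such that [word_perm s f] is sorted: for fixed [s] the number
    does not depend on [s] because [P] is invariant, and for fixed [f] it is given by
    [card_sort_word]. *)
Lemma sum_sorted_words (P : pred {ffun 'I_n -> T}) :
    (forall s f, P (word_perm s f) = P f) ->
  (n`! * #|[set f | P f & std (lexw (r \o f)) == 1%g]|)%N =
  \sum_(f | P f) #|stab_word f|.
Proof.
move=> Pperm; rewrite -(card_Sn n) -sum_nat_const.
transitivity (\sum_(s : 'S_n) \sum_(f | P f) (std (lexw (r \o word_perm s f)) == 1%g))%N.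
  apply: eq_big => // s _; rewrite -sum1dep_card big_mkcondr /=.
  rewrite -(sum_word_perm _ s); apply: eq_big => [f|f _]; first by rewrite Pperm.
  by case: ifP.
rewrite exchange_big; apply: eq_bigr => f _.
by rewrite -card_sort_word -sum1dep_card [RHS]big_mkcond; apply: eq_bigr => s _; case: ifP.
Qed.
End Sorted.

Section Content.
Variables (n N : nat) (T : finType).
Hypothesis le_nN : (n <= N)%N.
Implicit Types f : {ffun 'I_n -> T}.

(** The bound [N] makes contents a finite type that can be summed over; since [n <= N], [inord]
    never falls back on its default value. *)
Definition content f : {ffun T -> 'I_N.+1} := [ffun t => inord #|[set j | f j == t]|].

Lemma eq_contentE f (c : {ffun T -> 'I_N.+1}) : (content f == c) = has_content (fun t => c t) f.
Proof.
have lt t : (#|[set j | f j == t]| < N.+1)%N.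
  by rewrite ltnS (leq_trans (max_card _)) // card_ord.
apply/eqP/has_contentP=> [<- t|fc]; first by rewrite ffunE inordK.
by apply/ffunP=> t; apply: ord_inj; rewrite ffunE inordK.
Qed.

Lemma sum_by_content (V : nmodType) (P : pred {ffun 'I_n -> T})
    (Q : pred {ffun T -> 'I_N.+1}) (F : {ffun 'I_n -> T} -> V) :
    (forall f (c : {ffun T -> 'I_N.+1}), has_content (fun t => c t) f -> P f = Q c) ->
  \sum_(f | P f) F f = \sum_(c | Q c) \sum_(f | has_content (fun t => c t) f) F f.
Proof.
move=> PQ; rewrite (partition_big content Q) /=.
  apply: eq_bigr => c Qc; apply: eq_bigl => f; rewrite eq_contentE.
  by case cf: (has_content (fun t => c t) f); rewrite ?andbF // (PQ _ _ cf) Qc.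
by move=> f; rewrite (PQ f (content f)) // -eq_contentE.
Qed.
End Content.

(** * Cutting a word into a prefix and a suffix *)

Section Cut.
Variables (k l n : nat) (e : (k + l)%N = n) (T : finType).
Implicit Types (f : {ffun 'I_n -> T}) (u : {ffun 'I_k -> T}) (v : {ffun 'I_l -> T}).

Definition cutl f : {ffun 'I_k -> T} := [ffun j => f (cast_ord e (lshift l j))].
Definition cutr f : {ffun 'I_l -> T} := [ffun j => f (cast_ord e (rshift k j))].

Lemma card_cut f t : #|[set j | f j == t]| =
  (#|[set j | cutl f j == t]| + #|[set j | cutr f j == t]|)%N.
Proof.
rewrite /cutl /cutr; case: _ / e f => f; rewrite (card_set_split (fun j => f j == t)).
by congr (_ + _)%N; apply: eq_card => j; rewrite !inE ffunE cast_ord_id.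
Qed.

Lemma sum_cut_pair (V : nmodType) (a : T -> nat)
    (F : {ffun 'I_k -> T} -> {ffun 'I_l -> T} -> V) :
  \sum_(f | has_content a f) F (cutl f) (cutr f) =
  \sum_(u : {ffun 'I_k -> T}) \sum_(v : {ffun 'I_l -> T} |
      [forall t, (#|[set j | u j == t]| + #|[set j | v j == t]|)%N == a t])
    F u v.
Proof.
rewrite pair_big_dep /= -(big_bij (P := fun f => has_content a f)
  (h := fun f => (cutl f, cutr f))) //.
- move=> f g _ _ [/ffunP fl /ffunP fr]; apply/ffunP=> j.
  rewrite -[j](cast_ordKV e).
  case: (split_ordP (cast_ord (esym e) j)) => i ->.
    by have := fl i; rewrite !ffunE.
  by have := fr i; rewrite !ffunE.
- by move=> f /has_contentP fa /=; apply/forallP=> t; rewrite -fa card_cut.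
- move=> [u v] /= /forallP uv.
  pose f := [ffun j => match split (cast_ord (esym e) j) with inl i => u i | inr i => v i end].
  have fl : cutl f = u.
    by apply/ffunP=> i; rewrite !ffunE cast_ordK split_lshift.
  have fr : cutr f = v.
    by apply/ffunP=> i; rewrite !ffunE cast_ordK split_rshift.
  exists f; last by rewrite fl fr.
  by apply/has_contentP=> t; rewrite card_cut fl fr (eqP (uv t)).
Qed.

Lemma sum_cut (V : nmodType) (a : T -> nat)
    (F : {ffun 'I_k -> T} -> {ffun 'I_l -> T} -> V) :
  \sum_(f | has_content a f) F (cutl f) (cutr f) =
  \sum_(c : {ffun T -> 'I_n.+1} | [forall t, (c t <= a t)%N])
    \sum_(u | has_content (fun t => c t) u)
      \sum_(v | has_content (fun t => a t - c t)%N v) F u v.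
Proof.
rewrite sum_cut_pair; have le_kn : (k <= n)%N by rewrite -e leq_addr.
rewrite (partition_big (@content k n T) xpredT) //= [RHS]big_mkcond /=.
apply: eq_bigr => c _; under eq_bigl => u do rewrite eq_contentE //.
(* A content exceeding [a] at some letter cannot be that of a prefix; in the remaining case the
   subtraction [a t - c t] does not truncate. *)
case: ifP => [/forallP ca|/negbT]; last first.
  rewrite negb_forall => /existsP[t]; rewrite -ltnNge => lt_t.
  apply: big1 => u /has_contentP uc; apply: big_pred0 => v.
  apply/negbTE; rewrite negb_forall; apply/existsP; exists t.
  by rewrite uc neq_ltn (leq_trans lt_t) ?orbT // leq_addr.
apply: eq_bigr => u /has_contentP uc; apply: eq_bigl => v.
apply: eq_forallb => t; rewrite uc.
by rewrite -[in LHS](subnKC (ca t)) eqn_add2l.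
Qed.
End Cut.

(** * Words on pairs of letters *)

Section Pairing.
Variables (n : nat) (T1 T2 : finType).
Implicit Types (u : {ffun 'I_n -> T1}) (v : {ffun 'I_n -> T2}).
Implicit Types (f : {ffun 'I_n -> T1 * T2}).

Definition margins (a : T1 -> nat) (b : T2 -> nat) (c : T1 * T2 -> nat) :=
  [forall x, (\sum_y c (x, y))%N == a x] && [forall y, (\sum_x c (x, y))%N == b y].

Lemma card_fst f (x : T1) :
  #|[set j | (f j).1 == x]| = (\sum_y #|[set j | f j == (x, y)]|)%N.
Proof.
rewrite -sum1dep_card (partition_big (fun j => (f j).2) xpredT) //=.
apply: eq_bigr => y _; rewrite -sum1dep_card; apply: eq_bigl => j.
by case: (f j).
Qed.

Lemma card_snd f (y : T2) :
  #|[set j | (f j).2 == y]| = (\sum_x #|[set j | f j == (x, y)]|)%N.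
Proof.
rewrite -sum1dep_card (partition_big (fun j => (f j).1) xpredT) //=.
apply: eq_bigr => x _; rewrite -sum1dep_card; apply: eq_bigl => j.
by rewrite andbC; case: (f j).
Qed.

Definition has_margins a b f :=
  [forall x, #|[set j | (f j).1 == x]| == a x] &&
  [forall y, #|[set j | (f j).2 == y]| == b y].

Lemma sum_pairing (V : nmodType) a b (F : {ffun 'I_n -> T1 * T2} -> V) :
  \sum_(u | has_content a u) \sum_(v | has_content b v) F [ffun j => (u j, v j)] =
  \sum_(f | has_margins a b f) F f.
Proof.
have mE u v : has_margins a b [ffun j => (u j, v j)] = has_content a u && has_content b v.
  congr (_ && _); apply: eq_forallb => t; congr (_ == _);
    by apply: eq_card => j; rewrite !inE ffunE.
rewrite pair_big /= -(big_bij (P := fun p : {ffun 'I_n -> T1} * {ffun 'I_n -> T2} =>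
  has_content a p.1 && has_content b p.2) (h := fun p => [ffun j => (p.1 j, p.2 j)])) //.
- move=> [u v] [u' v'] _ _ /ffunP E; congr (_, _); apply/ffunP=> j;
    by have := E j; rewrite !ffunE /= => -[].
- by move=> [u v]; rewrite mE.
- move=> f fab; have fE : f = [ffun j => ([ffun i => (f i).1] j, [ffun i => (f i).2] j)].
    by apply/ffunP=> j; rewrite !ffunE; case: (f j).
  by exists ([ffun i => (f i).1], [ffun i => (f i).2]) => //=; rewrite -mE -fE.
Qed.

(** The contents [c] are the matrices of natural numbers with given row and column sums, which index
    the double cosets of two Young subgroups in Mackey's formula. *)
Lemma sum_pairing_content (V : nmodType) a b (F : {ffun 'I_n -> T1 * T2} -> V) :
  \sum_(u | has_content a u) \sum_(v | has_content b v) F [ffun j => (u j, v j)] =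
  \sum_(c : {ffun T1 * T2 -> 'I_n.+1} | margins a b (fun t => c t))
    \sum_(f | has_content (fun t => c t) f) F f.
Proof.
rewrite sum_pairing; apply: sum_by_content => // f c /has_contentP fc.
congr (_ && _); apply: eq_forallb => t; congr (_ == _).
  by rewrite card_fst; apply: eq_bigr => y _; rewrite fc.
by rewrite card_snd; apply: eq_bigr => y _; rewrite fc.
Qed.
End Pairing.

(** * Products of generators as sums over words *)

Section ColoredWords.
Variable gT : finGroupType.
Local Notation Gamma := (dual gT).

Section Elements.
Variables (T : finType) (r : T -> nat) (c : T -> Gamma).

Definition elt n (f : {ffun 'I_n -> T}) : wreath Gamma n :=
  Wreath [ffun j => c (f j)] (std (lexw (r \o f)))^-1%g.

(* This is 0 if the contents of the letters do not add up to n. *)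
Definition wsum n (a : T -> nat) : fmod gT :=
  \sum_(f : {ffun 'I_n -> T} | has_content a f) << fbasis_in (elt f) >>.
End Elements.

Lemma elt_ext (T U : finType) (r : T -> nat) (r' : U -> nat) c c' n
    (f : {ffun 'I_n -> T}) (g : {ffun 'I_n -> U}) :
    (forall i j, (r (f i) < r (f j))%N = (r' (g i) < r' (g j))%N) ->
    (forall i, c (f i) = c' (g i)) ->
  elt r c f = elt r' c' g.
Proof.
move=> rr cc; congr Wreath; first by apply/ffunP=> i; rewrite !ffunE.
congr (_^-1)%g; apply: eq_std => [|i j]; first exact: lexw_inj.
by rewrite !lexw_lt /= rr !eqn_leq ![(r _ <= _)%N]leqNgt ![(r' _ <= _)%N]leqNgt !rr.
Qed.

Lemma wsum_relabel (T U : finType) (r : T -> nat) (r' : U -> nat) c c' n a b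
    (h : T -> U) :
    injective h -> (forall t, b (h t) = a t) ->
    (forall u, u \notin codom h -> b u = 0%N) ->
    (forall t, c' (h t) = c t) ->
    (forall t u, (r' (h t) < r' (h u))%N = (r t < r u)%N) ->
  wsum r c n a = wsum r' c' n b.
Proof.
move=> hinj ba b0 cc rr.
rewrite /wsum -(sum_relabel hinj ba b0 (fun f => << fbasis_in (elt r' c' f) >>)).
apply: eq_bigr => f _; congr << fbasis_in _ >>.
by apply: elt_ext => i; rewrite !ffunE // => j; rewrite !ffunE.
Qed.

Lemma wsum_degree (T : finType) (r : T -> nat) c n a :
  \sum_t a t != n -> wsum r c n a = 0.
Proof.
by move=> an; apply: big_pred0 => f; apply: contraNF an => /sum_content->.
Qed.

Section ExternalProduct.
Variables (T1 T2 : finType) (r1 : T1 -> nat) (r2 : T2 -> nat).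
Variables (c1 : T1 -> Gamma) (c2 : T2 -> Gamma).

(** The shift places every letter of [T2] above every letter of [T1], as the second factor of an
    external product requires. *)
Definition sum_rank (x : T1 + T2) :=
  match x with inl t => r1 t | inr t => ((\max_t r1 t).+1 + r2 t)%N end.
Definition sum_color (x : T1 + T2) := match x with inl t => c1 t | inr t => c2 t end.

(** A shuffle is increasing on each block, so it preserves the breaking of ties from left to right
    inside each factor; between the blocks the shifted ranks decide. *)
Lemma perm_act_juxt k l (u : {ffun 'I_k -> T1}) (v : {ffun 'I_l -> T2}) p :
  p \in shuffles k l ->
  perm_act p (juxt (elt r1 c1 u, elt r2 c2 v)) =
  elt sum_rank sum_color (word_perm p^-1%g (join u v)).
Proof.
move=> /shufflesP[pl pr]; congr Wreath.
  apply/ffunP=> j; rewrite !ffunE.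
  by case: (split_ordP (p^-1%g j)) => i _; rewrite ffunE.
rewrite /= -[LHS]invgK; congr (_^-1)%g; rewrite invMg juxt_permV !invgK.
apply/esym/std_unique => i j; rewrite !permM lexw_lt /= !ffunE.
rewrite -(permKV p i) -(permKV p j).
move: (p^-1%g i) (p^-1%g j) => {}i {}j; rewrite !permK.
have ltb (x : 'I_k) (y : 'I_l) : (r1 (u x) < (\max_t r1 t).+1 + r2 (v y))%N.
  by rewrite addSn ltnS (leq_trans (leq_bigmax _)) ?leq_addr.
have mono n (g : 'I_n -> 'I_(k + l)) : (forall i j : 'I_n, (i < j)%N -> (g i < g j)%N) ->
    forall i j : 'I_n, (g i < g j)%N = (i < j)%N.
  move=> gm i' j'; case: (ltngtP i' j') => [/gm->//|/gm/ltnW|/ord_inj->].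
    by rewrite leqNgt => /negbTE.
  by rewrite ltnn.
case: (split_ordP i) => x ->; case: (split_ordP j) => y ->;
  rewrite ?juxt_lshift ?juxt_rshift /= ?ltn_add2l ?eqn_add2l.
- rewrite (mono _ (fun x => p (lshift l x)) pl) std_lt ?lexw_lt //; exact: lexw_inj.
- rewrite ltb /=; apply: leq_trans (ltn_ord _) (leq_addr _ _).
- rewrite ltnNge (leq_trans (ltnW (ltn_ord _)) (leq_addr _ _)).
  by rewrite ltnNge ltnW ?ltb // gtn_eqF ?ltb.
- rewrite (mono _ (fun x => p (rshift k x)) pr) std_lt ?lexw_lt //; exact: lexw_inj.
Qed.

(** Every word over the disjoint union with the joint content has exactly [k] left letters, so
    exactly one shuffle produces it. *)
Lemma ext_mul_wsum k l a1 a2 : \sum_t a1 t = k ->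
  ext_mul (wsum r1 c1 k a1) (wsum r2 c2 l a2) =
  wsum sum_rank sum_color (k + l) (sum_content2 a1 a2).
Proof.
move=> a1k; rewrite /ext_mul /wsum extend2_sum.
under eq_bigr => u _ do under eq_bigr => v _ do rewrite extend2UU /=.
under eq_bigr => u _ do rewrite exchange_big /=.
rewrite exchange_big /=.
transitivity (\sum_(p in shuffles k l) \sum_(u | has_content a1 u)
  \sum_(v | has_content a2 v) (<< fbasis_in (elt sum_rank sum_color
     (word_perm p^-1%g (join u v))) >> : fmod gT)).
  apply: eq_bigr => p pS; apply: eq_bigr => u _; apply: eq_bigr => v _.
  by rewrite perm_act_juxt.
rewrite (sum_perm_join _ _ _ (fun g => << fbasis_in (elt sum_rank sum_color g) >> : fmod gT)).
apply: eq_bigr => g gc.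
by rewrite card_shuffle_splits // (card_is_left gc).
Qed.
End ExternalProduct.
End ColoredWords.

(** * The internal product on sums over words *)

Section InternalProduct.
Variable gT : finGroupType.
Local Notation Gamma := (dual gT).
Variables (T1 T2 : finType) (r1 : T1 -> nat) (r2 : T2 -> nat).
Variables (c1 : T1 -> Gamma) (c2 : T2 -> Gamma).

(** Lexicographic order with the second letter compared first, encoded as a number in mixed
    radix. *)
Definition pair_rank (x : T1 * T2) := (r2 x.2 * (\max_t r1 t).+1 + r1 x.1)%N.
Definition pair_color (x : T1 * T2) := (c1 x.1 * c2 x.2)%g.

Lemma pair_rank_lt x y : (pair_rank x < pair_rank y)%N =
  (r2 x.2 < r2 y.2)%N || (r2 x.2 == r2 y.2) && (r1 x.1 < r1 y.1)%N.
Proof.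
rewrite /pair_rank; set R := (\max_t r1 t).+1.
have ltR t : (r1 t < R)%N by rewrite ltnS leq_bigmax.
case: (ltngtP (r2 x.2) (r2 y.2)) => [lt_xy|lt_yx|->] /=.
- apply: (@leq_trans ((r2 x.2).+1 * R)%N); first by rewrite mulSnr -addnS leq_add2l.
  by rewrite (leq_trans _ (leq_addr _ _)) // leq_mul2r lt_xy orbT.
- apply/negbTE; rewrite -leqNgt (@leq_trans ((r2 y.2).+1 * R)%N) //.
    by rewrite mulSnr leq_add2l ltnW.
  by rewrite (leq_trans _ (leq_addr _ _)) // leq_mul2r lt_yx orbT.
- by rewrite ltn_add2l.
Qed.

Lemma pair_rank_eq x y :
  (pair_rank x == pair_rank y) = (r2 x.2 == r2 y.2) && (r1 x.1 == r1 y.1).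
Proof.
have := pair_rank_lt x y; have := pair_rank_lt y x.
by case: (ltngtP (r2 x.2) (r2 y.2)); case: (ltngtP (r1 x.1) (r1 y.1));
  case: (ltngtP (pair_rank x) (pair_rank y)).
Qed.

Lemma pair_rank_inj : injective r1 -> injective r2 -> injective pair_rank.
Proof.
move=> i1 i2 [x1 x2] [y1 y2] /eqP; rewrite pair_rank_eq /=.
by case/andP=> /eqP/i2-> /eqP/i1->.
Qed.

(** With s and t the standardizations of u and v, the inverse of the product permutation is i -> t
    (s i). It compares the letters of [v] at s i and s j, then s i and s j themselves, that is the
    letters of [u] and finally the positions. *)
Lemma eltM n (u : {ffun 'I_n -> T1}) (v : {ffun 'I_n -> T2}) :
  (elt r1 c1 u * elt r2 c2 v)%g =
  elt pair_rank pair_color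
    [ffun j => (u j, word_perm (std (lexw (r1 \o u))) v j)].
Proof.
congr Wreath; first by apply/ffunP=> i; rewrite !ffunE /= invgK.
rewrite /= -invMg; congr (_^-1)%g; apply/esym/std_unique => i j.
rewrite !permM std_lt; last exact: lexw_inj.
rewrite !lexw_lt /= !ffunE pair_rank_lt /= std_lt; last exact: lexw_inj.
by rewrite lexw_lt pair_rank_eq /= andb_orr andbA orbA.
Qed.

(** For fixed [u], the rearrangement of [v] in [eltM] permutes the words of content [a2], so it
    disappears from the sum and plain pairs of words remain. *)
Lemma int_mul_wsum n a1 a2 :
  int_mul (wsum r1 c1 n a1) (wsum r2 c2 n a2) =
  \sum_(c : {ffun T1 * T2 -> 'I_n.+1} | margins a1 a2 (fun t => c t))
     wsum pair_rank pair_color n (fun t => c t).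
Proof.
rewrite /int_mul /wsum extend2_sum -sum_pairing_content.
apply: eq_bigr => u _; set s := std (lexw (r1 \o u)).
rewrite -[RHS](sum_word_perm _ s); apply: eq_big => v; first by rewrite has_content_perm.
by move=> _; rewrite extend2UU /= eqxx tagged_asE eltM.
Qed.
End InternalProduct.

(** * Products of generators indexed by coloured compositions *)

Section ColoredCompositions.
Variable gT : finGroupType.
Local Notation Gamma := (dual gT).
Local Notation word := (seq (nat * Gamma)).
Implicit Types w : word.

Definition weight w := sumn (unzip1 w).
Definition wsize w (i : 'I_(size w)) : nat := (nth (0%N, 1%g) w i).1.
Definition wcolor w (i : 'I_(size w)) : Gamma := (nth (0%N, 1%g) w i).2.

(* The product of the generators y_{m,c} for the pairs (m, c) of w if their   *)
(* degrees add up to n, and 0 otherwise.                                      *)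
Definition wprod n w : fmod gT := wsum val (wcolor (w := w)) n (@wsize w).

Lemma sum_wsize w : (\sum_i wsize (w := w) i)%N = weight w.
Proof.
rewrite /weight sumnE big_map (big_nth (0%N, 1%g)) big_mkord.
by apply: eq_bigr.
Qed.

Lemma weight_cat u v : weight (u ++ v) = (weight u + weight v)%N.
Proof. by rewrite /weight /unzip1 map_cat sumn_cat. Qed.

Lemma wprod_degree n w : weight w != n -> wprod n w = 0.
Proof. by move=> wn; apply: wsum_degree; rewrite sum_wsize. Qed.

Section WordOf.
Variables (T : finType) (r : T -> nat) (c : T -> Gamma) (a : T -> nat).

Definition word_of : word := [seq (a t, c t) | t <- sort (relpre r leq) (enum T)].

Lemma weight_word_of : weight word_of = (\sum_t a t)%N.
Proof.
rewrite /weight /unzip1 -map_comp sumnE big_map /= -[RHS]big_enum /=.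
by apply: perm_big; rewrite perm_sort.
Qed.

Lemma word_ofP : exists h : 'I_(size word_of) -> T,
  [/\ injective h, forall t, t \in codom h,
      forall i, a (h i) = wsize i /\ c (h i) = wcolor i &
      injective r -> forall i j, (r (h i) < r (h j))%N = (i < j)%N].
Proof.
pose e := sort (relpre r leq) (enum T).
have sz : size word_of = size e by rewrite size_map.
have lt_e (i : 'I_(size word_of)) : (i < size e)%N by rewrite -sz.
pose h i := tnth (in_tuple e) (Ordinal (lt_e i)).
have hE t0 (i : 'I_(size word_of)) : h i = nth t0 e i by apply: tnth_nth.
have ue : uniq e by rewrite sort_uniq enum_uniq.
exists h; split.
- move=> i j E; have t0 := h i; move: E; rewrite !(hE t0) => /eqP.
  by rewrite nth_uniq // => /eqP/ord_inj.
- move=> t; have te : t \in e by rewrite mem_sort mem_enum.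
  have lt_i : (index t e < size word_of)%N by rewrite sz index_mem.
  by apply/codomP; exists (Ordinal lt_i); rewrite (hE t) nth_index.
- move=> i; have t0 := h i; rewrite (hE t0) /wsize /wcolor.
  by rewrite (nth_map t0).
- move=> rinj; have mono (i j : 'I_(size word_of)) : (i < j)%N -> (r (h i) < r (h j))%N.
    move=> lt_ij; have t0 := h i; rewrite ltn_neqAle (inj_eq rinj) !(hE t0).
    rewrite nth_uniq // (ltn_eqF lt_ij) /=.
    have tr : transitive (relpre r leq) by move=> x y z; apply: leq_trans.
    have se : sorted (relpre r leq) e by apply: sort_sorted => x y; apply: leq_total.
    by have /(_ i j (lt_e i) (lt_e j) lt_ij) := sorted_ltn_nth tr t0 se.
  move=> i j; case: (ltngtP i j) => [/mono-> //|/mono/ltnW|/ord_inj->].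
    by rewrite leqNgt => /negbTE.
  by rewrite ltnn.
Qed.

(** Turns the sums over auxiliary alphabets, such as those of [int_mul_wsum] and [coprod_wsum], back
    into products of generators; this is how they are seen to lie in MR. *)
Lemma wsum_word_of n : injective r -> wsum r c n a = wprod n word_of.
Proof.
move=> rinj; have [h [hinj hsurj hE hr]] := word_ofP.
symmetry; apply: (wsum_relabel n hinj) => [t|u|t|t u].
- by case: (hE t).
- by rewrite hsurj.
- by case: (hE t).
- by rewrite hr.
Qed.
End WordOf.

Lemma wprod_cat u v :
  ext_mul (wprod (weight u) u) (wprod (weight v) v) =
  wprod (weight (u ++ v)) (u ++ v).
Proof.
rewrite ext_mul_wsum ?sum_wsize // weight_cat.
have sz := size_cat u v.
pose h (x : 'I_(size u) + 'I_(size v)) : 'I_(size (u ++ v)) :=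
  cast_ord (esym sz) (unsplit x).
have nthl (i : 'I_(size u)) : nth (0%N, 1%g) (u ++ v) (h (inl i)) = nth (0%N, 1%g) u i.
  by rewrite /= nth_cat ltn_ord.
have nthr (i : 'I_(size v)) : nth (0%N, 1%g) (u ++ v) (h (inr i)) = nth (0%N, 1%g) v i.
  by rewrite /= nth_cat ltnNge leq_addr addKn.
apply: (wsum_relabel _ (h := h)).
- move=> x y /cast_ord_inj; exact: (can_inj (@unsplitK _ _)).
- by case=> i; rewrite /wsize ?nthl ?nthr.
- move=> i; case/negP; apply/codomP; exists (split (cast_ord sz i)).
  by rewrite /h splitK cast_ordK.
- by case=> i; rewrite /wcolor ?nthl ?nthr.
- move=> [i|i] [j|j] //=.
  + rewrite (leq_trans (ltn_ord i) (leq_addr _ _)).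
    apply/esym; rewrite addSn ltnS (leq_trans _ (leq_addr _ _)) //.
    exact: (@leq_bigmax _ (fun x : 'I_(size u) => x : nat)).
  + rewrite ltnNge (leq_trans (ltnW (ltn_ord j)) (leq_addr _ _)) /=.
    apply/esym/negbTE; rewrite -leqNgt addSn ltnW // ltnS (leq_trans _ (leq_addr _ _)) //.
    exact: (@leq_bigmax _ (fun x : 'I_(size u) => x : nat)).
  + by rewrite !ltn_add2l.
Qed.

Lemma wprod_nil : wprod 0 [::] = ext_one gT.
Proof.
rewrite /wprod /wsum (big_pred1 [ffun i => i]) => [|f].
  congr << fbasis_in _ >>; congr Wreath; first by apply/ffunP=> -[].
  by apply/permP=> -[].
have -> : f = [ffun i => i] by apply/ffunP=> -[].
by rewrite /= eqxx; apply/has_contentP=> -[].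
Qed.

Lemma wprod1 n c : wprod n [:: (n, c)] = ygen n c.
Proof.
rewrite /wprod /wsum (big_pred1 [ffun=> ord0]) => [|f].
  congr << fbasis_in _ >>; congr Wreath; first by apply/ffunP=> j; rewrite !ffunE.
  apply: invg_inj; rewrite invgK invg1; apply: std_unique => i j.
  by rewrite !perm1 lexw_lt /= !ffunE ltnn eqxx.
have -> : f = [ffun=> ord0] by apply/ffunP=> i; rewrite ffunE [f i]ord1.
rewrite /= eqxx; apply/has_contentP=> t; rewrite (ord1 t) /wsize /=.
by rewrite -[RHS]card_ord; apply: eq_card => j; rewrite !inE ffunE.
Qed.
End ColoredCompositions.

(** * The algebra MR and its homogeneous components *)

Section MantaciReutenauer.
Variable gT : finGroupType.
Local Notation Gamma := (dual gT).
Local Notation word := (seq (nat * Gamma)).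
Implicit Types (w : word) (x y : fmod gT) (s : seq (int * word)).

Lemma MR0 : MR (0 : fmod gT).
Proof. rewrite -(subrr (ext_one gT)); apply: MR_sub; exact: MR_one. Qed.

Lemma MR_opp x : MR x -> MR (- x).
Proof. by move=> Rx; rewrite -sub0r; apply: MR_sub => //; apply: MR0. Qed.

Lemma MR_add x y : MR x -> MR y -> MR (x + y).
Proof. by move=> Rx Ry; rewrite -[y]opprK; apply: MR_sub => //; apply: MR_opp. Qed.

Lemma MR_sum (I : Type) (r : seq I) (P : pred I) F :
  (forall i, P i -> MR (F i : fmod gT)) -> MR (\sum_(i <- r | P i) F i).
Proof. by move=> RF; apply: big_ind => //; [apply: MR0|apply: MR_add]. Qed.

Lemma MR_mulz x (m : int) : MR x -> MR (x *~ m).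
Proof.
move=> Rx; case: m => m; last rewrite NegzE mulrNz; rewrite -?pmulrn.
  by elim: m => [|m IH]; rewrite ?mulr0n ?mulrS; [apply: MR0|apply: MR_add].
apply: MR_opp; elim: m => [|m IH]; rewrite ?mulr1n // mulrS; exact: MR_add.
Qed.

Lemma MR_wprod_weight w : MR (wprod (weight w) w).
Proof.
elim: w => [|[n c] w IH]; first by rewrite wprod_nil; apply: MR_one.
rewrite -cat1s -wprod_cat; apply: MR_mul => //.
by rewrite /weight /= addn0 wprod1; apply: MR_gen.
Qed.

Lemma MR_wprod n w : MR (wprod n w).
Proof.
case: (weight w =P n) => [<-|/eqP/wprod_degree->]; last exact: MR0.
exact: MR_wprod_weight.
Qed.

Lemma MR_wsum (T : finType) (r : T -> nat) c n a :
  injective r -> MR (wsum r c n a : fmod gT).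
Proof. by move=> /wsum_word_of->; apply: MR_wprod. Qed.

Definition zcomb s : fmod gT := \sum_(p <- s) wprod (weight p.2) p.2 *~ p.1.

Lemma MR_zcomb x : MR x -> exists s, x = zcomb s.
Proof.
elim=> [|n c|{}x y _ [s ->] _ [t ->]|{}x y _ [s ->] _ [t ->]].
- by exists [:: (1, [::])]; rewrite /zcomb big_seq1 /= wprod_nil.
- exists [:: (1, [:: (n, c)])]; rewrite /zcomb big_seq1.
  by rewrite /weight /= addn0 wprod1.
- exists (s ++ [seq (- p.1, p.2) | p <- t]).
  rewrite /zcomb big_cat big_map; congr (_ + _); rewrite -sumrN.
  by apply: eq_bigr => p _; rewrite mulrNz.
- exists [seq (p.1 * q.1, p.2 ++ q.2) | p <- s, q <- t].
  rewrite /zcomb big_allpairs_dep /= /ext_mul extend2_sumz.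
  by apply: eq_bigr => p _; apply: eq_bigr => q _; rewrite -wprod_cat.
Qed.

(** Products of generators span MR over the integers ([MR_zcomb]), so additive statements are
    checked on them alone. *)
Lemma MR_ind (P : fmod gT -> Prop) :
    (forall w, P (wprod (weight w) w)) ->
    P 0 -> (forall x y, P x -> P y -> P (x - y)) ->
  forall x, MR x -> P x.
Proof.
move=> Pw P0 PB x /MR_zcomb[s ->].
have PN y : P y -> P (- y) by move=> Py; rewrite -sub0r; apply: PB.
have PD y z : P y -> P z -> P (y + z).
  by move=> Py Pz; rewrite -[z]opprK; apply: PB => //; apply: PN.
have PMn y m : P y -> P (y *+ m).
  by move=> Py; elim: m => [|m IH]; rewrite ?mulr0n ?mulrS //; apply: PD.
apply: big_ind => // p _; case: p.1 => m; last rewrite NegzE mulrNz; rewrite -?pmulrn.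
  exact: PMn.
by apply: PN; apply: PMn.
Qed.

Lemma wprod_homogeneous n w : homogeneous n (wprod n w : fmod gT).
Proof.
rewrite /wprod /wsum; apply: (big_ind (homogeneous n)).
- by move=> b; rewrite msupp0 inE.
- move=> x y xn yn b /(fsubsetP (msuppD_le x y)); rewrite in_fsetU.
  by case/orP=> [/xn|/yn].
- by move=> f _ b /(fsubsetP msuppU_le); rewrite in_fset1 => /eqP->.
Qed.

Definition proj_degree n : fmod gT -> fmod gT :=
  extend1 (fun b => if tag b == n then << b >> else 0).

HB.instance Definition _ n := GRing.Additive.copy (proj_degree n)
  (extend1 (fun b : fbasis gT => if tag b == n then << b >> : fmod gT else 0)).

Lemma proj_degree_id n x : homogeneous n x -> proj_degree n x = x.
Proof.
move=> xn; rewrite {2}(malg_sumE x) /proj_degree /extend1.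
by apply: eq_big_seq => b bx; rewrite xn ?eqxx.
Qed.

Lemma proj_degree_neq m n x : homogeneous m x -> m != n -> proj_degree n x = 0.
Proof.
move=> xm mn; rewrite /proj_degree /extend1 big_seq big1 // => b bx.
by rewrite xm // (negbTE mn) mul0rz.
Qed.

Lemma homogeneousB n x y : homogeneous n x -> homogeneous n y -> homogeneous n (x - y).
Proof.
move=> xn yn b /(fsubsetP (msuppB_le x y)); rewrite in_fsetU.
by case/orP=> [/xn|/yn].
Qed.

Lemma homogeneous0 n : homogeneous n (0 : fmod gT).
Proof. by move=> b; rewrite msupp0 inE. Qed.

(** [MR_ind] for the degree [n] projection, which fixes [x] and kills the products of generators of
    any other weight. *)
Lemma MRn_ind n (P : fmod gT -> Prop) :
    (forall w, weight w = n -> P (wprod n w)) ->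
    P 0 -> (forall x y, P x -> P y -> P (x - y)) ->
  forall x, MRn n x -> P x.
Proof.
move=> Pw P0 PB x [Rx xn]; rewrite -(proj_degree_id xn).
elim/MR_ind: x / Rx {xn} => [w||x y Px Py]; rewrite ?raddf0 ?raddfB //; last exact: PB.
case: (weight w =P n) => [wn|/eqP wn].
  by rewrite wn proj_degree_id; [apply: Pw|apply: wprod_homogeneous].
by rewrite (proj_degree_neq _ wn) //; apply: wprod_homogeneous.
Qed.

Lemma MRnB n x y : MRn n x -> MRn n y -> MRn n (x - y).
Proof. by move=> [Rx xn] [Ry yn]; split; [apply: MR_sub|apply: homogeneousB]. Qed.

Lemma MRn0 n : MRn n (0 : fmod gT).
Proof. by split; [apply: MR0|apply: homogeneous0]. Qed.

Lemma MRn_wprod n w : MRn n (wprod n w : fmod gT).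
Proof. by split; [apply: MR_wprod|apply: wprod_homogeneous]. Qed.

Lemma MRn_sum n (I : Type) (r : seq I) (P : pred I) F :
  (forall i, P i -> MRn n (F i : fmod gT)) -> MRn n (\sum_(i <- r | P i) F i).
Proof.
move=> RF; apply: big_ind => //; first exact: MRn0.
move=> x y Rx Ry; rewrite -[y]opprK; apply: MRnB => //.
by rewrite -sub0r; apply: MRnB => //; apply: MRn0.
Qed.

Lemma MRn_wsum (T : finType) (r : T -> nat) c n a :
  injective r -> MRn n (wsum r c n a : fmod gT).
Proof. by move=> /wsum_word_of->; apply: MRn_wprod. Qed.

Lemma MRn_int_mul n x y : MRn n x -> MRn n y -> MRn n (int_mul x y).
Proof.
move=> Rx Ry; move: x Rx; apply: MRn_ind => [w _||x x' IHx IHx'].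
- move: y Ry; apply: MRn_ind => [v _||y y' IHy IHy'].
  + rewrite int_mul_wsum; apply: MRn_sum => c _; apply: MRn_wsum.
    by apply: pair_rank_inj; apply: val_inj.
  + by rewrite /int_mul raddf0; apply: MRn0.
  + by rewrite /int_mul raddfB; apply: MRnB.
- by rewrite /int_mul extend2C raddf0; apply: MRn0.
- by rewrite /int_mul extend2_is_additivel; apply: MRnB.
Qed.

Lemma MRn_one n : MRn n (ygen n (1%g : Gamma)).
Proof. by rewrite -wprod1; apply: MRn_wprod. Qed.
End MantaciReutenauer.

(** * Monomial characters of wreath products *)

Section MonomialCharacters.
Variable gT : finGroupType.
Local Notation Gamma := (dual gT).

Lemma dual_charM (c : Gamma) : {morph dual_char c : x y / (x * y)%g >-> x * y}.
Proof. by move=> x y; rewrite lin_charM ?dual_lin ?inE. Qed.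

Lemma dual_char1 (c : Gamma) : dual_char c 1%g = 1.
Proof. by rewrite lin_char1 ?dual_lin. Qed.

Lemma dual_mulE (c d : Gamma) x : dual_char (c * d)%g x = dual_char c x * dual_char d x.
Proof. by rewrite dual_ofE cfunE. Qed.

Lemma dual_oneE x : dual_char (1%g : Gamma) x = 1.
Proof. by rewrite dual_ofE cfun1E inE. Qed.

Lemma dual_invE (c : Gamma) x : dual_char c^-1%g x = (dual_char c x)^*.
Proof.
have E : dual_char c^-1%g x * dual_char c x = 1.
  by rewrite -dual_mulE mulVg dual_oneE.
have N : (dual_char c x)^* * dual_char c x = 1.
  by rewrite mulrC -normCK normC_lin_char ?dual_lin ?inE // expr1n.
have nz : dual_char c x != 0.
  by apply/eqP=> z; move/eqP: N; rewrite z mulr0 eq_sym oner_eq0.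
by apply: (mulIf nz); rewrite E N.
Qed.

Section Letters.
Variables (n : nat) (T : finType) (c : T -> Gamma).
Local Notation W := (wreath gT n).
Implicit Types (f : {ffun 'I_n -> T}) (h : W).

Definition word_eval h f : algC := \prod_j dual_char (c (f j)) (wr_base h j).

(** The diagonal coefficient at [f] of the monomial matrix of [h] on words. *)
Definition word_char h f : algC :=
  (word_perm (wr_perm h) f == f)%:R * word_eval h f.

Lemma word_evalM h k f :
  word_eval (h * k)%g f = word_eval h f * word_eval k (word_perm (wr_perm h) f).
Proof.
rewrite /word_eval [X in _ * X](reindex_perm (wr_perm h)^-1) -big_split /=.
by apply: eq_bigr => j _; rewrite !ffunE dual_charM permKV.
Qed.

Lemma word_eval1 f : word_eval 1%g f = 1.
Proof. by rewrite /word_eval big1 // => j _; rewrite ffunE dual_char1. Qed.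

Lemma word_charJ h y f :
  word_char (h ^ y)%g f = word_char h (word_perm (wr_perm y)^-1%g f).
Proof.
have sJ : wr_perm (h ^ y)%g = (wr_perm y * wr_perm h * (wr_perm y)^-1)%g.
  by rewrite conjgE.
rewrite /word_char sJ !word_permM (can2_eq (word_permK _) (word_permKV _)).
case: eqP => [fix_f|]; rewrite ?mul0r // !mul1r.
by rewrite conjgE !word_evalM fix_f mulrCA -word_evalM mulVg word_eval1 mulr1.
Qed.

Variable a : T -> nat.
Let A := [set f : {ffun 'I_n -> T} | has_content a f].

Definition word_mx h : 'M[algC]_#|A| :=
  \matrix_(i, j) ((word_perm (wr_perm h) (enum_val i) == enum_val j)%:R
                   * word_eval h (enum_val i)).

Lemma word_mx_repr : mx_repr [set: W] word_mx.
Proof.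
split=> [|h k _ _]; apply/matrixP=> i j; rewrite !mxE.
  by rewrite word_perm1 word_eval1 mulr1 (inj_eq enum_val_inj).
have Ai : word_perm (wr_perm h) (enum_val i) \in A.
  by have := enum_valP i; rewrite !inE has_content_perm.
rewrite (bigD1 (enum_rank_in Ai (word_perm (wr_perm h) (enum_val i)))) //= !mxE.
rewrite enum_rankK_in // eqxx mul1r big1 ?addr0 => [|m ne_m].
  by rewrite word_evalM -word_permM mulrCA.
rewrite !mxE; case: eqP => [E|]; last by rewrite !mul0r.
by case/eqP: ne_m; apply: enum_val_inj; rewrite enum_rankK_in.
Qed.

Definition word_repr := MxRepresentation word_mx_repr.

(* The character induced by a product of the eta(c t) from a Young subgroup of type a. *)
Definition wchar : 'CF([set: W]) := cfRepr word_repr.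

Lemma wcharE h : wchar h = \sum_(f | has_content a f) word_char h f.
Proof.
rewrite /wchar cfunE inE mulr1n /mxtrace.
transitivity (\sum_(f in A) word_char h f); last by apply: eq_bigl => f; rewrite inE.
by rewrite [RHS]big_enum_val; apply: eq_bigr => i _; rewrite mxE.
Qed.

Lemma wchar_char : wchar \is a character.
Proof. exact: cfRepr_char. Qed.
End Letters.

Lemma word_char_ext n (T U : finType) (c : T -> Gamma) (d : U -> Gamma) (h : wreath gT n)
    (f : {ffun 'I_n -> T}) (g : {ffun 'I_n -> U}) :
    (forall i j, (f i == f j) = (g i == g j)) -> (forall i, c (f i) = d (g i)) ->
  word_char c h f = word_char d h g.
Proof.
move=> fg cd; rewrite /word_char /word_eval; congr (_%:R * _).
  congr nat_of_bool; apply/eqP/eqP=> /ffunP E; apply/ffunP=> i.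
    by have /eqP := E i; rewrite !ffunE fg => /eqP.
  by have /eqP := E i; rewrite !ffunE -fg => /eqP.
by apply: eq_bigr => j _; rewrite cd.
Qed.

Lemma wchar_degree n (T : finType) (c : T -> Gamma) a :
  \sum_t a t != n -> wchar n c a = 0.
Proof.
move=> an; apply/cfunP=> h; rewrite wcharE cfunE big_pred0 // => f.
by apply: contraNF an => /sum_content->.
Qed.

Lemma wchar_relabel n (T U : finType) c c' a b (h : T -> U) :
    injective h -> (forall t, b (h t) = a t) ->
    (forall u, u \notin codom h -> b u = 0%N) ->
    (forall t, c' (h t) = c t) ->
  wchar n c a = wchar n c' b.
Proof.
move=> hinj ba b0 cc; apply/cfunP=> w; rewrite !wcharE.
rewrite -(sum_relabel hinj ba b0); apply: eq_bigr => f _.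
by apply: word_char_ext => [i j|i]; rewrite !ffunE ?(inj_eq hinj).
Qed.

Lemma wchar_conj n (T : finType) (c : T -> Gamma) a :
  (wchar n c a)^*%CF = wchar n (fun t => (c t)^-1%g) a.
Proof.
apply/cfunP=> h; rewrite cfunE !wcharE rmorph_sum; apply: eq_bigr => f _.
rewrite /word_char rmorphM rmorph_nat /word_eval rmorph_prod.
by congr (_ * _); apply: eq_bigr => j _; rewrite dual_invE.
Qed.

(** A permutation fixes a word of pairs exactly when it fixes both components, and the evaluations
    multiply. The index set is that of [int_mul_wsum], which makes the homomorphism multiplicative
    for the internal product. *)
Lemma wcharM n (T1 T2 : finType) (c1 : T1 -> Gamma) (c2 : T2 -> Gamma) a1 a2 :
  wchar n c1 a1 * wchar n c2 a2 =
  \sum_(c : {ffun T1 * T2 -> 'I_n.+1} | margins a1 a2 (fun t => c t))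
    wchar n (pair_color c1 c2) (fun t => c t).
Proof.
apply/cfunP=> h; rewrite cfunE sum_cfunE !wcharE big_distrlr /=.
under [RHS]eq_bigr => c _ do rewrite wcharE.
rewrite -sum_pairing_content; apply: eq_bigr => u _; apply: eq_bigr => v _.
rewrite /word_char mulrACA; congr (_ * _).
  rewrite -natrM mulnb; congr (nat_of_bool _)%:R.
  apply/andP/eqP=> [[/eqP/ffunP uh /eqP/ffunP vh]|/ffunP E].
    by apply/ffunP=> j; have := uh j; have := vh j; rewrite !ffunE => -> ->.
  by split; apply/eqP/ffunP=> j; have := E j; rewrite !ffunE => -[].
by rewrite /word_eval -big_split; apply: eq_bigr => j _; rewrite ffunE /= dual_mulE.
Qed.

Lemma eta_wchar n (c : Gamma) :
  eta_char n c = wchar n (fun=> c) (fun _ : unit => n).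
Proof.
apply/cfunP=> h; rewrite wcharE cfunE (big_pred1 [ffun=> tt]) => [|f]; last first.
  have -> : f = [ffun=> tt] by apply/ffunP=> j; rewrite ffunE; case: (f j).
  rewrite /= eqxx; apply/has_contentP=> -[].
  by rewrite -[RHS]card_ord; apply: eq_card => j; rewrite !inE ffunE.
rewrite /word_char [_ == _](_ : _ = true); last first.
  by apply/eqP/ffunP=> j; rewrite !ffunE.
rewrite mul1r /word_eval; apply: (big_morph (dual_char c)) => [x y|]; first exact: dual_charM.
exact: dual_char1.
Qed.
End MonomialCharacters.

Section WreathSums.
Variables (gT : finGroupType) (n : nat).

Lemma sum_wreath (V : nmodType) (F : wreath gT n -> V) :
  \sum_w F w = \sum_(s : 'S_n) \sum_(g : {ffun 'I_n -> gT}) F (Wreath g s).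
Proof.
rewrite pair_bigA_idem /=; last exact: addr0.
rewrite (reindex (fun p : 'S_n * {ffun 'I_n -> gT} => Wreath p.2 p.1)) //=.
by exists (fun w => (wr_perm w, wr_base w)) => [[]|[]].
Qed.

Lemma card_wreath : #|wreath gT n| = (n`! * #|gT| ^ n)%N.
Proof.
rewrite -sum1_card sum_wreath.
under eq_bigr => s _ do rewrite sum1_card card_ffun card_ord.
by rewrite sum_nat_const card_Sn.
Qed.
End WreathSums.

Lemma word_char_cut (gT : finGroupType) k l (T : finType) (c : T -> dual gT)
    (h1 : wreath gT k) (h2 : wreath gT l) (f : {ffun 'I_(k + l) -> T}) :
  word_char c (juxt (h1, h2)) f =
  word_char c h1 (cutl erefl f) * word_char c h2 (cutr erefl f).
Proof.
rewrite /word_char mulrACA -natrM mulnb; congr (_%:R * _).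
  congr nat_of_bool; apply/eqP/andP=> [/ffunP E|[/eqP/ffunP E1 /eqP/ffunP E2]].
    split; apply/eqP/ffunP=> j; rewrite !ffunE !cast_ord_id.
      by have := E (lshift l j); rewrite ffunE /= juxt_lshift.
    by have := E (rshift k j); rewrite ffunE /= juxt_rshift.
  apply/ffunP=> j; rewrite ffunE /=; case: (split_ordP j) => i ->.
    by have := E1 i; rewrite juxt_lshift !ffunE !cast_ord_id.
  by have := E2 i; rewrite juxt_rshift !ffunE !cast_ord_id.
rewrite /word_eval big_split_ord /=; congr (_ * _); apply: eq_bigr => j _;
  by rewrite !ffunE cast_ord_id /= ?split_lshift ?split_rshift.
Qed.

(** * Induction from Young subgroups *)

Section InducedProduct.
Variables (gT : finGroupType) (k l : nat) (T1 T2 : finType).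
Variables (c1 : T1 -> dual gT) (c2 : T2 -> dual gT).
Implicit Types (u : {ffun 'I_k -> T1}) (v : {ffun 'I_l -> T2}).

Lemma word_char_juxt h1 h2 u v :
  word_char (sum_color c1 c2) (juxt (h1, h2)) (join u v) =
  word_char c1 h1 u * word_char c2 h2 v.
Proof.
rewrite word_char_cut; congr (_ * _); apply: word_char_ext => [i j|i];
  by rewrite !ffunE !cast_ord_id ?split_lshift ?split_rshift.
Qed.

Lemma word_char_young h u v :
  word_char (sum_color c1 c2) h (join u v) != 0 ->
  exists h1 h2, h = juxt (h1, h2).
Proof.
rewrite /word_char; case: (word_perm _ _ =P _) => [/ffunP fix_h _|]; last by rewrite mul0r eqxx.
have [i|s [t st]] := @perm_juxt k l (wr_perm h).
  have := fix_h (lshift l i); rewrite ffunE join_lshift.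
  by case: (split_ordP (wr_perm h (lshift l i))) => j // ->; rewrite join_rshift.
exists (Wreath [ffun i => wr_base h (lshift l i)] s).
exists (Wreath [ffun i => wr_base h (rshift k i)] t).
case: h st {fix_h} => g p /= ->; congr Wreath; apply/ffunP=> j; rewrite !ffunE /=.
by case: (split_ordP j) => i ->; rewrite ffunE.
Qed.

(** In the formula for induced characters, conjugation moves words through the permutation part
    only. Each word over the disjoint union is thus met k! l! |G|^(k+l) times, which is the order of
    the Young subgroup. *)
Lemma ind2_wchar a1 a2 : (\sum_t a1 t)%N = k ->
  ind2 (wchar k c1 a1) (wchar l c2 a2) =
  wchar (k + l) (sum_color c1 c2) (sum_content2 a1 a2).
Proof.
move=> a1k; apply/cfunP=> h; rewrite wcharE /ind2 cfIndE ?subsetT //.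
(* Outside the Young subgroup both sides vanish, because a permutation that fixes a word [join u v]
   preserves the two blocks. *)
have outerE x : cfIsom (juxt_isom k l gT) (cfOuter (wchar k c1 a1) (wchar l c2 a2)) x =
    \sum_(u | has_content a1 u) \sum_(v | has_content a2 v)
      word_char (sum_color c1 c2) x (join u v).
  case: (boolP (x \in young k l gT)) => [/morphimP[[h1 h2] _ _ ->]|out].
    rewrite cfIsomE ?inE //= cfunE /= !wcharE big_distrlr /=.
    by apply: eq_bigr => u _; apply: eq_bigr => v _; rewrite word_char_juxt.
  rewrite (cfun0 _ out) big1 // => u _; rewrite big1 // => v _.
  apply/eqP; apply: contraNT out => /word_char_young[h1 [h2 ->]].
  by apply: mem_morphim; rewrite inE.
rewrite big_mkcond /=; under eq_bigr => y _ do rewrite inE outerE.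
rewrite sum_wreath /=.
pose S (s : 'S_(k + l)) := \sum_(u | has_content a1 u) \sum_(v | has_content a2 v)
  word_char (sum_color c1 c2) h (word_perm s^-1 (join u v)).
rewrite (eq_bigr (fun s => S s *+ #|gT| ^ (k + l))); last first.
  move=> s _; have := card_ffun 'I_(k + l) gT; rewrite card_ord => <-.
  rewrite -sumr_const; apply: eq_bigr => g _; apply: eq_bigr => u _; apply: eq_bigr => v _.
  by rewrite word_charJ.
rewrite sumrMnl (eq_bigl (fun p => p \in setT)); last by move=> p; rewrite inE.
rewrite (sum_perm_join _ _ _ (word_char (sum_color c1 c2) h)).
rewrite (eq_bigr (fun g => word_char (sum_color c1 c2) h g *+ (k`! * l`!))); last first.
  move=> g gc; rewrite -(card_perm_splits (g := g)); last by rewrite (card_is_left gc).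
  by congr (_ *+ _); apply: eq_card => p; rewrite !inE.
rewrite sumrMnl -mulrnA -[X in _ * X]mulr_natl mulrA.
rewrite [X in X * _ = _](_ : _ = 1) ?mul1r //.
rewrite card_injm ?subsetT //; last by apply/injmP=> v w _ _; apply: juxt_inj.
rewrite cardsT card_prod !card_wreath expnD mulnACA mulVf //.
rewrite pnatr_eq0 -lt0n !muln_gt0 !fact_gt0 !expn_gt0.
by rewrite (cardD1 1%g) inE.
Qed.
End InducedProduct.

(** * Traces and scalar products *)

Section CharacterSums.
Variable gT : finGroupType.
Local Notation Gamma := (dual gT).

HB.instance Definition _ := GRing.isZmodMorphism.Build (fmod gT) int
  (@tau_tot gT) (extend1_is_additive _).

Lemma dual_char_eq1 (c : Gamma) : (dual_char c == 1) = (c == 1%g).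
Proof.
apply/eqP/eqP=> [E|->]; last by rewrite dual_ofE.
by apply: dual_char_inj; rewrite E dual_ofE.
Qed.

Lemma sum_dual_char (c : Gamma) : \sum_x dual_char c x = (#|gT| * (c == 1%g))%:R.
Proof.
have := cfdotE (dual_char c) 1; rewrite -dual_char_eq1.
have -> : '[dual_char c, 1] = (dual_char c == 1)%:R.
  by rewrite /dual_char -irr0 cfdot_irr (inj_eq irr_inj).
rewrite cardsT natrM => ->; rewrite mulrA mulfV ?mul1r; last first.
  by rewrite pnatr_eq0 -lt0n (cardD1 1%g) inE.
by apply: eq_big => [x|x _]; rewrite ?inE // cfun1E inE rmorph1 mulr1.
Qed.

(** By orthogonality, the sum over the base is a product of factors |G| for letters of trivial
    colour and 0 for the others; the permutations left are those fixing [f]. The weight [e] is 1 in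
    [tau_wsum] and the sign in [cfdot_wsgn]. *)
Lemma sum_word_char n (T : finType) (c : T -> Gamma) (f : {ffun 'I_n -> T}) (e : 'S_n -> algC) :
  \sum_(h : wreath gT n) e (wr_perm h) * word_char c h f =
  ([forall j, c (f j) == 1%g] * #|gT| ^ n)%:R * \sum_(s in stab_word f) e s.
Proof.
have gE s : \sum_(g : {ffun 'I_n -> gT}) word_eval c (Wreath g s) f =
    ([forall j, c (f j) == 1%g] * #|gT| ^ n)%:R.
  rewrite /word_eval /= -(bigA_distr_bigA (fun j x => dual_char (c (f j)) x)) /=.
  under eq_bigr => j _ do rewrite sum_dual_char.
  rewrite -natr_prod big_split /= prod_nat_const card_ord mulnC.
  congr (_ * _)%:R; case: forallP => [fc|/forallP].
    by rewrite big1 // => j _; rewrite fc.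
  by rewrite negb_forall => /existsP[j /negbTE cj]; rewrite (bigD1 j) //= cj.
rewrite sum_wreath mulr_sumr [RHS]big_mkcond; apply: eq_bigr => s _ /=.
transitivity (e s * ((word_perm s f == f)%:R *
    \sum_(g : {ffun 'I_n -> gT}) word_eval c (Wreath g s) f)).
  by rewrite !mulr_sumr; apply: eq_bigr.
by rewrite gE inE; case: ifP => _; rewrite ?mul0r ?mulr0 // mul1r mulrC.
Qed.

Lemma elt_eq1 n (T : finType) r (c : T -> Gamma) (f : {ffun 'I_n -> T}) :
  (elt r c f == 1%g) = [forall j, c (f j) == 1%g] && (std (lexw (r \o f)) == 1%g).
Proof.
apply/eqP/andP=> [[/ffunP E1 E2]|[/forallP fc /eqP E]].
  split; last by rewrite -invg_eq1 E2.
  by apply/forallP=> j; have := E1 j; rewrite !ffunE => ->.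
congr Wreath; last by rewrite E invg1.
by apply/ffunP=> j; rewrite !ffunE (eqP (fc j)).
Qed.

(** The left side counts the sorted words all of whose colours are trivial ([elt_eq1]). The right
    side is 1/n! times the sum of the orders of the stabilizers of the words with trivial colours,
    and [sum_sorted_words] equates the two. *)
Lemma tau_wsum n (T : finType) r (c : T -> Gamma) a : injective r ->
  (tau_tot (wsum r c n a))%:~R =
  #|wreath gT n|%:R^-1 * \sum_(h : wreath gT n) wchar n c a h.
Proof.
move=> rinj; under eq_bigr => h _ do rewrite wcharE.
pose P (f : {ffun 'I_n -> T}) := has_content a f && [forall j, c (f j) == 1%g].
have Pperm s f : P (word_perm s f) = P f.
  rewrite /P (has_content_perm s a f); apply: andb_id2l => _.
  apply/forallP/forallP=> fc j; last by rewrite ffunE.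
  by have := fc (s^-1%g j); rewrite ffunE permKV.
have -> : tau_tot (wsum r c n a) = #|[set f | P f & std (lexw (r \o f)) == 1%g]|%:R.
  rewrite /tau_tot /wsum raddf_sum /= -sum1dep_card natr_sum.
  rewrite big_mkcond [RHS]big_mkcond /=; apply: eq_bigr => f _.
  rewrite extend1U /= elt_eq1 /P; case: (has_content a f) => //=.
  by rewrite andbC; case: ifP.
rewrite exchange_big /=.
transitivity (#|wreath gT n|%:R^-1 * (#|gT| ^ n * \sum_(f | P f) #|stab_word f|)%:R : algC).
  rewrite -(sum_sorted_words rinj) // card_wreath mulnA (mulnC (_ ^ n)%N) [X in _ * X]natrM mulKf.
    by rewrite rmorph_nat.
  rewrite pnatr_eq0 -lt0n muln_gt0 fact_gt0 expn_gt0.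
  by rewrite (cardD1 1%g) inE.
congr (_ * _); rewrite natrM natr_sum mulr_sumr /P big_mkcondr /=.
apply: eq_bigr => f _; symmetry.
transitivity (\sum_h 1 * word_char c h f).
  by apply: eq_bigr => h _; rewrite mul1r.
rewrite (sum_word_char c f (fun=> 1)) sumr_const; case: ifP => _; last by rewrite mul0n mul0r.
by rewrite mul1n.
Qed.

Lemma varpi_tau (x y : fmod gT) : varpi_tot x y = tau_tot (int_mul x y).
Proof.
rewrite /int_mul (malg_sumE x) (malg_sumE y) /varpi_tot !extend2_sumz /tau_tot.
rewrite raddf_sum; apply: eq_bigr => b _; rewrite raddf_sum; apply: eq_bigr => d _.
rewrite (raddfMz (extend1 _)) !extend2UU; congr (_ *~ _).
case: b d => [n v] [m w] /=; have [E|nm] := eqVneq n m; last by rewrite (raddf0 (extend1 _)).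
case: _ / E w => w; rewrite ?eqxx extend1U /= tagged_asE; congr (nat_of_bool _)%:R.
apply/andP/eqP=> [[/eqP vw /forallP E]|].
  congr Wreath; last by rewrite vw mulgV.
  apply/ffunP=> i; rewrite !ffunE.
  by have /eqP := E ((wr_perm v)^-1%g i); rewrite permKV => ->; rewrite mulVg.
move=> vw; have E : (wr_perm w * wr_perm v = 1)%g := congr1 (@wr_perm _ _) vw.
split; first by rewrite eq_sym eq_invg_mul E.
apply/forallP=> i; rewrite eq_mulgV1 invgK.
have /ffunP/(_ (wr_perm v i)) := congr1 (@wr_base _ _) vw.
by rewrite !ffunE permK => ->.
Qed.

(** The form is [tau_tot] of an internal product, hence the mean of a product of characters; the
    conjugate offsets the one built into the hermitian product. *)
Lemma varpi_wsum n (T1 T2 : finType) r1 r2 (c1 : T1 -> Gamma) (c2 : T2 -> Gamma) a1 a2 :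
    injective r1 -> injective r2 ->
  (varpi_tot (wsum r1 c1 n a1) (wsum r2 c2 n a2))%:~R =
  '[wchar n c1 a1, (wchar n c2 a2)^*%CF].
Proof.
move=> i1 i2; rewrite varpi_tau int_mul_wsum (raddf_sum (@tau_tot gT)) mulrz_sumr /=.
rewrite (eq_bigr _ (fun c _ => tau_wsum _ _ _ (pair_rank_inj i1 i2))).
rewrite -mulr_sumr exchange_big /= cfdotE cardsT; congr (_ * _).
apply: eq_big => [h|h _]; first by rewrite inE.
transitivity ((wchar n c1 a1 * wchar n c2 a2) h); first by rewrite wcharM sum_cfunE.
by rewrite cfunE [X in _ = _ * X^*]cfunE conjCK.
Qed.

Lemma varpi_wsum_neq n m (T1 T2 : finType) r1 r2 (c1 : T1 -> Gamma) (c2 : T2 -> Gamma) a1 a2 :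
  n != m -> varpi_tot (wsum r1 c1 n a1) (wsum r2 c2 m a2) = 0.
Proof.
move=> nm; rewrite /varpi_tot extend2_sum big1 // => u _; rewrite big1 // => v _.
by rewrite extend2UU /= (negbTE nm).
Qed.
End CharacterSums.

(** * The sign character *)

(** The words fixed by [s] are those constant on its cycles. *)
Lemma card_fixed_words n k (s : 'S_n) :
  #|[set f : {ffun 'I_n -> 'I_k} | word_perm s f == f]| = (k ^ #|porbits s|)%N.
Proof.
pose D := {x : {set 'I_n} | x \in porbits s}.
have orb j : porbit s j \in porbits s by apply: imset_f.
pose h (g : {ffun D -> 'I_k}) := [ffun j : 'I_n => g (exist _ (porbit s j) (orb j))].
have hinj : injective h.
  move=> g g' /ffunP E; apply/ffunP=> -[x xs]; have /imsetP[j _ xE] := xs.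
  have -> : exist (fun x => x \in porbits s) x xs = exist _ (porbit s j) (orb j).
    by apply: val_inj.
  by have := E j; rewrite !ffunE.
transitivity #|h @: setT|; last first.
  by rewrite card_imset // cardsT card_ffun card_ord card_sig.
apply: eq_card => f; rewrite inE; apply/eqP/imsetP=> [/ffunP sf|[g _ ->]]; last first.
  apply/ffunP=> j; rewrite !ffunE; congr (g _); apply: val_inj => /=.
  by rewrite -[RHS](porbit_perm _ 1) expg1.
have fix_iter m j : f (iter m s j) = f j.
  by elim: m => //= m IH; have := sf (iter m s j); rewrite ffunE => ->.
have rep (x : D) : exists j, val x = porbit s j.
  by case: x => x /= /imsetP[j _ ->]; exists j.
have /fin_all_exists[q qE] := rep.
exists [ffun x => f (q x)] => //; apply/ffunP=> j; rewrite !ffunE.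
have := qE (exist _ (porbit s j) (orb j)); set x := q _ => /= E.
have : x \in porbit s j by rewrite E porbit_id.
by case/porbitP=> m ->; rewrite permX fix_iter.
Qed.

(** The m-th finite difference of a polynomial of degree less than m vanishes. Pascal's rule writes
    the sum for m + 1 as a difference between x and x + 1, in which only powers lower than d
    survive. *)
Lemma sum_alternating_binomial (R : comNzRingType) (m d : nat) (x : R) : (d < m)%N ->
  \sum_(i < m.+1) (-1) ^+ i * 'C(m, i)%:R * (x + i%:R) ^+ d = 0.
Proof.
elim: m d x => // m IH d x; rewrite ltnS => le_dm.
pose S e y : R := \sum_(i < m.+1) (-1) ^+ i * 'C(m, i)%:R * (y + i%:R) ^+ e.
have -> : \sum_(i < m.+2) (-1) ^+ i * 'C(m.+1, i)%:R * (x + i%:R) ^+ d =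
    S d x - S d (x + 1).
  rewrite big_ord_recl /= bin0 mulr1.
  under eq_bigr => i _ do
    rewrite /bump /= add1n binS natrD mulrDr mulrDl exprS mulN1r !mulNr.
  rewrite big_split /= addrA; congr (_ + _).
    rewrite [S d x]big_ord_recl /= bin0 mulr1; congr (_ + _).
    rewrite big_ord_recr /= bin_small // mulr0 mul0r oppr0 addr0.
    by apply: eq_bigr => i _; rewrite /bump /= add1n exprS mulN1r !mulNr.
  by rewrite -sumrN; apply: eq_bigr => i _; rewrite -addrA [1 + _]addrC -natr1.
have -> : S d (x + 1) = S d x + \sum_(e < d) 'C(d, e)%:R * S e x.
  transitivity (\sum_(e < d.+1) 'C(d, e)%:R * S e x); last first.
    by rewrite big_ord_recr /= binn mul1r addrC.
  under [RHS]eq_bigr => e _ do rewrite mulr_sumr.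
  rewrite [RHS]exchange_big /=; apply: eq_bigr => i _.
  rewrite -addrA addrCA exprDn mulr_sumr.
  apply: eq_bigr => e _; by rewrite expr1n mul1r [RHS]mulr_natl -[RHS]mulrnAr.
rewrite big1 ?addr0 ?subrr // => e _.
by rewrite [S _ _]IH ?mulr0 // (leq_trans (ltn_ord e)).
Qed.

(** The vanishing difference of order n + 1 based at x = -1, solved for its term of index 0. *)
Lemma signr_binomial (R : comNzRingType) (n d : nat) : (d <= n)%N ->
  (-1) ^+ d = \sum_(k < n.+1) (-1) ^+ k * 'C(n.+1, k.+1)%:R * k%:R ^+ d :> R.
Proof.
move=> le_dn; have := @sum_alternating_binomial R n.+1 d (-1) le_dn.
rewrite big_ord_recl /= bin0 !mul1r addr0 => /eqP; rewrite addr_eq0 => /eqP->.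
rewrite -sumrN; apply: eq_bigr => i _; rewrite /bump /= add1n.
by rewrite exprS mulN1r !mulNr opprK -natr1 addrCA addNr addr0.
Qed.

(** If two positions carry the same letter, multiplication by their transposition preserves the
    stabilizer and reverses signs; otherwise the stabilizer is trivial. *)
Lemma sum_sign_stab n (T : finType) (f : {ffun 'I_n -> T}) (R : numDomainType) :
  \sum_(s in stab_word f) (-1) ^+ s = (injectiveb f)%:R :> R.
Proof.
case: (boolP (injectiveb f)) => [/injectiveP finj|/injectivePn[i [j ne_ij fij]]].
  rewrite (big_pred1 1%g) ?odd_perm1 // => s; rewrite inE.
  apply/eqP/eqP=> [/ffunP E|->]; last exact: word_perm1.
  by apply/permP=> x; apply: finj; rewrite perm1; have := E x; rewrite ffunE.
set S := \sum_(s in _) _; suffices SN : S = - S.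
  have /eqP : S *+ 2 = 0 by rewrite mulr2n {2}SN subrr.
  by rewrite mulrn_eq0 => /eqP.
rewrite {1}/S (reindex_inj (mulgI (tperm i j))) -sumrN; apply: eq_big => [s|s _].
  rewrite !inE word_permM; apply/eqP/eqP=> [E|->].
    rewrite -[LHS](word_permK (tperm i j)) tpermV E.
    apply/ffunP=> x; rewrite ffunE; by case: tpermP => // ->.
  apply/ffunP=> x; rewrite ffunE; by case: tpermP => // ->.
by rewrite odd_permM odd_tperm ne_ij signr_addb mulN1r.
Qed.

(** * The lattice spanned by the monomial characters, and the sign *)

Section WordSpan.
Variable gT : finGroupType.
Local Notation Gamma := (dual gT).
Local Notation word := (seq (nat * Gamma)).

Definition wordchar n (w : word) : 'CF([set: wreath gT n]) :=
  wchar n (wcolor (w := w)) (@wsize gT w).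

Definition zchar_of n (s : seq (int * word)) : 'CF([set: wreath gT n]) :=
  \sum_(p <- s) wordchar n p.2 *~ p.1.

Definition zprod_of n (s : seq (int * word)) : fmod gT :=
  \sum_(p <- s) wprod n p.2 *~ p.1.

Definition wspan n (phi : 'CF([set: wreath gT n])) : Prop :=
  exists s, phi = zchar_of n s.

Lemma wspan0 n : wspan (0 : 'CF([set: wreath gT n])).
Proof. by exists [::]; rewrite /zchar_of big_nil. Qed.

Lemma wspanD n (phi psi : 'CF([set: wreath gT n])) :
  wspan phi -> wspan psi -> wspan (phi + psi).
Proof. by move=> [s ->] [t ->]; exists (s ++ t); rewrite /zchar_of big_cat. Qed.

Lemma wspanMz n (phi : 'CF([set: wreath gT n])) m : wspan phi -> wspan (phi *~ m).
Proof.
move=> [s ->]; exists [seq (p.1 * m, p.2) | p <- s].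
rewrite /zchar_of big_map mulrz_suml; apply: eq_bigr => p _.
by rewrite mulrzA.
Qed.

Lemma wspan_sum n (I : Type) (r : seq I) (P : pred I) F :
  (forall i, P i -> wspan (F i : 'CF([set: wreath gT n]))) ->
  wspan (\sum_(i <- r | P i) F i).
Proof. by move=> sF; apply: big_ind => //; [apply: wspan0|apply: wspanD]. Qed.

Lemma wchar_word_of n (T : finType) (c : T -> Gamma) a :
  wchar n c a = wordchar n (word_of (@enum_rank T) c a).
Proof.
have [h [hinj hsurj hE _]] := word_ofP (fun t => enum_rank t : nat) c a.
symmetry; apply: (wchar_relabel _ hinj) => [t|u|t].
- by case: (hE t).
- by rewrite hsurj.
- by case: (hE t).
Qed.

Lemma wspan_wordchar n w : wspan (wordchar n w).
Proof. by exists [:: (1, w)]; rewrite /zchar_of big_seq1. Qed.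

Lemma wspan_wchar n (T : finType) (c : T -> Gamma) a : wspan (wchar n c a).
Proof. by rewrite wchar_word_of; apply: wspan_wordchar. Qed.

Lemma wspan_ind n (P : 'CF([set: wreath gT n]) -> Prop) :
    (forall w, P (wordchar n w)) -> (forall phi psi, P phi -> P psi -> P (phi + psi)) ->
    (forall phi m, P phi -> P (phi *~ m)) ->
  forall phi, wspan phi -> P phi.
Proof.
move=> Pw PD Pm phi [s ->]; apply: big_ind => //; last by move=> p _; apply: Pm.
by rewrite -(mulr0z (wordchar n [::])); apply: Pm.
Qed.

Lemma wspanM n (phi psi : 'CF([set: wreath gT n])) :
  wspan phi -> wspan psi -> wspan (phi * psi).
Proof.
move=> sphi spsi; elim/wspan_ind: phi / sphi => [w|phi phi' IH IH'|phi m IH].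
- elim/wspan_ind: psi / spsi => [v|psi psi' IH IH'|psi m IH].
  + by rewrite wcharM; apply: wspan_sum => c _; apply: wspan_wchar.
  + by rewrite mulrDr; apply: wspanD.
  + by rewrite mulrzAr; apply: wspanMz.
- by rewrite mulrDl; apply: wspanD.
- by rewrite mulrzAl; apply: wspanMz.
Qed.

Lemma wspan_conj n (phi : 'CF([set: wreath gT n])) : wspan phi -> wspan phi^*%CF.
Proof.
elim/wspan_ind=> [w|{}phi psi IH IH'|{}phi m IH].
- by rewrite wchar_conj; apply: wspan_wchar.
- by rewrite rmorphD; apply: wspanD.
- by rewrite rmorphMz; apply: wspanMz.
Qed.

Lemma wspan_vchar n (phi : 'CF([set: wreath gT n])) :
  wspan phi -> phi \in 'Z[irr [set: wreath gT n]]%g.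
Proof.
elim/wspan_ind=> [w|{}phi psi|{}phi m].
- by apply: char_vchar; apply: wchar_char.
- exact: rpredD.
- exact: rpredMz.
Qed.

Lemma cfun_mulzE n (phi : 'CF([set: wreath gT n])) m h : (phi *~ m) h = phi h *~ m.
Proof. by rewrite -scaler_int cfunE mulrzl. Qed.

(* The sum over the contents on k letters is k^(number of cycles), and the    *)
(* sign is the value at k = -1, interpolated from k = 0, ..., n.              *)
Definition wsgn n : 'CF([set: wreath gT n]) :=
  \sum_(k < n.+1) (\sum_(a : {ffun 'I_k -> 'I_n.+1}) wchar n (fun=> 1%g) (fun t => a t))
    *~ ((-1) ^+ (n + k) * 'C(n.+1, k.+1)%:R).

Lemma wspan_wsgn n : wspan (wsgn n).
Proof.
apply: wspan_sum => k _; apply: wspanMz.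
by apply: wspan_sum => a _; apply: wspan_wchar.
Qed.

Lemma wsgnE n (h : wreath gT n) : wsgn n h = (-1) ^+ wr_perm h.
Proof.
rewrite /wsgn sum_cfunE.
have E k : (\sum_(a : {ffun 'I_k -> 'I_n.+1}) wchar n (fun=> 1%g) (fun t => a t)) h
    = k%:R ^+ #|porbits (wr_perm h)| :> algC.
  rewrite sum_cfunE; under eq_bigr => a _ do rewrite wcharE.
  rewrite -(sum_by_content (leqnn n) (P := xpredT) (Q := xpredT)) //.
  rewrite -natrX -card_fixed_words -sum1_card natr_sum [RHS]big_mkcond.
  apply: eq_bigr => f _; rewrite inE /word_char /word_eval.
  rewrite big1 ?mulr1 => [|j _]; last exact: dual_oneE.
  by case: ifP.
have le_n : (#|porbits (wr_perm h)| <= n)%N.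
  rewrite -[X in (_ <= X)%N]card_ord; exact: leq_imset_card.
transitivity ((-1) ^+ n * (-1) ^+ #|porbits (wr_perm h)| : algC); last first.
  by rewrite /odd_perm card_ord signr_addb !signr_odd.
rewrite (signr_binomial _ le_n) mulr_sumr; apply: eq_bigr => k _.
rewrite cfun_mulzE E -mulrzr rmorphM rmorphXn rmorphN1 rmorph_nat mulrC exprD.
by rewrite !mulrA.
Qed.
End WordSpan.

Section SignedPairing.
Variables (gT : finGroupType) (n : nat) (T1 T2 : finType).
Variables (c1 : T1 -> dual gT) (c2 : T2 -> dual gT).

Lemma wcharM_words a1 a2 h :
  wchar n c1 a1 h * wchar n c2 a2 h =
  \sum_(f | has_margins a1 a2 f) word_char (pair_color c1 c2) h f.
Proof.
transitivity ((wchar n c1 a1 * wchar n c2 a2) h); first by rewrite [RHS]cfunE.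
rewrite wcharM sum_cfunE; under eq_bigr => c _ do rewrite wcharE.
by rewrite -sum_pairing_content sum_pairing.
Qed.
End SignedPairing.

(** The sign kills every word of pairs with a repeated letter ([sum_sign_stab]). What remains lists
    the cells of 0-1 matrices with the given margins, each matrix being listed in n! orders. *)
Lemma cfdot_wsgn (gT : finGroupType) n (T1 T2 : finType)
    (c1 : T1 -> dual gT) (c2 : T2 -> dual gT) a1 a2 :
  '[wsgn gT n * wchar n c1 a1, wchar n c2 a2] =
  #|[set f : {ffun 'I_n -> T1 * T2} | [&& has_margins a1 a2 f, injectiveb f
      & [forall j, c1 (f j).1 == c2 (f j).2]]]|%:R / n`!%:R.
Proof.
rewrite cfdotE cardsT card_wreath.
pose d := pair_color c1 (fun t => (c2 t)^-1%g).
have dE (f : {ffun 'I_n -> T1 * T2}) :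
    [forall j, d (f j) == 1%g] = [forall j, c1 (f j).1 == c2 (f j).2].
  by apply: eq_forallb => j; rewrite /d /pair_color -eq_mulgV1.
transitivity ((n`! * #|gT| ^ n)%:R^-1 * \sum_(f | has_margins a1 a2 f)
   \sum_(h : wreath gT n) (-1) ^+ wr_perm h * word_char d h f : algC).
  rewrite exchange_big /=; congr (_ * _); apply: eq_big => [h|h _]; first by rewrite inE.
  rewrite cfunE wsgnE -mulrA -mulr_sumr -wcharM_words; congr (_ * (_ * _)).
  by have /cfunP/(_ h) := wchar_conj n c2 a2; rewrite cfunE.
set A := [set f | _].
have nz : (#|gT| ^ n)%:R != 0 :> algC.
  by rewrite pnatr_eq0 -lt0n expn_gt0 (cardD1 1%g) inE.
transitivity ((n`! * #|gT| ^ n)%:R^-1 * (#|A|%:R * (#|gT| ^ n)%:R) : algC); last first.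
  by rewrite mulrC natrM invfM -[in LHS]mulrA (mulrC n`!%:R^-1) mulVKf.
congr (_ * _); rewrite -sum1dep_card natr_sum mulr_suml big_mkcond [RHS]big_mkcond.
apply: eq_bigr => f _; rewrite (sum_word_char d f (fun s : 'S_n => (-1) ^+ s)).
rewrite sum_sign_stab dE; case: (has_margins _ _ _) => //=.
by case: (injectiveb f); case: [forall j, _]; rewrite ?mulr0 ?mul0n ?mul0r // mul1n mulr1 mul1r.
Qed.

(** * Multipartitions *)

(** Outside the intersection, each element of [D] has [j + 1 <= m] and each element of [S] has
    [m <= j], while the totals of [m] agree. *)
Lemma sum_exchange_weight (X : finType) (D S : {set X}) (j m : X -> nat) :
    {in D, forall x, (j x < m x)%N} -> {in S :\: D, forall x, (m x <= j x)%N} ->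
    (\sum_(x in D) m x = \sum_(x in S) m x)%N ->
  (\sum_(x in D) j x + #|D :\: S| <= \sum_(x in S) j x)%N.
Proof.
move=> jm mj; rewrite (big_setID S) [in RHS](big_setID D) /=.
rewrite (setIC S D) => /addnI E.
rewrite (big_setID S) [in X in (_ <= X)%N](big_setID D) /= (setIC S D).
rewrite -addnA leq_add2l -sum1_card -big_split /=.
apply: (@leq_trans (\sum_(x in D :\: S) m x)).
  by apply: leq_sum => x; rewrite inE => /andP[_ xD]; rewrite addn1 jm.
by rewrite E; apply: leq_sum => x; apply: mj.
Qed.

Section Multipartitions.
Variables (C : finType) (n : nat).
Local Notation T := (C * 'I_n)%type.
Local Notation shape := {ffun T -> 'I_n.+1}.
Implicit Types (la mu : shape) (t : T).

Definition multipartition mu :=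
  ((\sum_t mu t)%N == n) &&
  [forall c, forall i : 'I_n, forall j : 'I_n, (i <= j)%N ==> (mu (c, j) <= mu (c, i))%N].

Lemma multipartition_sum mu : multipartition mu -> (\sum_t mu t)%N = n.
Proof. by case/andP=> /eqP. Qed.

Lemma multipartition_anti mu c (i j : 'I_n) :
  multipartition mu -> (i <= j)%N -> (mu (c, j) <= mu (c, i))%N.
Proof. by case/andP=> _ /forallP/(_ c)/forallP/(_ i)/forallP/(_ j)/implyP. Qed.

(** The values of [mu] are column lengths of its diagram, so these conjugate values are row
    lengths. *)
Definition transpose mu (t : T) : nat := #|[set j : 'I_n | (t.2 < mu (t.1, j))%N]|.

(** The statistic usually written n(mu), summed over the colours; it stands in for the dominance
    order in the unitriangularity. *)
Definition rank_shape mu : nat := (\sum_(t : T) t.2 * mu t)%N.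

(* The cell in row i and column j of the component of colour c is encoded by ((c, i), (c, j)). *)
Definition diagram mu : {set T * T} :=
  [set x : T * T | (x.1.1 == x.2.1) && (x.1.2 < mu x.2)%N].

Definition fillings la mu : {set {ffun 'I_n -> T * T}} :=
  [set f : {ffun 'I_n -> T * T} |
    [&& has_margins (transpose la) (fun t => mu t) f, injectiveb f
      & [forall j, (f j).1.1 == (f j).2.1]]].

Lemma rank_shape_le mu : multipartition mu -> (rank_shape mu <= n * n)%N.
Proof.
move=> pmu; rewrite -{2}(multipartition_sum pmu) big_distrr /=.
by apply: leq_sum => t _; rewrite leq_mul2r ltnW ?orbT.
Qed.

Lemma card_diagram_col mu t : #|[set x in diagram mu | x.2 == t]| = mu t.
Proof.
rewrite -[RHS](card_ord_lt (n := n)); last by rewrite -ltnS.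
have hinj : injective (fun i : 'I_n => ((t.1, i), t)) by move=> i i' [].
rewrite -[RHS](card_imset _ hinj); apply: eq_card => -[[c i] u]; rewrite !inE /=.
apply/andP/imsetP=> [[/andP[/eqP-> lt_i] /eqP E]|[i']].
  by exists i; rewrite ?inE -?E.
by rewrite inE => lt_i' [-> -> ->]; rewrite !eqxx.
Qed.

Lemma card_diagram_row mu t : #|[set x in diagram mu | x.1 == t]| = transpose mu t.
Proof.
have hinj : injective (fun j : 'I_n => (t, (t.1, j))) by move=> i i' [].
rewrite -[RHS](card_imset _ hinj); apply: eq_card => -[u [c j]]; rewrite !inE /=.
apply/andP/imsetP=> [[/andP[/eqP cE lt_i] /eqP E]|[i']].
  by exists j; rewrite ?inE -?E -?cE // cE.
by rewrite inE => lt_i' [-> -> ->]; rewrite !eqxx.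
Qed.

Lemma diagram_row_lt mu (t : T) j : multipartition mu ->
  (t.2 < mu (t.1, j))%N = (j < transpose mu t)%N.
Proof.
move=> pmu; rewrite /transpose -down_closed_ord ?inE // => i i' le_ii'.
by rewrite !inE => /leq_trans; apply; apply: multipartition_anti.
Qed.

Lemma sum_fiber (X Y : finType) (S : {set X}) (g : X -> Y) (w : Y -> nat) :
  (\sum_(x in S) w (g x) = \sum_y w y * #|[set x in S | g x == y]|)%N.
Proof.
rewrite (partition_big g xpredT) //=; apply: eq_bigr => y _.
rewrite -sum1dep_card big_distrr /=; apply: eq_big => [x|x /andP[_ /eqP->]] //.
by rewrite muln1.
Qed.

Lemma card_diagram mu : multipartition mu -> #|diagram mu| = n.
Proof.
move=> pmu; rewrite -[RHS](multipartition_sum pmu) -sum1_card.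
rewrite (sum_fiber _ (fun x => x.2) (fun=> 1%N)); apply: eq_bigr => t _.
by rewrite mul1n card_diagram_col.
Qed.

Lemma card_image_fiber (X : finType) (f : {ffun 'I_n -> X}) (P : pred X) : injective f ->
  #|[set x in f @: setT | P x]| = #|[set j | P (f j)]|.
Proof.
move=> finj; rewrite -[RHS](card_imset _ finj); apply: eq_card => x; rewrite !inE.
apply/andP/imsetP=> [[/imsetP[j _ ->] Pj]|[j + ->]]; first by exists j; rewrite ?inE.
by rewrite inE; split=> //; apply: imset_f.
Qed.

(** The rows of [diagram la] are flush left, and the cells of [f] have the same row sums. Each cell
    of the diagram that [f] misses is traded for one strictly further right, which raises the sum of
    the column indices. *)
Lemma fillings_rank la mu f : multipartition la -> f \in fillings la mu ->
  (rank_shape la + #|diagram la :\: f @: setT| <= rank_shape mu)%N.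
Proof.
move=> pla; rewrite inE => /and3P[/andP[/forallP row /forallP col] /injectiveP finj /forallP cE].
set S := f @: setT.
have rowS t : #|[set x in S | x.1 == t]| = transpose la t.
  by rewrite card_image_fiber // (eqP (row t)).
have colS t : #|[set x in S | x.2 == t]| = mu t.
  by rewrite card_image_fiber // (eqP (col t)).
have dE : rank_shape la = (\sum_(x in diagram la) x.2.2)%N.
  rewrite (sum_fiber _ (fun x : T * T => x.2) (fun t => t.2 : nat)).
  by apply: eq_bigr => t _; rewrite card_diagram_col.
have SE : rank_shape mu = (\sum_(x in S) x.2.2)%N.
  rewrite (sum_fiber _ (fun x : T * T => x.2) (fun t => t.2 : nat)).
  by apply: eq_bigr => t _; rewrite colS.
rewrite dE SE; apply: (sum_exchange_weight (m := fun x => transpose la x.1)).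
- move=> [[c i] [d j]]; rewrite inE /= => /andP[/eqP <- lt_i].
  by rewrite -diagram_row_lt.
- move=> [u [d j]]; rewrite !inE => /andP[xD /imsetP[k _ xE]].
  rewrite leqNgt -diagram_row_lt //; apply: contra xD => /=.
  by have /eqP := cE k; rewrite -xE /= => <-; rewrite eqxx.
- rewrite !(sum_fiber _ (fun x : T * T => x.1) (transpose la)).
  by apply: eq_bigr => t _; rewrite card_diagram_row rowS.
Qed.

(** Equality of the ranks leaves no room for a missing cell in [fillings_rank], so [f] fills the
    diagram, whose column sums are [la]. *)
Lemma fillings_eq la mu f : multipartition la -> f \in fillings la mu ->
  rank_shape la = rank_shape mu -> f @: setT = diagram la /\ la = mu.
Proof.
move=> pla fF rE; have := fillings_rank pla fF; rewrite rE -[X in (_ <= X)%N]addn0 leq_add2l.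
rewrite leqn0 cards_eq0 setD_eq0 => sub.
move: fF; rewrite inE => /and3P[/andP[_ /forallP col] /injectiveP finj _].
have SE : diagram la = f @: setT.
  by apply/eqP; rewrite eqEcard sub card_imset // cardsT card_ord card_diagram /=.
split=> //; apply/ffunP=> t; apply: ord_inj.
by rewrite -(card_diagram_col la) SE card_image_fiber // (eqP (col t)).
Qed.

(** The fillings are the orderings of the n cells of the diagram. *)
Lemma card_fillings_diag la : multipartition la -> #|fillings la la| = n`!.
Proof.
move=> pla; have := card_inj_ffuns_on 'I_n (mem (diagram la)).
rewrite card_diagram // card_ord ffactnn => <-; apply: eq_card => f.
rewrite [RHS]inE; apply/idP/andP=> [fF|[/ffun_onP fD /injectiveP finj]].
  have [E _] := fillings_eq pla fF erefl.
  split; last by move: fF; rewrite inE => /and3P[].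
  by apply/ffun_onP=> j; rewrite -E imset_f.
have E : f @: setT = diagram la.
  apply/eqP; rewrite eqEcard card_imset // cardsT card_ord card_diagram // leqnn andbT.
  by apply/subsetP=> _ /imsetP[j _ ->].
rewrite inE; apply/and3P; split; last 2 first.
- exact/injectiveP.
- by apply/forallP=> j; have := fD j; rewrite inE => /andP[].
apply/andP; split; apply/forallP=> t.
  by rewrite -(card_image_fiber (fun x => x.1 == t) finj) E card_diagram_row.
by rewrite -(card_image_fiber (fun x => x.2 == t) finj) E card_diagram_col.
Qed.
End Multipartitions.

(** * Reduction of coloured compositions to multipartitions *)

Section NormalForm.
Variable gT : finGroupType.
Local Notation Gamma := (dual gT).
Local Notation word := (seq (nat * Gamma)).
Implicit Types u v w : word.

Definition nonzero_parts w : word := [seq p <- w | p.1 != 0%N].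

Lemma weight_nonzero_parts w : weight (nonzero_parts w) = weight w.
Proof. by elim: w => // -[[|m] c] w /= IH; rewrite /weight /= -/(weight _) IH. Qed.

Lemma perm_weight w w' : perm_eq w w' -> weight w = weight w'.
Proof. by move=> ww'; apply/perm_sumn/perm_map. Qed.

Definition shape_word n (mu : {ffun Gamma * 'I_n -> 'I_n.+1}) : word :=
  word_of (@enum_rank (Gamma * 'I_n)%type) fst (fun t => mu t).

Lemma sum_nth_eq (l : seq nat) n m : (size l <= n)%N -> m != 0%N ->
  (\sum_(j < n) (nth 0 l j == m))%N = count_mem m l.
Proof.
move=> le_ln m0; rewrite -(big_mkord xpredT (fun j => nat_of_bool (nth 0 l j == m)%N)).
rewrite (big_cat_nat (n := size l)) //= [X in (_ + X)%N]big1_seq ?addn0; last first.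
  move=> j; rewrite mem_index_iota => /andP[_ /andP[le_lj _]].
  by rewrite nth_default // eq_sym (negbTE m0).
rewrite -(big_nth 0%N xpredT (fun x => nat_of_bool (x == m))) -sum1_count.
by rewrite [RHS]big_mkcond; apply: eq_bigr => x _ /=; case: (x == m).
Qed.

(** Sort the nonzero sizes of each colour in decreasing order and pad with zeros; a word of weight n
    has at most n nonzero sizes, so indices in ['I_n] suffice. *)
Lemma exists_shape n w : weight w = n ->
  exists2 mu : {ffun Gamma * 'I_n -> 'I_n.+1},
  multipartition mu & perm_eq (nonzero_parts w) (nonzero_parts (shape_word mu)).
Proof.
move=> wn; pose parts c := sort geq [seq p.1 | p <- nonzero_parts w & p.2 == c].
have le_size v : all (fun p => p.1 != 0%N) v -> (size v <= weight v)%N.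
  by elim: v => //= p v IH /andP[p0 /IH]; rewrite -(leq_add2l p.1) -add1n;
     apply: leq_trans; rewrite leq_add2r lt0n.
have size_parts c : (size (parts c) <= n)%N.
  rewrite size_sort size_map size_filter (leq_trans (count_size _ _)) //.
  by rewrite -wn -weight_nonzero_parts le_size // filter_all.
have le_parts c j : (nth 0 (parts c) j < n.+1)%N.
  case: (ltnP j (size (parts c))) => [lt_j|?]; last by rewrite nth_default.
  have := mem_nth 0%N lt_j; rewrite mem_sort => /mapP[p]; rewrite mem_filter => /andP[_ pw] ->.
  rewrite ltnS -wn -weight_nonzero_parts /weight sumnE big_map.
  by rewrite (big_rem p) //= leq_addr.
pose mu : {ffun Gamma * 'I_n -> 'I_n.+1} := [ffun t : Gamma * 'I_n => Ordinal (le_parts t.1 t.2)].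
have muE c (j : 'I_n) : mu (c, j) = nth 0%N (parts c) j :> nat by rewrite ffunE.
have perm_mu : perm_eq (nonzero_parts w) (nonzero_parts (shape_word mu)).
  apply/allP=> -[m c] _ /=; apply/eqP.
  case: (m =P 0%N) => [->|/eqP m0].
    have zero v : count_mem (0%N, c) (nonzero_parts v) = 0%N.
      by apply/count_memPn; rewrite mem_filter.
    by rewrite !zero.
  have count_nz v : count_mem (m, c) (nonzero_parts v) = count_mem (m, c) v.
    rewrite count_filter; apply: eq_count => -[m' c'] /=.
    by rewrite xpair_eqE; case: (m' =P m) => //= ->; rewrite m0 andbT.
  rewrite [RHS]count_nz /shape_word /word_of count_map.
  rewrite (seq.permP (permEl (perm_sort _ _))) -[RHS]sum1_count big_enum_cond /=.
  transitivity (\sum_(j < n) (mu (c, j) == m :> nat))%N; last first.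
    transitivity (\sum_(c' : Gamma) \sum_(j < n) ((mu (c', j) == m :> nat) && (c' == c)))%N.
      rewrite (bigD1 c) //= [X in (_ + X)%N]big1 ?addn0 => [|c' /negbTE ne_c].
        by apply: eq_bigr => j _; rewrite eqxx andbT.
      by apply: big1 => j _; rewrite ne_c andbF.
    rewrite pair_bigA [RHS]big_mkcond; apply: eq_bigr => -[c' j] _ /=.
    by rewrite xpair_eqE; case: (_ && _).
  under [RHS]eq_bigr => j _ do rewrite muE.
  rewrite sum_nth_eq // (seq.permP (permEl (perm_sort _ _))) count_map [RHS]count_filter.
  by apply: eq_count => -[m' c'] /=; rewrite xpair_eqE.
exists mu => //; apply/andP; split.
  have <- : weight (shape_word mu) = (\sum_t mu t)%N by apply: weight_word_of.
  by rewrite -weight_nonzero_parts -(perm_weight perm_mu) weight_nonzero_parts wn.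
apply/forallP=> c; apply/forallP=> i; apply/forallP=> j; apply/implyP=> le_ij.
rewrite !muE; case: (ltnP j (size (parts c))) => [lt_j|?]; last by rewrite (nth_default _ _).
have sp : sorted geq (parts c) by apply: sort_sorted => x y; apply: leq_total.
have tg : transitive geq by move=> x y z /= h1 h2; apply: leq_trans h2 h1.
have rg : reflexive geq by move=> x /=.
by have /(_ i j (leq_ltn_trans le_ij lt_j) lt_j le_ij) := sorted_leq_nth tg rg 0%N sp.
Qed.

Section Relation.
Variable R : word -> word -> Prop.
Hypotheses (R_refl : forall w, R w w) (R_sym : forall u v, R u v -> R v u).
Hypothesis R_trans : forall v u w, R u v -> R v w -> R u w.
Hypothesis R_swap : forall u v p q, R (u ++ p :: q :: v) (u ++ q :: p :: v).
Hypothesis R_zero : forall u v c, R (u ++ (0%N, c) :: v) (u ++ v).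

Lemma rel_nonzero_parts u w : R (u ++ w) (u ++ nonzero_parts w).
Proof.
elim: w u => [|[[|m] c] w IH] u //=; first exact: R_trans (R_zero _ _ _) (IH u).
by rewrite -!cat_rcons; apply: IH.
Qed.

Lemma rel_move u v w p : R (u ++ p :: v ++ w) (u ++ v ++ p :: w).
Proof.
elim: v u => [|q v IH] u //=; apply: R_trans (R_swap _ _ _ _) _.
by rewrite -!cat_rcons; have := IH (rcons u q); rewrite !cat_rcons.
Qed.

Lemma rel_perm u w w' : perm_eq w w' -> R (u ++ w) (u ++ w').
Proof.
elim: w w' u => [|p w IH] w' u ww'; first by move: ww'; rewrite perm_sym => /perm_nilP->.
have pw' : p \in w' by rewrite -(perm_mem ww') mem_head.
case/splitPr: pw' ww' => v1 v2 ww'.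
have {}ww' : perm_eq w (v1 ++ v2).
  by rewrite -(perm_cons p) (perm_trans ww') // -cat1s perm_catCA.
apply: R_trans (rel_move _ _ _ _).
by rewrite -!cat_rcons; apply: IH.
Qed.

(** The relation is abstract because it is used both for equality of characters ([wordchar_shape])
    and for congruence modulo the commutator ideal ([ideal_shape]). Instead of assuming that [R] is
    compatible with concatenation, the auxiliary lemmas carry a prefix [u]. *)
Lemma rel_nonzero_parts_perm w w' : perm_eq (nonzero_parts w) (nonzero_parts w') -> R w w'.
Proof.
move=> ww'; apply: R_trans (rel_nonzero_parts [::] w) _.
by apply: R_trans (rel_perm [::] ww') _; apply/R_sym/(rel_nonzero_parts [::]).
Qed.
End Relation.
End NormalForm.

(** * Unimodularity *)

Section ShapeCharacters.
Variable gT : finGroupType.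
Local Notation Gamma := (dual gT).
Local Notation word := (seq (nat * Gamma)).

Lemma perm_wordchar n (w w' : word) : perm_eq w w' -> wordchar n w = wordchar n w'.
Proof.
move=> /(perm_iotaP (0%N, 1%g))[I pI wE].
have sI : size I = size w' by rewrite (perm_size pI) size_iota.
have sw : size w = size I by rewrite wE size_map.
have lt_h (i : 'I_(size w)) : (nth 0%N I i < size w')%N.
  have : nth 0%N I i \in I by rewrite mem_nth // -sw.
  by rewrite (perm_mem pI) mem_iota.
pose h i := Ordinal (lt_h i).
have hinj : injective h.
  move=> i j [] /eqP; rewrite nth_uniq -?sw // => [/eqP/ord_inj //|].
  by rewrite (perm_uniq pI) iota_uniq.
have hE i : nth (0%N, 1%g) w' (h i) = nth (0%N, 1%g) w i.
  have nE k : (k < size I)%N -> nth (0%N, 1%g) w k = nth (0%N, 1%g) w' (nth 0%N I k).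
    by move=> lt_k; rewrite wE (nth_map 0%N).
  by rewrite nE // -sw.
apply: (wchar_relabel _ hinj) => [i|u|i]; rewrite /wsize /wcolor ?hE //.
have cwE : #|'I_(size w')| = #|'I_(size w)| by rewrite !card_ord sw sI.
by rewrite (inj_card_onto hinj) // cwE.
Qed.

Lemma lift0_notin k (u : 'I_k.+1) : u \notin codom (lift (@ord0 k)) -> u = ord0.
Proof.
case: (unliftP ord0 u) => [j ->|-> //]; by rewrite codom_f.
Qed.

Lemma wordchar_zero n c (w : word) : wordchar n ((0%N, c) :: w) = wordchar n w.
Proof.
symmetry; apply: (wchar_relabel n (h := lift (@ord0 (size w)))) => //.
- exact: lift_inj.
- by move=> u /lift0_notin->.
Qed.

Lemma wprod_zero n c (w : word) : wprod n ((0%N, c) :: w) = wprod n w.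
Proof.
symmetry; apply: (wsum_relabel n (h := lift (@ord0 (size w)))) => //.
- exact: lift_inj.
- by move=> u /lift0_notin->.
Qed.

Section Degree.
Variable n : nat.
Local Notation shape := {ffun Gamma * 'I_n -> 'I_n.+1}.
Local Notation W := (wreath gT n).

Definition hchar (mu : shape) : 'CF([set: W]) := wchar n fst (fun t => mu t).

(** The analogue of the elementary symmetric function of the conjugate partition, where [hchar] is
    the analogue of the complete one. *)
Definition echar (la : shape) : 'CF([set: W]) := wsgn gT n * wchar n fst (transpose la).

Lemma hcharE mu : hchar mu = wordchar n (shape_word mu).
Proof. exact: wchar_word_of. Qed.

Lemma wordchar_shape (w : word) : weight w = n ->
  exists2 mu : shape, multipartition mu & wordchar n w = hchar mu.
Proof.
case/exists_shape=> mu pmu ww; exists mu => //; rewrite hcharE.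
apply: (rel_nonzero_parts_perm (R := fun u v => wordchar n u = wordchar n v)) ww => //.
- by move=> v u w' -> ->.
- by move=> u v p q; apply: perm_wordchar; rewrite perm_cat2l;
    exact: permEl (perm_catCA [:: p] [:: q] v).
- move=> u v c; rewrite -(wordchar_zero _ c (u ++ v)); apply: perm_wordchar.
  exact: permEl (perm_catCA u [:: (0%N, c)] v).
Qed.

Lemma cfdot_echar la mu :
  '[echar la, hchar mu] = #|fillings la mu|%:R / n`!%:R.
Proof. exact: cfdot_wsgn. Qed.

Lemma cfdot_echar_diag la : multipartition la -> '[echar la, hchar la] = 1.
Proof.
move=> pla; rewrite cfdot_echar card_fillings_diag // divff //.
by rewrite pnatr_eq0 -lt0n fact_gt0.
Qed.

Lemma cfdot_echar_tri la mu : multipartition la ->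
  (rank_shape mu <= rank_shape la)%N -> mu != la -> '[echar la, hchar mu] = 0.
Proof.
move=> pla le_r ne; rewrite cfdot_echar (_ : #|_| = 0%N) ?mul0r //.
apply: eq_card0 => f; apply/negP=> fF; case/eqP: ne; symmetry.
have := fillings_rank pla fF => le_r'.
have rE : rank_shape la = rank_shape mu.
  by apply/eqP; rewrite eqn_leq le_r (leq_trans (leq_addr _ _) le_r').
by have [] := fillings_eq pla fF rE.
Qed.

Lemma wspan_hchar mu : wspan (hchar mu).
Proof. exact: wspan_wchar. Qed.

Lemma wspan_echar la : wspan (echar la).
Proof. by apply: wspanM; [apply: wspan_wsgn|apply: wspan_wchar]. Qed.

(* By induction on the rank, using that the pairing is unitriangular. *)
Lemma wspan_unimodular (psi : 'CF([set: W])) : psi \in 'Z[irr [set: W]]%g ->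
  exists2 phi, wspan phi &
    forall mu, multipartition mu -> '[phi, hchar mu] = '[psi, hchar mu].
Proof.
move=> Zpsi; suffices /(_ (n * n).+1)[phi sphi E] : forall k, exists2 phi, wspan phi &
    forall mu, multipartition mu -> (rank_shape mu < k)%N ->
      '[phi, hchar mu] = '[psi, hchar mu].
  by exists phi => // mu pmu; apply: E; rewrite // ltnS rank_shape_le.
elim=> [|k [phi sphi E]]; first by exists 0 => //; apply: wspan0.
have dotZ mu : exists m : int, '[psi - phi, hchar mu] = m%:~R.
  apply/intrP; apply: Cint_cfdot_vchar; last exact/wspan_vchar/wspan_hchar.
  by apply: rpredB => //; apply: wspan_vchar.
have /fin_all_exists[m mE] := dotZ.
pose P (mu : shape) := multipartition mu && (rank_shape mu == k).
exists (phi + \sum_(la | P la) echar la *~ m la).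
  by apply: wspanD => //; apply: wspan_sum => la _; apply/wspanMz/wspan_echar.
move=> mu pmu; rewrite ltnS leq_eqVlt cfdotDl cfdot_suml => /orP[/eqP rmu|lt_mu].
  rewrite (bigD1 mu) /=; last by rewrite /P pmu rmu eqxx.
  rewrite big1 ?addr0 => [|la /andP[/andP[pla /eqP rla] ne]].
    by rewrite -scaler_int cfdotZl cfdot_echar_diag // mulr1 -mE cfdotBl addrC subrK.
  by rewrite -scaler_int cfdotZl cfdot_echar_tri ?mulr0 ?rla ?rmu // eq_sym.
rewrite big1 ?addr0 ?E // => la /andP[pla /eqP rla].
rewrite -scaler_int cfdotZl cfdot_echar_tri ?mulr0 ?rla ?(ltnW lt_mu) //.
by apply: contraTneq lt_mu => ->; rewrite rla ltnn.
Qed.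

Lemma wspan_orthogonal (psi phi : 'CF([set: W])) :
    (forall mu, multipartition mu -> '[psi, hchar mu] = 0) -> wspan phi ->
  '[psi, phi] = 0.
Proof.
move=> Z; elim/wspan_ind=> [w|phi' phi'' E' E''|phi' m E].
- case: (weight w =P n) => [/wordchar_shape[mu pmu ->]|/eqP wn]; first exact: Z.
  by rewrite /wordchar wchar_degree ?cfdot0r // sum_wsize.
- by rewrite cfdotDr E' E'' addr0.
- by rewrite -scaler_int cfdotZr E mulr0.
Qed.

(** Pairing the relation with [echar la], for [la] of largest rank among those with nonzero
    coefficient, isolates that coefficient. *)
Lemma hchar_free (b : shape -> int) :
    \sum_(mu | multipartition mu) hchar mu *~ b mu = 0 ->
  forall mu, multipartition mu -> b mu = 0.
Proof.
move=> Z mu0 pmu0; apply/eqP; apply: contraT => bmu0.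
pose P (mu : shape) := multipartition mu && (b mu != 0).
have Pmu0 : P mu0 by rewrite /P pmu0.
case: (arg_maxnP (@rank_shape Gamma n) Pmu0) => la /andP[pla bla] max_la.
have := congr1 (cfdot (echar la)) Z; rewrite cfdot0r cfdot_sumr.
rewrite (bigD1 la) //= big1 ?addr0 => [|mu /andP[pmu ne]].
  rewrite -scaler_int cfdotZr cfdot_echar_diag // mulr1 => /eqP.
  by rewrite conjC_eq0 intr_eq0 (negbTE bla).
rewrite -scaler_int cfdotZr; case: (b mu =P 0) => [->|/eqP bmu].
  by rewrite rmorph0 mul0r.
by rewrite cfdot_echar_tri ?mulr0 //; apply: max_la; rewrite /P pmu.
Qed.
End Degree.

Hypothesis abG : abelian [set: gT].

(** All irreducible characters of an abelian group are linear, so this sum is the regular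
    character. *)
Lemma sum_dual (x : gT) : \sum_(c : Gamma) dual_char c x = (#|gT| * (x == 1%g))%:R.
Proof.
have lin i := char_abelianP _ abG i.
have E : \sum_(i : Iirr [set: gT]) 'chi_i x = (#|gT| * (x == 1%g))%:R.
  have := cfRegE [set: gT] x; rewrite cfReg_sum sum_cfunE cardsT.
  rewrite -mulrnA => <-.
  by apply: eq_bigr => i _; rewrite cfunE lin_char1 ?mul1r.
rewrite -E; apply: (big_bij (P := xpredT) (Q := xpredT) (h := val) (fun i => 'chi_i x)) => //.
- by move=> c d _ _; apply: val_inj.
- by move=> i _; exists (exist _ i (lin i)).
Qed.

(** Words with all letters distinct are fixed by no nontrivial permutation, and summing over all
    colourings kills the elements with nontrivial base by [sum_dual]. *)
Lemma wspan_regular n : exists2 phi : 'CF([set: wreath gT n]), wspan phi &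
  exists2 m : nat, m != 0%N & forall h, phi h = m%:R *+ (h == 1%g).
Proof.
pose one := fun _ : 'I_n => 1%N.
have injf (f : {ffun 'I_n -> 'I_n}) : has_content one f -> injective f.
  move=> /has_contentP f1 i j fij; have /eqP/cards1P[x E] := f1 (f j).
  have : i \in [set k | f k == f j] by rewrite inE fij.
  have : j \in [set k | f k == f j] by rewrite inE eqxx.
  by rewrite E !inE => /eqP-> /eqP.
exists (\sum_(c : {ffun 'I_n -> Gamma}) wchar n c one).
  by apply: wspan_sum => c _; apply: wspan_wchar.
exists (#|[set f : {ffun 'I_n -> 'I_n} | has_content one f]| * #|gT| ^ n)%N.
  rewrite -lt0n muln_gt0 expn_gt0 (cardD1 1%g) inE /= andbT.
  rewrite card_gt0; apply/set0Pn; exists [ffun i => i]; rewrite inE.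
  apply/has_contentP=> t; apply/eqP/cards1P; exists t.
  by apply/setP=> i; rewrite !inE ffunE.
move=> h; rewrite sum_cfunE; under eq_bigr => c _ do rewrite wcharE.
rewrite exchange_big /= natrM -mulrnAr.
rewrite -sum1dep_card natr_sum mulr_suml; apply: eq_bigr => f fc.
have finj := injf f fc.
have E : \sum_(c : {ffun 'I_n -> Gamma}) word_eval c h f =
    (#|gT| ^ n * (wr_base h == [ffun=> 1%g]))%:R.
  transitivity (\sum_(c : {ffun 'I_n -> Gamma}) \prod_j dual_char (c j) (wr_base h j)).
    have := sum_word_perm xpredT (perm finj)
      (fun c : {ffun 'I_n -> Gamma} => \prod_j dual_char (c j) (wr_base h j)) => <-.
    by apply: eq_bigr => c _; apply: eq_bigr => j _; rewrite ffunE permE.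
  rewrite -(bigA_distr_bigA (fun j c => dual_char c (wr_base h j))) /=.
  under eq_bigr => j _ do rewrite sum_dual.
  rewrite -natr_prod big_split /= prod_nat_const card_ord; congr (_ * _)%:R.
  case: eqP => [->|ne]; first by rewrite big1 // => j _; rewrite ffunE eqxx.
  case: (pickP (fun j => wr_base h j != 1%g)) => [j /negbTE hj|all1].
    by rewrite (bigD1 j) //= hj.
  by case: ne; apply/ffunP=> j; rewrite ffunE; apply/eqP; have := all1 j; case: eqP.
rewrite mul1r /word_char -mulr_sumr E -natrM -mulrnA; congr (_%:R).
have -> : (h == 1%g) = (word_perm (wr_perm h) f == f) && (wr_base h == [ffun=> 1%g]).
  apply/eqP/andP=> [->|[/eqP/ffunP hf /eqP hb]]; first by rewrite word_perm1.
  case: h hf hb {E} => g s /= sf ->; congr Wreath; apply/permP=> j.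
  by apply: finj; rewrite perm1; have := sf j; rewrite ffunE.
by rewrite -mulnb mulnCA.
Qed.

(** Unimodularity gives a lattice element [phi] such that [chi - phi] is orthogonal to the lattice,
    [phi] included, so the norms of [phi] and [chi - phi] are natural numbers with sum 1. *)
Lemma irr_wspan n (i : Iirr [set: wreath gT n]) : wspan 'chi_i.
Proof.
have [phi sphi phiE] := wspan_unimodular (irr_vchar i).
have orth : forall mu, multipartition mu -> '['chi_i - phi, hchar mu] = 0.
  by move=> mu pmu; rewrite cfdotBl phiE // subrr.
have dot0 psi : wspan psi -> '['chi_i - phi, psi] = 0 by apply: wspan_orthogonal.
have Zphi := wspan_vchar sphi.
have dot1 : '['chi_i - phi, phi] = 0 by apply: dot0.
have normE : '['chi_i - phi] = 1 - '[phi].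
  have := dot1; rewrite cfdotBl => /eqP; rewrite subr_eq0 => /eqP chi_phi.
  rewrite cfnormB chi_phi cfnorm_irr.
  have /natrP[k ->] : '[phi] \in Num.nat by apply: Cnat_cfnorm_vchar.
  by rewrite rmorph_nat -mulr2n mulr2n opprD addrA addrK.
have /natrP[a aE] : '[phi] \in Num.nat by apply: Cnat_cfnorm_vchar.
have /natrP[b bE] : '['chi_i - phi] \in Num.nat.
  by apply: Cnat_cfnorm_vchar; apply: rpredB => //; apply: irr_vchar.
have ab : (b + a = 1)%N.
  by apply/eqP; rewrite -(eqr_nat algC) natrD -aE -bE normE subrK.
case: a b ab aE bE => [|[|a]] [|[|b]] // _ aE bE; last first.
  by move/eqP: bE; rewrite cfnorm_eq0 subr_eq0 => /eqP->.
(* Now [chi] is orthogonal to the lattice, hence to a positive multiple of the regular character,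
   against its nonzero value at 1. *)
have phi0 : phi = 0 by apply/eqP; rewrite -cfnorm_eq0 aE.
have [reg sreg [m m0 regE]] := wspan_regular n.
have := dot0 _ sreg; rewrite phi0 subr0 cfdotE cardsT.
rewrite (bigD1 1%g) ?inE //= big1 ?addr0 => [|h /andP[_ /negbTE h1]]; last first.
  by rewrite regE h1 rmorph0 mulr0.
rewrite regE eqxx mulr1n => /eqP; rewrite !mulf_eq0 invr_eq0 conjC_nat !pnatr_eq0.
rewrite (negbTE m0) (negbTE (irr1_neq0 i)) orbF orbF => /eqP W0.
by have := cardD1 (1%g : wreath gT n) (wreath gT n); rewrite W0 inE.
Qed.
End ShapeCharacters.

(** * The Solomon homomorphism *)

Lemma sum_rank_inj (T1 T2 : finType) (r1 : T1 -> nat) (r2 : T2 -> nat) :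
  injective r1 -> injective r2 -> injective (sum_rank r1 r2).
Proof.
have ltb t t' : (r1 t < (\max_t r1 t).+1 + r2 t')%N.
  by rewrite addSn ltnS (leq_trans (leq_bigmax _)) ?leq_addr.
move=> i1 i2 [t|t] [t'|t'] /= E.
- by rewrite (i1 _ _ E).
- by have := ltb t t'; rewrite E ltnn.
- by have := ltb t' t; rewrite E ltnn.
- by move/addnI/i2: E => ->.
Qed.

Section Solomon.
Variables (gT : finGroupType).
Hypothesis abG : abelian [set: gT].
Local Notation Gamma := (dual gT).
Local Notation word := (seq (nat * Gamma)).
Implicit Types x y : fmod gT.

Lemma conj_irr_lift n (i : Iirr [set: wreath gT n]) :
  exists s : seq (int * word), ('chi_i)^*%CF == zchar_of n s.
Proof. by have [s ->] := wspan_conj (irr_wspan abG i); exists s. Qed.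

(* On MR, Theta x is recovered from its scalar products with the irreducible  *)
(* characters, which are values of varpi_tot; this makes sense on all of F.   *)
Definition Theta x : cfamily gT := fun n =>
  \sum_i (varpi_tot x (zprod_of n (xchoose (conj_irr_lift i))))%:~R *: 'chi_i.

HB.instance Definition _ x := GRing.isZmodMorphism.Build (fmod gT) int
  (varpi_tot x) (extend2_is_additiver _ x).

Lemma varpi_zprod n (T : finType) r (c : T -> Gamma) a s : injective r ->
  (varpi_tot (wsum r c n a) (zprod_of n s))%:~R = '[wchar n c a, (zchar_of n s)^*%CF].
Proof.
move=> rinj; rewrite /zprod_of (raddf_sum (varpi_tot _)) /zchar_of mulrz_sumr.
rewrite rmorph_sum cfdot_sumr; apply: eq_bigr => p _ /=.
rewrite (raddfMz (varpi_tot _)) -[varpi_tot _ _ *~ _]mulrzr rmorphM /=.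
rewrite varpi_wsum //; last exact: val_inj.
rewrite (raddfMz (cfAut Num.conj) p.1 (wordchar n p.2)) -[X in _ = '[_, X]]scaler_int.
by rewrite cfdotZr mulrC !rmorph_int.
Qed.

(** [Theta] is defined with lifts of the conjugates of the irreducible characters and [varpi_tot]
    conjugates once more, so its coefficients are those of the decomposition into irreducible
    characters. *)
Lemma Theta_wsum m n (T : finType) r (c : T -> Gamma) a : injective r ->
  Theta (wsum r c m a) n = if m == n then wchar n c a else 0.
Proof.
move=> rinj; rewrite /Theta; case: eqP => [->|/eqP mn]; last first.
  rewrite big1 // => i _; rewrite /zprod_of (raddf_sum (varpi_tot _)) big1 ?scale0r // => p _.
  by rewrite (raddfMz (varpi_tot _)) /= varpi_wsum_neq ?mul0rz.
rewrite [RHS]cfun_sum_cfdot; apply: eq_bigr => i _; congr (_ *: _).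
rewrite varpi_zprod //; congr '[_, _].
by rewrite -(eqP (xchooseP (conj_irr_lift i))) cfConjCK.
Qed.

Lemma Theta_wprod m n (w : word) :
  Theta (wprod m w) n = if m == n then wordchar n w else 0.
Proof. exact/Theta_wsum/val_inj. Qed.

Definition Theta_component n x := Theta x n.

Lemma Theta_is_additive n : zmod_morphism (Theta_component n).
Proof.
move=> x y; rewrite /Theta_component /Theta -sumrB; apply: eq_bigr => i _.
by rewrite -scalerBl /varpi_tot extend2_is_additivel rmorphB.
Qed.

HB.instance Definition _ n := GRing.isZmodMorphism.Build (fmod gT) _
  (Theta_component n) (Theta_is_additive n).

Lemma ThetaB x y n : Theta (x - y) n = Theta x n - Theta y n.
Proof. exact: Theta_is_additive. Qed.

Lemma ThetaD x y n : Theta (x + y) n = Theta x n + Theta y n.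
Proof. exact: (raddfD (Theta_component n)). Qed.

Lemma Theta0 n : Theta 0 n = 0.
Proof. exact: (raddf0 (Theta_component n)). Qed.

Lemma ThetaMz x m n : Theta (x *~ m) n = Theta x n *~ m.
Proof. exact: (raddfMz (Theta_component n)). Qed.

Lemma Theta_sum (I : Type) (r : seq I) (P : pred I) (F : I -> fmod gT) n :
  Theta (\sum_(i <- r | P i) F i) n = \sum_(i <- r | P i) Theta (F i) n.
Proof. exact: (raddf_sum (Theta_component n)). Qed.

Lemma Theta_vchar x n : Theta x n \in 'Z[irr [set: wreath gT n]]%g.
Proof.
by apply: rpred_sum => i _; rewrite scaler_int rpredMz // irr_vchar.
Qed.

Lemma Theta_bounded x : MR x -> exists N, forall n, (N <= n)%N -> Theta x n = 0.
Proof.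
elim/MR_ind=> {x} [w||x y [M xM] [N yN]].
- by exists (weight w).+1 => n lt_n; rewrite Theta_wprod ltn_eqF.
- by exists 0%N => n _; rewrite Theta0.
- exists (maxn M N) => n; rewrite geq_max => /andP[le_M le_N].
  by rewrite ThetaB xM // yN // subr0.
Qed.

(** The family [F] lets both branches live in degree [m] without a cast. *)
Lemma rep_inE n (F : cfamily gT) m : rep_in (F n) m = if n == m then F m else 0.
Proof.
rewrite /rep_in; case: eqP => [<-|/eqP nm]; first exact: dfwith_in.
by rewrite dfwith_out.
Qed.

Lemma wordchar_nil : wordchar 0 [::] = 1 :> 'CF([set: wreath gT 0]).
Proof.
apply/cfunP=> h; rewrite wcharE cfun1E inE (big_pred1 [ffun i => i]) => [|f].
  rewrite /word_char /word_eval big_ord0 mulr1 [_ == _](_ : _ = true) //.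
  by apply/eqP/ffunP=> -[].
have -> : f = [ffun i => i] by apply/ffunP=> -[].
by rewrite /= eqxx; apply/has_contentP=> -[].
Qed.

Lemma wordchar1 n (c : Gamma) : wordchar n [:: (n, c)] = eta_char n c.
Proof.
rewrite eta_wchar; symmetry.
apply: (wchar_relabel n (h := fun=> @ord0 0)) => //; first by move=> [] [].
by move=> u; rewrite (ord1 u) => /negP[]; apply/codomP; exists tt.
Qed.

Lemma Theta_ygen n c m : Theta (ygen n c) m = rep_in (eta_char n c) m.
Proof.
rewrite -wprod1 Theta_wprod (rep_inE n (fun n => eta_char n c)).
by case: eqP => // <-; rewrite wordchar1.
Qed.

Lemma Theta_one n : Theta (ext_one gT) n = rep_in (1 : 'CF([set: wreath gT 0])) n.
Proof.
rewrite -wprod_nil Theta_wprod (rep_inE 0 (fun=> 1)).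
by case: eqP => // <-; rewrite wordchar_nil.
Qed.

Lemma ecastB m n (e : m = n) (phi psi : 'CF([set: wreath gT m])) :
  ecast m 'CF([set: wreath gT m]) e (phi - psi) =
  ecast m 'CF([set: wreath gT m]) e phi - ecast m 'CF([set: wreath gT m]) e psi.
Proof. by case: _ / e. Qed.

Lemma ind2Bl k l (phi phi' : 'CF([set: wreath gT k])) (psi : 'CF([set: wreath gT l])) :
  ind2 (phi - phi') psi = ind2 phi psi - ind2 phi' psi.
Proof.
rewrite /ind2 -!raddfB /=; congr ('Ind[_] (cfIsom _ _)); apply/cfunP=> h.
by rewrite !cfunE mulrBl.
Qed.

Lemma ind2Br k l (phi : 'CF([set: wreath gT k])) (psi psi' : 'CF([set: wreath gT l])) :
  ind2 phi (psi - psi') = ind2 phi psi - ind2 phi psi'.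
Proof.
rewrite /ind2 -!raddfB /=; congr ('Ind[_] (cfIsom _ _)); apply/cfunP=> h.
by rewrite !cfunE mulrBr.
Qed.

Lemma ind20l k l (psi : 'CF([set: wreath gT l])) : ind2 (0 : 'CF([set: wreath gT k])) psi = 0.
Proof. by have := ind2Bl (0 : 'CF([set: wreath gT k])) 0 psi; rewrite !subrr. Qed.

Lemma ind20r k l (phi : 'CF([set: wreath gT k])) : ind2 phi (0 : 'CF([set: wreath gT l])) = 0.
Proof. by have := ind2Br phi (0 : 'CF([set: wreath gT l])) 0; rewrite !subrr. Qed.

Lemma rep_mulBl (r r' s : cfamily gT) n :
  rep_mul (fun m => r m - r' m) s n = rep_mul r s n - rep_mul r' s n.
Proof. by rewrite /rep_mul -sumrB; apply: eq_bigr => i _; rewrite ind2Bl ecastB. Qed.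

Lemma rep_mulBr (r s s' : cfamily gT) n :
  rep_mul r (fun m => s m - s' m) n = rep_mul r s n - rep_mul r s' n.
Proof. by rewrite /rep_mul -sumrB; apply: eq_bigr => i _; rewrite ind2Br ecastB. Qed.

Lemma eq_rep_mul (r r' s s' : cfamily gT) n :
  (forall m, r m = r' m) -> (forall m, s m = s' m) -> rep_mul r s n = rep_mul r' s' n.
Proof. by move=> rr ss; apply: eq_bigr => i _; rewrite rr ss. Qed.

Lemma rep_mul0l (r s : cfamily gT) n : (forall m, r m = 0) -> rep_mul r s n = 0.
Proof.
move=> r0; rewrite -(subrr (rep_mul r s n)) -rep_mulBl; apply: eq_rep_mul => // m.
by rewrite r0 subr0.
Qed.

Lemma rep_mul0r (r s : cfamily gT) n : (forall m, s m = 0) -> rep_mul r s n = 0.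
Proof.
move=> s0; rewrite -(subrr (rep_mul r s n)) -rep_mulBr; apply: eq_rep_mul => // m.
by rewrite s0 subr0.
Qed.

Lemma ind2_wchar_cast k l n (e : (k + l)%N = n) (T1 T2 : finType)
    (c1 : T1 -> Gamma) (c2 : T2 -> Gamma) a1 a2 : (\sum_t a1 t)%N = k ->
  ecast m 'CF([set: wreath gT m]) e (ind2 (wchar k c1 a1) (wchar l c2 a2)) =
  wchar n (sum_color c1 c2) (sum_content2 a1 a2).
Proof. by move=> a1k; case: _ / e; apply: ind2_wchar. Qed.

Lemma ecast0 m n (e : m = n) : ecast m 'CF([set: wreath gT m]) e 0 = 0.
Proof. by case: _ / e. Qed.

Lemma Theta_ext_mul x y n : MR x -> MR y ->
  Theta (ext_mul x y) n = rep_mul (Theta x) (Theta y) n.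
Proof.
move=> Rx Ry; elim/MR_ind: x / Rx => [u||x x' IH IH']; last 2 first.
- rewrite /ext_mul extend2C raddf0 Theta0 rep_mul0l // => m; exact: Theta0.
- rewrite /ext_mul extend2_is_additivel -/(ext_mul _ _) ThetaB IH IH' -rep_mulBl.
  by apply: eq_rep_mul => m; rewrite ?ThetaB.
elim/MR_ind: y / Ry => [v||y y' IH IH']; last 2 first.
- rewrite /ext_mul raddf0 Theta0 rep_mul0r // => m; exact: Theta0.
- rewrite /ext_mul raddfB -/(ext_mul _ _) ThetaB IH IH' -rep_mulBr.
  by apply: eq_rep_mul => m; rewrite ?ThetaB.
rewrite ext_mul_wsum ?sum_wsize // Theta_wsum; last first.
  apply: sum_rank_inj; exact: val_inj.
have term (i : 'I_n.+1) :
    ecast m 'CF([set: wreath gT m]) (subnKC (leq_ord i))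
      (ind2 (Theta (wprod (weight u) u) i) (Theta (wprod (weight v) v) (n - i)%N)) =
    if (weight u == i) && (weight v == n - i)%N
    then wchar n (sum_color (wcolor (w := u)) (wcolor (w := v)))
           (sum_content2 (@wsize _ u) (@wsize _ v)) else 0.
  rewrite !Theta_wprod; case: eqP => [ui|_] /=; last first.
    by rewrite ind20l ecast0.
  case: eqP => [_|_]; last by rewrite ind20r ecast0.
  by apply: ind2_wchar_cast; rewrite sum_wsize.
rewrite /rep_mul (eq_bigr _ (fun i _ => term i)).
case: eqP => [uvn|uvn].
  have lt_u : (weight u < n.+1)%N by rewrite ltnS -uvn leq_addr.
  rewrite (bigD1 (Ordinal lt_u)) //= -[X in _ == (X - _)%N]uvn addKn !eqxx /=.
  rewrite big1 ?addr0 // => i ne_i; case: eqP => //= ui.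
  by case/eqP: ne_i; apply: ord_inj.
rewrite big1 // => i _; case: eqP => //= ui; case: eqP => //= vi.
by case: uvn; rewrite ui vi subnKC // -ltnS.
Qed.

Lemma Theta_Solomon : Solomon_morphism Theta.
Proof.
split; last exact: Theta_ygen.
split.
- move=> x Rx; split=> [n|]; [exact: Theta_vchar|exact: Theta_bounded].
- by move=> x y _ _ n; apply: ThetaB.
- exact: Theta_one.
- by move=> x y Rx Ry n; apply: Theta_ext_mul.
Qed.

Lemma Solomon_unique theta : Solomon_morphism theta ->
  forall x, MR x -> forall n, theta x n = Theta x n.
Proof.
move=> [[_ thB th1 thM] thg] x; elim=> [n|m c n|{}x y Rx IHx Ry IHy n|{}x y Rx IHx Ry IHy n].
- by rewrite th1 Theta_one.
- by rewrite thg Theta_ygen.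
- by rewrite thB // IHx IHy ThetaB.
- by rewrite thM // Theta_ext_mul //; apply: eq_rep_mul.
Qed.
End Solomon.

(** * Surjectivity, and the kernel as the commutator ideal *)

Section KernelIdeal.
Variables (gT : finGroupType).
Hypothesis abG : abelian [set: gT].
Local Notation Gamma := (dual gT).
Local Notation word := (seq (nat * Gamma)).
Local Notation Theta := (Theta abG).
Implicit Types x y : fmod gT.

Lemma Theta_zprod n m (s : seq (int * word)) :
  Theta (zprod_of n s) m = if n == m then zchar_of m s else 0.
Proof.
rewrite /zprod_of Theta_sum /zchar_of.
transitivity (\sum_(p <- s) (if n == m then wordchar m p.2 *~ p.1 else 0)).
  apply: eq_bigr => p _; rewrite ThetaMz Theta_wprod.
  by case: eqP; rewrite ?mul0rz.
by case: eqP => // _; rewrite big1.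
Qed.

Lemma vchar_wspan n (psi : 'CF([set: wreath gT n])) :
  psi \in 'Z[irr [set: wreath gT n]]%g -> wspan psi.
Proof.
move=> Zpsi; rewrite [psi]cfun_sum_cfdot; apply: wspan_sum => i _.
have /intrP[m ->] := Cint_cfdot_vchar_irr i Zpsi.
by rewrite scaler_int; apply/wspanMz/irr_wspan.
Qed.

Lemma homogeneousMz n x m : homogeneous n x -> homogeneous n (x *~ m).
Proof.
by move=> xn b; rewrite -mcoeff_neq0 -scaler_int mcoeffZ mulf_eq0 => /norP[_];
  rewrite mcoeff_neq0; apply: xn.
Qed.

Lemma MRn_zprod n (s : seq (int * word)) : MRn n (zprod_of n s).
Proof.
apply: MRn_sum => p _; split; first by apply/MR_mulz/MR_wprod.
by apply/homogeneousMz/wprod_homogeneous.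
Qed.

Lemma Theta_surj_degree n psi : psi \in 'Z[irr [set: wreath gT n]]%g ->
  exists x, MRn n x /\ forall m, Theta x m = rep_in psi m.
Proof.
case/vchar_wspan=> s psiE; exists (zprod_of n s); split; first exact: MRn_zprod.
by move=> m; rewrite Theta_zprod psiE (rep_inE n (fun n => zchar_of n s)).
Qed.

Lemma Theta_surj (r : cfamily gT) : in_Rep r ->
  exists x, MR x /\ forall n, Theta x n = r n.
Proof.
move=> [Zr [N rN]].
have /fin_all_exists[x xE] (i : 'I_N) : exists x, MRn i x /\
    forall m, Theta x m = rep_in (r i) m.
  exact: Theta_surj_degree.
exists (\sum_i x i); split; first by apply: MR_sum => i _; case: (xE i) => -[].
move=> n; rewrite Theta_sum.
have termE (i : 'I_N) : Theta (x i) n = if i == n :> nat then r n else 0.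
  by have [_ ->] := xE i; rewrite rep_inE.
rewrite (eq_bigr _ (fun i _ => termE i)).
case: (ltnP n N) => [lt_n|le_N].
  rewrite (bigD1 (Ordinal lt_n)) //= eqxx big1 ?addr0 // => i ne.
  by case: eqP => // E; case/eqP: ne; apply: ord_inj.
by rewrite rN // big1 // => i _; rewrite ltn_eqF // (leq_trans (ltn_ord i)).
Qed.

Definition commutators z := exists m n (c d : Gamma),
  [/\ (1 <= m)%N, (1 <= n)%N &
      z = ext_mul (ygen m c) (ygen n d) - ext_mul (ygen n d) (ygen m c)].

Local Notation I := (ideal_gen (@ext_mul gT) (@MR gT) commutators).
Local Notation W w := (wprod (weight w) w : fmod gT).

Lemma ideal_opp x : I x -> I (- x).
Proof. by move=> Ix; rewrite -sub0r; apply: ideal_genB => //; apply: ideal_gen0. Qed.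

Lemma ideal_add x y : I x -> I y -> I (x + y).
Proof. by move=> Ix Iy; rewrite -[y]opprK; apply: ideal_genB => //; apply: ideal_opp. Qed.

Lemma wprod_letter n (c : Gamma) : W [:: (n, c)] = ygen n c.
Proof. by rewrite /weight /= addn0 wprod1. Qed.

Lemma wprod_skip_zero u v (c : Gamma) : W (u ++ (0%N, c) :: v) = W (u ++ v).
Proof. by rewrite -!wprod_cat -[weight (_ :: v)]/(weight v) wprod_zero. Qed.

Lemma ideal_swap u v (p q : nat * Gamma) : I (W (u ++ p :: q :: v) - W (u ++ q :: p :: v)).
Proof.
case: p q => [m c] [n d].
(* A letter of size 0 contributes the factor y_{0,c} = 1, so moving it leaves the product unchanged;
   the same applies to [n]. *)
case: m => [|m].
  rewrite wprod_skip_zero -(cat1s _ ((0%N, c) :: v)) catA wprod_skip_zero -catA subrr.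
  exact: ideal_gen0.
case: n => [|n].
  rewrite wprod_skip_zero -(cat1s _ ((0%N, d) :: v)) catA wprod_skip_zero -catA subrr.
  exact: ideal_gen0.
have E p q : W (p :: q :: v) = ext_mul (ext_mul (W [:: p]) (W [:: q])) (W v).
  by rewrite !wprod_cat.
rewrite -!(wprod_cat u) !E !wprod_letter.
rewrite /ext_mul -raddfB /=; apply: ideal_genMl; first exact: MR_wprod.
rewrite -extend2_is_additivel; apply: ideal_genMr; first exact: MR_wprod.
by apply: ideal_gen_in; exists m.+1, n.+1, c, d.
Qed.

Lemma ideal_shape w : exists2 mu : {ffun Gamma * 'I_(weight w) -> 'I_(weight w).+1},
  multipartition mu & I (W w - wprod (weight w) (shape_word mu)).
Proof.
have [mu pmu ww] := exists_shape (erefl (weight w)); exists mu => //.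
have weight_mu : weight (shape_word mu) = weight w.
  by rewrite -[RHS]weight_nonzero_parts (perm_weight ww) weight_nonzero_parts.
rewrite -[X in wprod X (shape_word mu)]weight_mu.
apply: (rel_nonzero_parts_perm (R := fun u v => I (W u - W v))) ww.
- by move=> v; rewrite subrr; apply: ideal_gen0.
- by move=> u v uv; rewrite -opprB; apply: ideal_opp.
- by move=> v u w' uv vw; rewrite -(subrK (W v) (W u)) -addrA; apply: ideal_add.
- exact: ideal_swap.
- by move=> u v c; rewrite wprod_skip_zero subrr; apply: ideal_gen0.
Qed.

Lemma ideal_in_kernel x : I x -> in_kernel Theta x.
Proof.
elim=> [|{}x [m [n [c [d [m0 n0 ->]]]]]|{}x y _ [Rx xE] _ [Ry yE]|a {}x Ra _ [Rx xE]|
  a {}x Ra _ [Rx xE]].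
- by split=> [|n]; [apply: MR0|apply: Theta0].
- split=> [|k]; first by apply: MR_sub; apply: MR_mul; apply: MR_gen.
  rewrite -!wprod_letter !wprod_cat ThetaB !Theta_wprod.
  have pq : perm_eq ([:: (m, c)] ++ [:: (n, d)]) ([:: (n, d)] ++ [:: (m, c)]).
    by rewrite perm_catC.
  by rewrite (perm_weight pq) (perm_wordchar k pq) subrr.
- by split=> [|n]; [apply: MR_sub|rewrite ThetaB xE yE subr0].
- by split=> [|n]; [apply: MR_mul|rewrite Theta_ext_mul // rep_mul0r].
- by split=> [|n]; [apply: MR_mul|rewrite Theta_ext_mul // rep_mul0l].
Qed.

Definition shape_comb M (b : forall n, {ffun Gamma * 'I_n -> 'I_n.+1} -> int) : fmod gT :=
  \sum_(n < M) \sum_(mu : {ffun Gamma * 'I_n -> 'I_n.+1} | multipartition mu)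
    wprod n (shape_word mu) *~ b n mu.

(** Allowing every large cutoff [M] makes it possible to use the same one for two elements that are
    subtracted. *)
Lemma ideal_shape_comb x : MR x -> exists N, forall M, (N <= M)%N ->
  exists b, I (x - shape_comb M b).
Proof.
elim/MR_ind=> {x} [w||x y [M xM] [N yN]].
- have [mu pmu Iw] := ideal_shape w; exists (weight w).+1 => M lt_M.
  pose b := dfwith (fun n (_ : {ffun Gamma * 'I_n -> 'I_n.+1}) => 0 : int)
    (fun la => (la == mu)%:R).
  exists b; rewrite (_ : shape_comb M b = wprod (weight w) (shape_word mu)) //.
  rewrite /shape_comb (bigD1 (Ordinal lt_M)) //= /b dfwith_in (bigD1 mu) //= eqxx.
  rewrite big1 ?addr0 => [|la /andP[_ /negbTE->]]; last by rewrite mulr0z.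
  rewrite big1 ?addr0 ?mulr1z // => n ne; apply: big1 => la _.
  rewrite dfwith_out ?mulr0z //; apply: contra ne => /eqP E.
  by apply/eqP/ord_inj.
- exists 0%N => M _; exists (fun n _ => 0); rewrite /shape_comb big1 ?subrr.
    exact: ideal_gen0.
  by move=> n _; rewrite big1 // => mu _; rewrite mulr0z.
- exists (maxn M N) => K; rewrite geq_max => /andP[/xM[b xb] /yN[d yd]].
  exists (fun n mu => b n mu - d n mu).
  rewrite (_ : shape_comb K _ = shape_comb K b - shape_comb K d).
    rewrite (_ : _ - _ = (x - shape_comb K b) - (y - shape_comb K d)).
      exact: ideal_genB.
    by rewrite !opprB addrACA [RHS]addrACA [- y - _]addrC.
  rewrite /shape_comb -sumrB; apply: eq_bigr => n _; rewrite -sumrB.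
  by apply: eq_bigr => mu _; rewrite mulrzBr.
Qed.

(** Modulo the ideal, [x] is a combination of products indexed by multipartitions. That combination
    is again in the kernel, and [hchar_free] annihilates its coefficients degree by degree. *)
Lemma kernel_ideal x : in_kernel Theta x <-> I x.
Proof.
split=> [[Rx xE]|]; last exact: ideal_in_kernel.
have [M /(_ M (leqnn M))[b Ib]] := ideal_shape_comb Rx.
suffices Z : shape_comb M b = 0 by rewrite -[x]subr0 -Z.
have [_ TE] := ideal_in_kernel Ib.
rewrite /shape_comb; apply: big1 => n _; apply: big1 => mu pmu.
rewrite (@hchar_free _ n (b n)) ?mulr0z //.
have := TE n; rewrite ThetaB xE sub0r => /eqP; rewrite oppr_eq0 => /eqP E.
apply: etrans E; symmetry.
rewrite /shape_comb Theta_sum (bigD1 n) //=.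
rewrite [X in _ + X]big1 ?addr0 => [|m ne_m]; rewrite Theta_sum.
  apply: eq_bigr => la _; rewrite ThetaMz Theta_wprod eqxx.
  by rewrite hcharE.
apply: big1 => la _; rewrite ThetaMz Theta_wprod.
by rewrite (inj_eq (@ord_inj M)) (negbTE ne_m) mul0rz.
Qed.
End KernelIdeal.

(** * Compatibility with the coproducts and counits *)

Section Coalgebra.
Variables (gT : finGroupType).
Hypothesis abG : abelian [set: gT].
Local Notation Gamma := (dual gT).
Local Notation word := (seq (nat * Gamma)).
Local Notation Theta := (Theta abG).
Implicit Types x y : fmod gT.

(** Standardization commutes with restriction to increasing positions, because these keep both the
    order of letters and the breaking of ties. *)
Lemma subword_elt k n (T : finType) (r : T -> nat) (c : T -> Gamma) (f : {ffun 'I_n -> T})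
    (g : 'I_k -> 'I_n) :
    (forall i j, (g i < g j)%N = (i < j)%N) ->
  subword g (elt r c f) = elt r c [ffun j => f (g j)].
Proof.
move=> mono; congr Wreath; first by apply/ffunP=> j; rewrite !ffunE.
congr (_^-1)%g; rewrite /= invgK; symmetry; apply: eq_std => [|i j].
  exact: lexw_inj.
by rewrite std_lt ?lexw_lt /= ?ffunE ?mono //; apply: lexw_inj.
Qed.

Lemma subword_cutl k l n (e : (k + l)%N = n) (T : finType) (r : T -> nat)
    (c : T -> Gamma) (f : {ffun 'I_n -> T}) :
  subword (fun j => cast_ord e (lshift l j)) (elt r c f) = elt r c (cutl e f).
Proof. exact: subword_elt. Qed.

Lemma subword_cutr k l n (e : (k + l)%N = n) (T : finType) (r : T -> nat)
    (c : T -> Gamma) (f : {ffun 'I_n -> T}) :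
  subword (fun j => cast_ord e (rshift k j)) (elt r c f) = elt r c (cutr e f).
Proof. by apply: subword_elt => i j; rewrite /= ltn_add2l. Qed.

HB.instance Definition _ := GRing.isZmodMorphism.Build (fmod gT) (fmod2 gT)
  (@coprod gT) (extend1_is_additive _).

Lemma coprod_wsum n (T : finType) (r : T -> nat) (c : T -> Gamma) a :
  coprod (wsum r c n a) =
  \sum_(i < n.+1) \sum_(b : {ffun T -> 'I_n.+1} | [forall t, (b t <= a t)%N])
    tensor (wsum r c i (fun t => b t)) (wsum r c (n - i) (fun t => a t - b t)%N).
Proof.
rewrite /coprod /wsum raddf_sum /=.
transitivity (\sum_(f : {ffun 'I_n -> T} | has_content a f) \sum_(i < n.+1)
   (<< (fbasis_in (elt r c (cutl (subnKC (leq_ord i)) f)),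
        fbasis_in (elt r c (cutr (subnKC (leq_ord i)) f))) >> : fmod2 gT)).
  apply: eq_bigr => f _; rewrite extend1U /=; apply: eq_bigr => i _.
  by rewrite subword_cutl subword_cutr.
rewrite exchange_big /=; apply: eq_bigr => i _.
rewrite (sum_cut (subnKC (leq_ord i)) a (fun u v =>
  << (fbasis_in (elt r c u), fbasis_in (elt r c v)) >> : fmod2 gT)).
apply: eq_bigr => b _; rewrite /tensor extend2_sum.
by apply: eq_bigr => u _; apply: eq_bigr => v _; rewrite extend2UU.
Qed.

Lemma coprod_MR x : MR x -> exists s : seq (fmod gT * fmod gT),
  {in s, forall p, MR p.1 /\ MR p.2} /\ coprod x = \sum_(p <- s) tensor p.1 p.2.
Proof.
elim/MR_ind=> {x} [w||x y [s [sR sE]] [t [tR tE]]].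
- rewrite coprod_wsum; set n := weight w; set T := 'I_(size w).
  pose ip := [seq (i, b) | i <- enum 'I_n.+1,
    b <- enum [pred b : {ffun T -> 'I_n.+1} | [forall t, (b t <= @wsize _ w t)%N]]].
  pose F (p : 'I_n.+1 * {ffun T -> 'I_n.+1}) : fmod gT * fmod gT :=
    (wsum val (wcolor (w := w)) p.1 (fun t => p.2 t),
     wsum val (wcolor (w := w)) (n - p.1) (fun t => @wsize _ w t - p.2 t)%N).
  exists [seq F p | p <- ip].
  split; first by move=> _ /mapP[p _ ->] /=; split; apply/MR_wsum/val_inj.
  by rewrite big_map big_allpairs_dep /= big_enum; apply: eq_bigr => i _; rewrite big_enum.
- by exists [::]; split=> //; rewrite big_nil raddf0.
- exists (s ++ [seq (- p.1, p.2) | p <- t]); split.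
    move=> p; rewrite mem_cat => /orP[/sR //|/mapP[q /tR[R1 R2] ->]].
    by split=> //; apply: MR_opp.
  rewrite raddfB /= sE tE big_cat big_map -sumrN.
  congr (_ + _); apply: eq_bigr => p _.
  by rewrite /tensor !extend2E raddfN.
Qed.

Section Evaluation.
Variables (k l : nat) (h1 : wreath gT k) (h2 : wreath gT l).

(** The tensor square of [Theta] evaluated at a pair. Since [Theta] is defined on all of F, this
    makes sense on the whole of F (x) F, and the coproduct formula follows for every decomposition
    into tensors. *)
Definition coeval : fmod2 gT -> algC :=
  extend1 (fun p => Theta << p.1 >> k h1 * Theta << p.2 >> l h2).

HB.instance Definition _ := GRing.isZmodMorphism.Build (fmod2 gT) algC
  coeval (extend1_is_additive _).

Lemma Theta_coefs n x (h : wreath gT n) :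
  Theta x n h = \sum_(b <- msupp x) Theta << b >> n h *~ x@_b.
Proof.
rewrite [in LHS](malg_sumE x) Theta_sum sum_cfunE; apply: eq_bigr => b _.
by rewrite ThetaMz cfun_mulzE.
Qed.

Lemma coeval_tensor x y : coeval (tensor x y) = Theta x k h1 * Theta y l h2.
Proof.
rewrite [in LHS](malg_sumE x) [in LHS](malg_sumE y) /tensor extend2_sumz.
rewrite raddf_sum (Theta_coefs x) (Theta_coefs y) big_distrlr.
apply: eq_bigr => a _; rewrite raddf_sum; apply: eq_bigr => b _.
by rewrite raddfMz extend2UU /= /coeval extend1U /= mulrzAl mulrzAr mulrzA_C mulrzA.
Qed.

Lemma coeval_coprod x : MR x -> coeval (coprod x) = Theta x (k + l)%N (juxt (h1, h2)).
Proof.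
elim/MR_ind=> {x} [w||x y IHx IHy].
(* The degree is a variable here, instead of [weight w], so that [k + l] can be substituted for
   it. *)
- have main n : coeval (coprod (wprod n w)) = Theta (wprod n w) (k + l)%N (juxt (h1, h2)).
    rewrite coprod_wsum Theta_wprod raddf_sum.
    have term (i : 'I_n.+1) : coeval (\sum_(b : {ffun 'I_(size w) -> 'I_n.+1} |
          [forall t, (b t <= @wsize _ w t)%N])
        tensor (wsum val (wcolor (w := w)) i (fun t => b t))
          (wsum val (wcolor (w := w)) (n - i) (fun t => @wsize _ w t - b t)%N)) =
      if (i == k :> nat) && (n - i == l)%N then
        \sum_(b : {ffun 'I_(size w) -> 'I_n.+1} | [forall t, (b t <= @wsize _ w t)%N])
           wchar k (wcolor (w := w)) (fun t => b t) h1 *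
           wchar l (wcolor (w := w)) (fun t => @wsize _ w t - b t)%N h2 else 0.
      rewrite raddf_sum; case: eqP => [ik|ik] /=; last first.
        apply: big1 => b _; rewrite coeval_tensor Theta_wsum; last exact: val_inj.
        by case: eqP => // _; rewrite cfunE mul0r.
      case: eqP => [il|il]; last first.
        apply: big1 => b _; rewrite coeval_tensor mulrC Theta_wsum; last exact: val_inj.
        by case: eqP => // _; rewrite cfunE mul0r.
      apply: eq_bigr => b _; rewrite coeval_tensor !Theta_wsum; try exact: val_inj.
      by rewrite il ik !eqxx.
    rewrite (eq_bigr _ (fun i _ => term i)) {term}.
    case: eqP => [nkl|nkl]; last first.
      rewrite cfunE big1 // => i _; case: eqP => //= ik; case: eqP => //= il.
      by case: nkl; rewrite -ik -il subnKC // -ltnS.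
    have lt_k : (k < n.+1)%N by rewrite ltnS nkl leq_addr.
    rewrite (bigD1 (Ordinal lt_k)) //= [X in (X - k == l)%N]nkl addKn !eqxx /=.
    rewrite [X in _ + X]big1 ?addr0 => [|i ne_i]; last first.
      by case: ifP => // /andP[/eqP ik _]; case/eqP: ne_i; apply: ord_inj.
    subst n; rewrite wcharE.
    rewrite (eq_bigr _ (fun f _ => word_char_cut _ _ _ f)).
    rewrite (sum_cut erefl (@wsize _ w) (fun u v =>
      word_char (wcolor (w := w)) h1 u * word_char (wcolor (w := w)) h2 v)).
    by apply: eq_bigr => b _; rewrite !wcharE big_distrlr.
  exact: main.
- by rewrite (raddf0 (@coprod gT)) (raddf0 coeval) Theta0 cfunE.
- rewrite (raddfB (@coprod gT)) (raddfB coeval) /= IHx IHy ThetaB.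
  by rewrite !cfunE.
Qed.
End Evaluation.

Lemma rep_coprodE (r : cfamily gT) k l h :
  rep_coprod r k l h = r (k + l)%N (juxt h).
Proof.
rewrite /rep_coprod cfMorphE ?inE // cfResE ?subsetT //.
by apply: mem_morphim; rewrite inE.
Qed.

Lemma Theta_coprod x (s : seq (fmod gT * fmod gT)) : MR x ->
    coprod x = \sum_(p <- s) tensor p.1 p.2 ->
  forall k l, rep_coprod (Theta x) k l =
    \sum_(p <- s) cfOuter (Theta p.1 k) (Theta p.2 l).
Proof.
move=> Rx xs k l; apply/cfunP=> -[h1 h2].
rewrite rep_coprodE -coeval_coprod // xs raddf_sum sum_cfunE.
by apply: eq_bigr => p _; rewrite /= coeval_tensor [RHS]cfunE.
Qed.

Lemma Theta_counit x : MR x -> rep_counit (Theta x) = (counit x)%:~R.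
Proof.
rewrite /rep_counit /counit; elim/MR_ind=> {x} [w||x y IHx IHy].
- rewrite Theta_wprod /wprod /wsum (raddf_sum (extend1 _)) mulrz_sumr.
  case: (weight w =P 0%N) => [->|/eqP w0].
    rewrite wcharE; apply: eq_bigr => f _.
    by rewrite /= extend1U /word_char word_perm1 word_eval1 eqxx mul1r.
  rewrite cfunE big1 // => f _.
  by rewrite /= extend1U /= (negbTE w0).
- by rewrite Theta0 cfunE raddf0.
- by rewrite ThetaB raddfB rmorphB /= -IHx -IHy cfunE [X in _ + X]cfunE.
Qed.
End Coalgebra.

(** * Comparison of the linear and bilinear forms *)

Section BilinearForms.
Variables (gT : finGroupType).
Hypothesis abG : abelian [set: gT].
Local Notation Gamma := (dual gT).
Local Notation word := (seq (nat * Gamma)).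
Local Notation Theta := (Theta abG).
Implicit Types x y : fmod gT.

Definition mean n (phi : 'CF([set: wreath gT n])) : algC :=
  #|[set: wreath gT n]|%:R^-1 * \sum_(h : wreath gT n) phi h.

Lemma meanB n (phi psi : 'CF([set: wreath gT n])) : mean (phi - psi) = mean phi - mean psi.
Proof.
rewrite /mean -mulrBr -sumrB; congr (_ * _); apply: eq_bigr => h _.
by rewrite !cfunE.
Qed.

Lemma mean0 n : mean (0 : 'CF([set: wreath gT n])) = 0.
Proof. by rewrite /mean big1 ?mulr0 // => h _; rewrite cfunE. Qed.

Lemma meanM n (phi psi : 'CF([set: wreath gT n])) : mean (phi * psi) = '[phi, psi^*%CF].
Proof.
rewrite cfdotE /mean; congr (_ * _); apply: eq_big => h; rewrite ?inE // => _.
by rewrite cfunE [X in _ = _ * X^*]cfunE conjCK.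
Qed.

Lemma phi_tot_sum (r : cfamily gT) N : (forall n, (N <= n)%N -> r n = 0) ->
  phi_tot r = \sum_(n < N) mean (r n).
Proof.
move=> rN; rewrite /phi_tot (fsbigop.fsbigE (iota 0 N)) ?iota_uniq //.
  rewrite -(big_mkord xpredT (fun n => mean (r n))) /index_iota subn0.
  by apply: eq_bigl => n; rewrite classical_sets.in_setT.
move=> n _; rewrite mem_iota /= add0n -leqNgt => le_Nn.
by rewrite -/(mean (r n)) rN // mean0.
Qed.

Lemma eq_phi_tot (r s : cfamily gT) : (forall n, r n = s n) -> phi_tot r = phi_tot s.
Proof.
by move=> rs; apply: fsbigop.eq_fsbigr => n _; rewrite rs.
Qed.

Lemma phi_totB (r s : cfamily gT) M N :
    (forall n, (M <= n)%N -> r n = 0) -> (forall n, (N <= n)%N -> s n = 0) ->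
  phi_tot (fun n => r n - s n) = phi_tot r - phi_tot s.
Proof.
move=> rM sN; pose K := maxn M N.
have rK n : (K <= n)%N -> r n = 0 by rewrite geq_max => /andP[/rM].
have sK n : (K <= n)%N -> s n = 0 by rewrite geq_max => /andP[_ /sN].
rewrite (phi_tot_sum rK) (phi_tot_sum sK) (@phi_tot_sum _ K) => [|n le_Kn].
  by rewrite -sumrB; apply: eq_bigr => n _; rewrite meanB.
by rewrite rK // sK // subr0.
Qed.

Lemma phi_tot0 (r : cfamily gT) : (forall n, r n = 0) -> phi_tot r = 0.
Proof. by move=> r0; rewrite (@phi_tot_sum _ 0) ?big_ord0. Qed.

Lemma phi_tot1 (r : cfamily gT) n : (forall m, m != n -> r m = 0) -> phi_tot r = mean (r n).
Proof.
move=> rn; rewrite (@phi_tot_sum _ n.+1) => [|m lt_m]; last by rewrite rn ?gtn_eqF.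
rewrite big_ord_recr /= big1 ?add0r // => i _.
by rewrite rn ?mean0 // ltn_eqF.
Qed.

Lemma tau_Theta x : MR x -> (tau_tot x)%:~R = phi_tot (Theta x).
Proof.
(* Membership is carried through the induction, since the subtraction step needs the supports to be
   bounded. *)
move=> Rx; suffices [] : MR x /\ (tau_tot x)%:~R = phi_tot (Theta x) by [].
elim/MR_ind: x / Rx => [w||x y [Rx IHx] [Ry IHy]].
- split; first exact: MR_wprod.
  rewrite (@phi_tot1 _ (weight w)) => [|m ne]; last first.
    by rewrite Theta_wprod eq_sym (negbTE ne).
  rewrite Theta_wprod eqxx tau_wsum; last exact: val_inj.
  by rewrite /mean cardsT.
- by split; [apply: MR0|rewrite raddf0 phi_tot0 // => n; apply: Theta0].
- split; first exact: MR_sub.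
  have [[M xM] [N yN]] := (Theta_bounded abG Rx, Theta_bounded abG Ry).
  rewrite raddfB rmorphB /= IHx IHy -(phi_totB xM yN).
  by apply: eq_phi_tot => n; rewrite ThetaB.
Qed.

Lemma beta_totBl x x' y : MR x -> MR x' ->
  beta_tot (Theta (x - x')) (Theta y) =
  beta_tot (Theta x) (Theta y) - beta_tot (Theta x') (Theta y).
Proof.
move=> Rx Rx'; have [[M xM] [N xN]] := (Theta_bounded abG Rx, Theta_bounded abG Rx').
rewrite /beta_tot -(@phi_totB _ _ M N) => [|n le_n|n le_n].
- by apply: eq_phi_tot => n; rewrite ThetaB mulrBl.
- by rewrite xM ?mul0r.
- by rewrite xN ?mul0r.
Qed.

Lemma beta_totC (r s : cfamily gT) : beta_tot r s = beta_tot s r.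
Proof. by apply: eq_phi_tot => n; rewrite mulrC. Qed.

Lemma varpi_wprod u v n : (varpi_tot (wprod n u) (wprod n v))%:~R =
  mean (wordchar n u * wordchar n v : 'CF([set: wreath gT n])).
Proof. by rewrite meanM varpi_wsum //; apply: val_inj. Qed.

Lemma varpi_Theta x y : MR x -> MR y ->
  (varpi_tot x y)%:~R = beta_tot (Theta x) (Theta y).
Proof.
move=> Rx Ry.
suffices [] : MR x /\ (varpi_tot x y)%:~R = beta_tot (Theta x) (Theta y) by [].
elim/MR_ind: x / Rx => [u||x x' [Rx IHx] [Rx' IHx']].
- split; first exact: MR_wprod.
  suffices [] : MR y /\ (varpi_tot (wprod (weight u) u) y)%:~R =
    beta_tot (Theta (wprod (weight u) u)) (Theta y) by [].
  elim/MR_ind: y / Ry => [v||y y' [Ry IHy] [Ry' IHy']].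
  + split; first exact: MR_wprod.
    rewrite /beta_tot (@phi_tot1 _ (weight u)) => [|m ne]; last first.
      by rewrite Theta_wprod eq_sym (negbTE ne) mul0r.
    rewrite !Theta_wprod eqxx; case: eqP => [E|/eqP ne].
      by rewrite E varpi_wprod.
    by rewrite mulr0 mean0 /wprod varpi_wsum_neq // eq_sym.
  + split; first exact: MR0.
    rewrite raddf0 /beta_tot phi_tot0 // => n.
    by rewrite Theta0 mulr0.
  + split; first exact: MR_sub.
    by rewrite raddfB rmorphB /= IHy IHy' !(beta_totC (Theta (wprod _ _))) beta_totBl.
- split; first exact: MR0.
  rewrite /varpi_tot extend2E raddf0 /beta_tot phi_tot0 // => n.
  by rewrite Theta0 mul0r.
- split; first exact: MR_sub.
  by rewrite /varpi_tot extend2_is_additivel rmorphB /= -/(varpi_tot _ _) IHx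
    -/(varpi_tot _ _) IHx' beta_totBl.
Qed.

(** For the converse, pair [x] with a lift of the conjugate of its component in degree n: the value
    is the norm of that component. *)
Lemma kernel_perp x : in_kernel Theta x <-> MR x /\ MR_perp x.
Proof.
split=> [[Rx xE]|[Rx xP]]; split=> //.
  move=> y Ry; apply/eqP; rewrite -(intr_eq0 algC) varpi_Theta //.
  by rewrite /beta_tot phi_tot0 // => n; rewrite xE mul0r.
move=> n; have Zx := Theta_vchar abG x n.
have [y [[Ry _] yE]] := Theta_surj_degree abG (cfAut_vchar Num.conj Zx).
have := varpi_Theta Rx Ry; rewrite xP // /beta_tot (@phi_tot1 _ n) => [|m ne].
  rewrite yE (rep_inE n (fun n => cfAut Num.conj (Theta x n))) eqxx meanM cfConjCK => /esym/eqP.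
  by rewrite cfnorm_eq0 => /eqP.
rewrite yE (rep_inE n (fun n => cfAut Num.conj (Theta x n))) eq_sym (negbTE ne).
by rewrite mulr0.
Qed.
End BilinearForms.

(** * The radical *)

Section TraceNilpotent.
Variable F : numFieldType.

(** In a full rank factorization E = C R, idempotency forces R C = 1, and the trace of C R is that
    of R C. *)
Lemma idempotent_trace_rank m (E : 'M[F]_m) : E *m E = E -> \tr E = (\rank E)%:R.
Proof.
move=> EE; have CR : row_base E *m col_base E = 1%:M.
  have : col_base E *m (row_base E *m col_base E) *m row_base E =
      col_base E *m 1%:M *m row_base E.
    by rewrite mulmx1 mulmxA mulmx_base -mulmxA mulmx_base EE.
  by move/(row_free_inj (row_base_free E))/(row_full_inj (col_base_full E)).
by rewrite -{1}(mulmx_base E) mxtrace_mulC CR mxtrace1.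
Qed.

(* Writing char_poly A = X^e q with q(0) != 0, Bezout gives a multiple of X   *)
(* that is idempotent at A; its trace, hence its rank, is 0.                  *)
Lemma trace_nilpotent m (A : 'M[F]_m.+1) :
  (forall k, \tr (A ^+ k.+1) = 0) -> exists N, A ^+ N = 0.
Proof.
move=> trA; have [e [q q0 pE]] := multiplicity_XsubC (char_poly A) 0.
rewrite subr0 (monic_neq0 (char_poly_monic A)) /= in q0 pE.
have pA : horner_mx A (q * 'X^e) = 0 by rewrite -pE; apply: Cayley_Hamilton.
have cop : coprimep ('X^(e.+1)) q.
  by rewrite coprimep_expl // coprimep_sym -(subr0 'X) coprimep_XsubC.
have [[u v] /= uv] := Bezout_eq1_coprimepP _ _ cop.
pose E := horner_mx A (u * 'X^(e.+1)).
have vqE : E + horner_mx A (v * q) = 1 by rewrite -rmorphD uv rmorph1.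
have Evq : E * horner_mx A (v * q) = 0.
  rewrite -rmorphM (_ : u * 'X^(e.+1) * (v * q) = u * v * 'X * (q * 'X^e)); last first.
    by rewrite exprS mulrACA -!mulrA (mulrC q).
  by rewrite rmorphM /= pA mulr0.
have EE : E * E = E by rewrite -[RHS]mulr1 -vqE mulrDr Evq addr0.
have trE : \tr E = 0.
  rewrite /E exprSr mulrA rmorphM /= horner_mx_X.
  set w := u * _; rewrite -[w]coefK poly_def rmorph_sum mulr_suml raddf_sum big1 //= => i _.
  by rewrite linearZ /= rmorphXn /= horner_mx_X -scalerAl -exprSr mxtraceZ trA mulr0.
have E0 : E = 0.
  apply/eqP; rewrite -mxrank_eq0; have := idempotent_trace_rank EE.
  by rewrite trE => /esym/eqP; rewrite pnatr_eq0.
exists e; rewrite -[LHS]mulr1 -vqE E0 add0r.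
by rewrite -[A in A ^+ e](horner_mx_X A) -rmorphXn -rmorphM mulrC -mulrA rmorphM /= pA mulr0.
Qed.
End TraceNilpotent.

Lemma trace_nilpotent_iter (F : numFieldType) m (A : 'M[F]_m) :
    (forall k, \tr (iter k.+1 (mulmx A) 1%:M) = 0) ->
  exists N, iter N (mulmx A) 1%:M = 0.
Proof.
case: m A => [|m] A trA; first by exists 0%N; apply: flatmx0.
have iterE k : iter k (mulmx A) 1%:M = A ^+ k.
  by elim: k => //= k ->; rewrite exprS.
have [k|N AN] := @trace_nilpotent F m A; first by rewrite -iterE.
by exists N; rewrite iterE.
Qed.

(** * The regular representation of the group ring F_n *)

Section RegularRepresentation.
Variables (gT : finGroupType) (n : nat).
Local Notation Gamma := (dual gT).
Local Notation V := (wreath Gamma n).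
Implicit Types x y : fmod gT.

Definition regular_of x : 'M[algC]_(gcard [set: V]) :=
  \sum_(v : V) (x@_(fbasis_in v))%:~R *: regular_mx algC [set: V] v.

Lemma regular_of_is_additive : zmod_morphism regular_of.
Proof.
move=> x y; rewrite /regular_of -sumrB; apply: eq_bigr => v _.
by rewrite mcoeffB rmorphB scalerBl.
Qed.

HB.instance Definition _ := GRing.isZmodMorphism.Build (fmod gT)
  'M[algC]_(gcard [set: V]) regular_of regular_of_is_additive.

Lemma fbasis_in_inj : injective (@fbasis_in gT n).
Proof. by move=> v w /eqP; rewrite eq_Tagged /= => /eqP. Qed.

Lemma regular_ofU (v : V) : regular_of << fbasis_in v >> = regular_mx algC [set: V] v.
Proof.
rewrite /regular_of (bigD1 v) //= mcoeffUU scale1r big1 ?addr0 // => w ne_w.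
by rewrite mcoeffU (inj_eq fbasis_in_inj) eq_sym (negbTE ne_w) mulr0n scale0r.
Qed.

Lemma homogeneousE x : homogeneous n x ->
  x = \sum_(v : V) << fbasis_in v >> *~ x@_(fbasis_in v).
Proof.
move=> xn; apply/malgP => b; rewrite raddf_sum /=.
under eq_bigr => v _ do rewrite raddfMz /= mcoeffU.
case: (tag b =P n) => [E|bn].
  have [w ->] : exists w, b = fbasis_in (w : V) by case: b E => m w /= E; subst m; exists w.
  rewrite (bigD1 w) //= eqxx big1 ?addr0 => [|v ne]; first by rewrite -mulrzr mul1r intz.
  by rewrite (inj_eq fbasis_in_inj) (negbTE ne) mul0rz.
rewrite big1 => [|v _]; first by apply: mcoeff_outdom; apply/negP => /xn.
by rewrite (_ : (_ == _) = false) ?mul0rz //; apply/eqP=> E; case: bn; rewrite -E.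
Qed.

Lemma trace_regular_mx (v : V) :
  \tr (regular_mx algC [set: V] v) = (#|V| * (v == 1%g))%:R.
Proof.
have := congr1 (fun phi : 'CF([set: V]) => phi v) (cfReprReg [set: V]).
by rewrite cfunE inE mulr1n cfRegE cardsT -mulrnA.
Qed.

Lemma regular_of_mul x y : homogeneous n x -> homogeneous n y ->
  regular_of (int_mul x y) = regular_of x *m regular_of y.
Proof.
move=> xn yn; rewrite {1}(homogeneousE xn) {1}(homogeneousE yn) /int_mul extend2_sumz.
rewrite raddf_sum /regular_of mulmx_suml; apply: eq_bigr => v _.
rewrite raddf_sum mulmx_sumr; apply: eq_bigr => w _ /=.
rewrite raddfMz /= extend2UU /= eqxx tagged_asE regular_ofU.
rewrite -scalemxAl -scalemxAr scalerA -rmorphM /= scaler_int.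
have [_ M] := regular_mx_repr algC [set: V].
by rewrite M ?inE.
Qed.

Lemma trace_regular_of x : homogeneous n x ->
  \tr (regular_of x) = #|V|%:R * (tau_tot x)%:~R.
Proof.
move=> xn; rewrite /regular_of raddf_sum {2}(homogeneousE xn) (raddf_sum (@tau_tot gT)).
rewrite mulrz_sumr mulr_sumr; apply: eq_bigr => v _.
rewrite /= mxtraceZ trace_regular_mx (raddfMz (@tau_tot gT)) /= /tau_tot extend1U /=.
rewrite natrM mulrCA; congr (_ * _); case: (v == 1%g) => /=.
  by rewrite mulr1 intz.
by rewrite mulr0 mul0rz.
Qed.

(** Up to the factor |V|, the coefficient of [v] is the trace of the product with the matrix of
    [v^-1]. *)
Lemma regular_of_inj x : homogeneous n x -> regular_of x = 0 -> x = 0.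
Proof.
move=> xn x0; rewrite (homogeneousE xn) big1 // => v _.
suffices -> : x@_(fbasis_in v) = 0 by rewrite mulr0z.
have := congr1 (fun A => \tr (A *m regular_mx algC [set: V] v^-1%g)) x0.
rewrite /regular_of mulmx_suml mul0mx mxtrace0 raddf_sum (bigD1 v) //= big1 ?addr0 => [|w ne].
  have [_ M] := regular_mx_repr algC [set: V].
  rewrite -scalemxAl mxtraceZ -M ?inE // trace_regular_mx mulgV eqxx muln1.
  move/eqP; rewrite mulf_eq0 intr_eq0 pnatr_eq0 => /orP[/eqP //|].
  by rewrite (cardD1 1%g) inE.
have [_ M] := regular_mx_repr algC [set: V].
rewrite -scalemxAl mxtraceZ -M ?inE // trace_regular_mx -eq_mulgV1 (negbTE ne).
by rewrite muln0 mulr0.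
Qed.

Lemma regular_of_one : regular_of (ygen n (1%g : Gamma)) = 1%:M.
Proof.
rewrite /ygen (_ : Wreath _ _ = 1%g) // regular_ofU.
by have [-> _] := regular_mx_repr algC [set: V].
Qed.
End RegularRepresentation.

(** * Existence of maximal left ideals *)

Section MaximalIdeals.
Variables (V : zmodType) (mul : V -> V -> V) (A : V -> Prop) (one : V).
Hypotheses (A1 : A one) (mulr_one : forall x, A x -> mul x one = x).

Lemma left_ideal_add (I : V -> Prop) x y : left_ideal mul A I -> I x -> I y -> I (x + y).
Proof. by case=> _ I0 IB _ Ix Iy; rewrite -[y]opprK -[- y]sub0r; apply: (IB) => //; apply: IB. Qed.

Lemma maximal_left_ideal_exists (L : V -> Prop) : left_ideal mul A L -> ~ L one ->
  exists2 I, maximal_left_ideal mul A I & forall x, L x -> I x.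
Proof.
(* Zorn's lemma is applied to the sets whose union with [L] is a proper left ideal; this way the
   empty chain, with empty union, is covered by the hypotheses on [L]. *)
move=> Lid L1; pose P (X : classical_sets.set V) :=
  left_ideal mul A (fun x => L x \/ X x) /\ ~ (L one \/ X one).
have [F FP Ftot|X [[Xid X1] Xmax]] := @classical_sets.Zorn_bigcup V P.
  have [LA L0 LB LM] := Lid; split; last first.
    by case=> // -[X FX X1]; have [_] := FP X FX; apply; right.
  split; first by move=> x [/LA //|[X FX Xx]]; have [[XA _ _ _] _] := FP X FX; apply: XA; right.
  - by left.
  - move=> x y [Lx|[X FX Xx]] [Ly|[Y FY Yy]].
    + by left; apply: LB.
    + have [[_ _ YB _] _] := FP Y FY.
      by have [?|?] := YB x y (or_introl Lx) (or_intror Yy); [left|right; exists Y].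
    + have [[_ _ XB _] _] := FP X FX.
      by have [?|?] := XB x y (or_intror Xx) (or_introl Ly); [left|right; exists X].
    + have [XY|YX] := Ftot X Y FX FY.
        have [[_ _ YB _] _] := FP Y FY.
        by have [?|?] := YB x y (or_intror (XY _ Xx)) (or_intror Yy); [left|right; exists Y].
      have [[_ _ XB _] _] := FP X FX.
      by have [?|?] := XB x y (or_intror Xx) (or_intror (YX _ Yy)); [left|right; exists X].
  - move=> a x Aa [Lx|[X FX Xx]]; first by left; apply: LM.
    have [[_ _ _ XM] _] := FP X FX.
    by have [?|?] := XM a x Aa (or_intror Xx); [left|right; exists X].
exists (fun x => L x \/ X x); last by move=> x; left.
split=> //; first by exists one.
move=> J Jid XJ; have [J1|J1] := boolp.EM (J one).
  by right=> x Ax; rewrite -(mulr_one Ax); case: Jid => _ _ _; apply.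
left=> x Jx; right; apply: boolp.contrapT => nXx.
apply: (Xmax J); first by split=> [y Xy|JX]; [apply: XJ; right|apply/nXx/JX].
have JL y : (L y \/ J y) <-> J y by split=> [[Ly|//]|]; [apply: XJ; left|right].
split; last by move/JL.
have [JA J0 JB JM] := Jid; split.
- by move=> y /JL/JA.
- by right.
- by move=> y z /JL Jy /JL Jz; right; apply: JB.
- by move=> a y Aa /JL Jy; right; apply: JM.
Qed.
End MaximalIdeals.

(** * The kernel in degree n as the Jacobson radical *)

Section Jacobson.
Variables (gT : finGroupType).
Hypothesis abG : abelian [set: gT].
Variable n : nat.
Local Notation Gamma := (dual gT).
Local Notation Theta := (Theta abG).
Local Notation A := (@MRn gT n).
Local Notation mul := (@int_mul gT).
Local Notation rho := (@regular_of gT n).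
Implicit Types x y : fmod gT.
Let one : fmod gT := ygen n (1%g : Gamma).

Lemma MRn_homogeneous x : A x -> homogeneous n x. Proof. by case. Qed.

Lemma regular_of_int_mul x y : A x -> A y -> rho (mul x y) = rho x *m rho y.
Proof. by move=> Ax Ay; apply: regular_of_mul; apply: MRn_homogeneous. Qed.

Lemma regular_of_MRn_inj x y : A x -> A y -> rho x = rho y -> x = y.
Proof.
move=> Ax Ay E; apply/eqP; rewrite -subr_eq0; apply/eqP.
apply: (@regular_of_inj gT n); first exact/MRn_homogeneous/MRnB.
by rewrite raddfB /= E subrr.
Qed.

(** The ring laws are read off on matrices, as [rho] is faithful. *)
Lemma int_mulA x y z : A x -> A y -> A z -> mul x (mul y z) = mul (mul x y) z.
Proof.
move=> Ax Ay Az; apply: regular_of_MRn_inj; try by repeat apply: MRn_int_mul.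
by rewrite !regular_of_int_mul ?mulmxA //; apply: MRn_int_mul.
Qed.

Lemma int_mul1l x : A x -> mul one x = x.
Proof.
move=> Ax; have A1 := MRn_one gT n; apply: regular_of_MRn_inj => //; first exact: MRn_int_mul.
by rewrite regular_of_int_mul // regular_of_one mul1mx.
Qed.

Lemma int_mul1r x : A x -> mul x one = x.
Proof.
move=> Ax; have A1 := MRn_one gT n; apply: regular_of_MRn_inj => //; first exact: MRn_int_mul.
by rewrite regular_of_int_mul // regular_of_one mulmx1.
Qed.

Lemma int_mulBl x y z : mul (x - y) z = mul x z - mul y z.
Proof. exact: extend2_is_additivel. Qed.

Lemma int_mulBr x y z : mul x (y - z) = mul x y - mul x z.
Proof. exact: extend2_is_additiver. Qed.

Lemma int_mulDl x y z : mul (x + y) z = mul x z + mul y z.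
Proof. by rewrite /int_mul !extend2E raddfD. Qed.

Lemma Theta_int_mul x y : A x -> A y -> Theta (mul x y) n = Theta x n * Theta y n.
Proof.
move=> Ax Ay; move: x Ax; apply: MRn_ind => [u _||x x' IH IH'].
- move: y Ay; apply: MRn_ind => [v _||y y' IH IH'].
  + rewrite int_mul_wsum Theta_sum !Theta_wprod !eqxx wcharM.
    apply: eq_bigr => c _; rewrite Theta_wsum ?eqxx //.
    by apply: pair_rank_inj; apply: val_inj.
  + by rewrite -(subrr 0) int_mulBr !subrr !Theta0 mulr0.
  + by rewrite int_mulBr !ThetaB IH IH' mulrBr.
- by rewrite -(subrr 0) int_mulBl !subrr !Theta0 mul0r.
- by rewrite int_mulBl !ThetaB IH IH' mulrBl.
Qed.

Lemma Theta_one_degree : Theta one n = 1.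
Proof.
rewrite Theta_ygen (rep_inE n (fun n => eta_char n 1%g)) eqxx.
by apply/cfunP=> h; rewrite cfunE cfun1E inE dual_oneE.
Qed.

(** Positive powers of [z] stay in the kernel, and the trace of such a power is a multiple of its
    [tau_tot], that is of [phi_tot] of its image 0; a matrix all of whose positive powers have trace
    0 is nilpotent. *)
Lemma kernel_nilpotent z : A z -> Theta z n = 0 ->
  exists N, iter N (mulmx (rho z)) 1%:M = 0.
Proof.
move=> Az z0; apply: trace_nilpotent_iter => k.
have [w Aw wE] : exists2 w, A w & iter k (mulmx (rho z)) 1%:M = rho w.
  elim: k => [|k [w Aw wE]]; first by exists one; [apply: MRn_one|rewrite regular_of_one].
  by exists (mul z w); [apply: MRn_int_mul|rewrite iterS wE regular_of_int_mul].
have Azw : A (mul z w) by apply: MRn_int_mul.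
rewrite iterS wE -regular_of_int_mul // trace_regular_of; last exact: MRn_homogeneous.
rewrite tau_Theta; last by case: Azw.
rewrite (@phi_tot1 _ _ n) => [|m ne].
  by rewrite Theta_int_mul // z0 mul0r mean0 mulr0.
suffices : forall x, A x -> Theta x m = 0 by apply.
apply: MRn_ind => [v _||x y x0 y0]; rewrite ?Theta0 ?ThetaB ?x0 ?y0 ?subr0 //.
by rewrite Theta_wprod eq_sym (negbTE ne).
Qed.

(** The inverse is the truncated geometric series, built inside MR_n by the recursion s -> 1 + z
    s. *)
Lemma kernel_left_inverse z : A z -> Theta z n = 0 ->
  exists2 s, A s & mul s (one - z) = one.
Proof.
move=> Az z0; have [N zN] := kernel_nilpotent Az z0; have A1 := MRn_one gT n.
have A1z : A (one - z) by apply: MRnB.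
have [s As sE] : exists2 s, A s &
    rho (mul s (one - z)) = 1%:M - iter N (mulmx (rho z)) 1%:M.
  elim: N {zN} => [|N [s As sE]].
    exists 0; first exact: MRn0.
    by rewrite -(subrr 0) int_mulBl subrr raddf0 /= subrr.
  have Azs : A (mul z s) by apply: MRn_int_mul.
  exists (one + mul z s).
    rewrite -[mul z s]opprK -[- mul z s]sub0r.
    by apply: MRnB => //; apply: MRnB => //; apply: MRn0.
  rewrite int_mulDl int_mul1l // -int_mulA // !raddfD raddfN /=.
  rewrite (regular_of_int_mul Az); last exact: MRn_int_mul.
  by rewrite sE regular_of_one mulmxBr mulmx1 addrA subrK.
exists s => //; apply: regular_of_MRn_inj => //; first exact: MRn_int_mul.
by rewrite sE zN subr0 regular_of_one.
Qed.

(** If a maximal left ideal M misses [x], then M + A x contains 1, say 1 = i + b x with i in M. As b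
    x is in the kernel, i = 1 - b x has a left inverse, so M contains 1. *)
Lemma kernel_sub_jacobson x : A x -> Theta x n = 0 -> jacobson_radical mul A x.
Proof.
move=> Ax x0; have A1 := MRn_one gT n; split=> // M [Mid [w [Aw Mw]] Mmax].
have [MA M0 MB MM] := Mid; apply: boolp.contrapT => Mx.
pose J y := exists i b, [/\ M i, A b & y = i + mul b x].
have Jid : left_ideal mul A J.
  split.
  - move=> _ [i [b [Mi Ab ->]]]; rewrite -[mul b x]opprK -[- mul b x]sub0r.
    by apply: MRnB; [apply: MA|apply: MRnB; [apply: MRn0|apply: MRn_int_mul]].
  - exists 0, 0; split=> //; first exact: MRn0.
    by rewrite -(subrr 0) int_mulBl !subrr add0r.
  - move=> _ _ [i [b [Mi Ab ->]]] [j [d [Mj Ad ->]]].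
    exists (i - j), (b - d); split; [exact: MB|exact: MRnB|].
    by rewrite int_mulBl opprD addrACA.
  - move=> a _ Aa [i [b [Mi Ab ->]]]; exists (mul a i), (mul a b).
    split; [exact: MM|exact: MRn_int_mul|].
    by rewrite -int_mulA // /int_mul raddfD.
have [i Mi|JM|AJ] := Mmax J Jid.
- by exists i, 0; split=> //; [apply: MRn0|rewrite -(subrr 0) int_mulBl !subrr addr0].
- by apply: Mx; apply: JM; exists 0, one; split=> //; rewrite int_mul1l // add0r.
have [i [b [Mi Ab oneE]]] := AJ one A1.
have Abx : A (mul b x) by apply: MRn_int_mul.
have bx0 : Theta (mul b x) n = 0 by rewrite Theta_int_mul // x0 mulr0.
have [s As sE] := kernel_left_inverse Abx bx0.
have M1 : M one by rewrite -sE; apply: MM => //; rewrite oneE addrK.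
by apply: Mw; rewrite -(int_mul1r Aw); apply: MM.
Qed.

(** Otherwise the left ideal generated by 1 - a x lies in a maximal one, which also contains a x,
    hence 1. *)
Lemma jacobson_left_inverse x a : jacobson_radical mul A x -> A a ->
  exists2 b, A b & mul b (one - mul a x) = one.
Proof.
move=> [Ax Jx] Aa; have A1 := MRn_one gT n.
have Aax : A (mul a x) by apply: MRn_int_mul.
have Ay : A (one - mul a x) by apply: MRnB.
pose L z := exists2 b, A b & z = mul b (one - mul a x).
have Lid : left_ideal mul A L.
  split.
  - by move=> _ [b Ab ->]; apply: MRn_int_mul.
  - by exists 0; [apply: MRn0|rewrite -(subrr 0) int_mulBl !subrr].
  - move=> _ _ [b Ab ->] [d Ad ->]; exists (b - d); first exact: MRnB.
    by rewrite int_mulBl.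
  - move=> c _ Ac [b Ab ->]; exists (mul c b); first exact: MRn_int_mul.
    by rewrite int_mulA.
have [[b Ab bE]|L1] := boolp.EM (L one); first by exists b.
have [M Mmax LM] := maximal_left_ideal_exists A1 int_mul1r Lid L1.
have [Mid [w [Aw Mw]] _] := Mmax; have [_ _ _ MM] := Mid.
case: Mw; rewrite -(int_mul1r Aw); apply: (MM) => //.
rewrite -(subrK (mul a x) one); apply: (left_ideal_add Mid).
  by apply: LM; exists one; rewrite ?int_mul1l.
by apply: MM => //; apply: Jx.
Qed.

(* If psi = Theta x with x in the radical then 1 + |psi|^2 has an inverse u   *)
(* in R(G wr S_n).  The mean of u is an integer and u takes its values in     *)
(* ]0, 1], so u = 1 and psi = 0.                                              *)
Lemma jacobson_sub_kernel x : jacobson_radical mul A x -> Theta x n = 0.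
Proof.
move=> Jx; have Ax : A x by case: Jx.
set psi := Theta x n; have Zpsi : psi \in 'Z[irr [set: wreath gT n]]%g by apply: Theta_vchar.
have [a [Aa aE]] := Theta_surj_degree abG (rpredNr (cfAut_vchar Num.conj Zpsi)).
have A1 := MRn_one gT n; have Aax : A (mul a x) by apply: MRn_int_mul.
have [b Ab bE] := jacobson_left_inverse Jx Aa.
set u := Theta b n; have uE : u * (1 + psi^*%CF * psi) = 1.
  rewrite -[RHS]Theta_one_degree -bE Theta_int_mul //; last exact: MRnB.
  rewrite ThetaB Theta_int_mul // Theta_one_degree aE.
  by rewrite (rep_inE n (fun n => - cfAut Num.conj (Theta x n))) eqxx mulNr opprK.
pose d h : algC := 1 + `|psi h| ^+ 2.
have d_ge1 h : 1 <= d h by rewrite lerDl exprn_ge0.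
have d_gt0 h : 0 < d h by apply: lt_le_trans (d_ge1 h).
have ud h : u h = (d h)^-1.
  have := congr1 (fun phi : 'CF([set: wreath gT n]) => phi h) uE.
  rewrite cfunE cfunE [X in _ * (_ + X)]cfunE cfunE cfun1E inE => E.
  apply: (mulIf (lt0r_neq0 (d_gt0 h))); rewrite mulVf ?lt0r_neq0 //.
  by rewrite /d normCK mulrC [X in _ + X]mulrC mulrC.
have u_gt0 h : 0 < u h by rewrite ud invr_gt0.
have u_le1 h : u h <= 1 by rewrite ud invf_le1.
have card_gt0 : 0 < #|[set: wreath gT n]|%:R :> algC.
  by rewrite ltr0n; apply/card_gt0P; exists 1%g; rewrite inE.
have sum_u : \sum_(h : wreath gT n) (1 - u h) = 0.
  have : '[u, 1] \in Num.int.
    by apply: Cint_cfdot_vchar; [apply: Theta_vchar|apply: rpred1].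
  rewrite cfdotE; set S := \sum_(_ in _) _.
  have SE : S = \sum_(h : wreath gT n) u h.
    by apply: eq_big => h; rewrite ?inE // => _; rewrite cfun1E inE rmorph1 mulr1.
  have S_gt0 : 0 < S.
    rewrite SE (bigD1 1%g) //= ltr_wpDr ?u_gt0 //.
    by apply: sumr_ge0 => h _; apply: ltW.
  have S_le : S <= #|[set: wreath gT n]|%:R.
    rewrite SE cardsT -sum1_card natr_sum; apply: ler_sum => h _; exact: u_le1.
  case/intrP=> m mE.
  have m1 : m = 1.
    have m_gt0 : 0 < m by rewrite -(ltr0z algC) -mE mulr_gt0 ?invr_gt0.
    have m_le1 : m <= 1 by rewrite -(ler_int algC) -mE mulrC ler_pdivrMr // mul1r.
    by apply/eqP; rewrite eq_le m_le1.
  rewrite sumrB -SE sumr_const -cardsT.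
  move/eqP: mE; rewrite m1 mulrC -subr_eq0.
  rewrite -{2}(mulfV (lt0r_neq0 card_gt0)) -mulrBl mulf_eq0 invr_eq0.
  rewrite (negbTE (lt0r_neq0 card_gt0)) orbF.
  by rewrite subr_eq0 => /eqP->; rewrite subrr.
apply/cfunP=> h; rewrite cfunE.
have /eqP := sum_u; rewrite psumr_eq0 => [/allP/(_ h)|i _]; last by rewrite subr_ge0.
rewrite mem_index_enum subr_eq0 => /(_ isT)/eqP u1.
have : d h = 1 by apply: invr_inj; rewrite -ud -u1 invr1.
move/eqP; rewrite /d -subr_eq0 addrC addKr expf_eq0 /= normr_eq0.
by move/eqP.
Qed.
End Jacobson.

Lemma eq_beta_tot (gT : finGroupType) (r r' s s' : cfamily gT) :
  (forall n, r n = r' n) -> (forall n, s n = s' n) -> beta_tot r s = beta_tot r' s'.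
Proof. by move=> rr ss; apply: eq_phi_tot => n; rewrite rr ss. Qed.

Theorem theorem4p3 (gT : finGroupType) (abG : abelian [set: gT]) :
  (exists theta : fmod gT -> cfamily gT, Solomon_morphism theta) /\
  forall theta : fmod gT -> cfamily gT, Solomon_morphism theta ->
  [/\ (* (a) *)
      [/\ preserves_degree theta,
          algebra_morphism theta,
          coalgebra_morphism theta,
          forall r : cfamily gT, in_Rep r ->
            exists x, MR x /\ forall n, theta x n = r n &
          forall x, in_kernel theta x <->
            ideal_gen (@ext_mul gT) (@MR gT)
              (fun z => exists m n (c d : dual gT),
                 [/\ (1 <= m)%N, (1 <= n)%N &
                     z = ext_mul (ygen m c) (ygen n d)
                         - ext_mul (ygen n d) (ygen m c)]) x],
      (* (b) *)
      forall n : nat,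
        [/\ MRn n (ygen n (1%g : dual gT)) /\
              (forall x y : fmod gT, MRn n x -> MRn n y ->
                 MRn n (int_mul x y)),
            theta (ygen n (1%g : dual gT)) n = 1 /\
              (forall x y : fmod gT, MRn n x -> MRn n y ->
                 [/\ theta (x + y) n = theta x n + theta y n,
                     theta (x - y) n = theta x n - theta y n &
                     theta (int_mul x y) n = theta x n * theta y n]),
            forall psi, psi \in 'Z[irr [set: wreath gT n]]%g ->
              exists x, MRn n x /\ theta x n = psi &
            forall x : fmod gT, MRn n x /\ theta x n = 0 <->
              jacobson_radical (@int_mul gT) (MRn n) x] &
      (* (c) *)
      [/\ forall x, MR x -> (tau_tot x)%:~R = phi_tot (theta x),
          forall x y, MR x -> MR y ->
            (varpi_tot x y)%:~R = beta_tot (theta x) (theta y) &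
          forall x, in_kernel theta x <-> MR x /\ MR_perp x]].
Proof.
split; first by exists (Theta abG); apply: Theta_Solomon.
(* Every Solomon morphism agrees with [Theta] on MR, so each clause is transported from [Theta]. *)
move=> theta Sol; have TE := Solomon_unique abG Sol.
have TEn n x : MRn n x -> theta x n = Theta abG x n by case=> Rx _; apply: TE.
have kerE x : in_kernel theta x <-> in_kernel (Theta abG) x.
  by split=> -[Rx x0]; split=> // n; rewrite -?TE ?x0 // TE.
split; last 1 first.
- split.
  + by move=> x Rx; rewrite tau_Theta //; apply: eq_phi_tot => n; rewrite TE.
  + move=> x y Rx Ry; rewrite (varpi_Theta abG) //.
    by apply: eq_beta_tot => n; rewrite TE.
  + by move=> x; rewrite kerE kernel_perp.
- split.
  + move=> n x Rx m ne; rewrite TE; last by case: Rx.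
    move: x Rx; apply: MRn_ind => [w _||x y x0 y0].
    * by rewrite Theta_wprod eq_sym (negbTE ne).
    * exact: Theta0.
    * by rewrite ThetaB x0 y0 subr0.
  + by case: Sol.
  + split.
    * exact: coprod_MR.
    * move=> x s Rx sR xs k l; have := Theta_coprod abG Rx xs k l.
      rewrite (_ : rep_coprod _ k l = rep_coprod (Theta abG x) k l) => [->|].
        by apply: eq_big_seq => p /sR[R1 R2]; rewrite !TE.
      by rewrite /rep_coprod TE.
    * by move=> x Rx; rewrite -(Theta_counit abG) // /rep_counit TE.
  + move=> r /(Theta_surj abG)[x [Rx xE]]; exists x; split=> // n.
    by rewrite TE.
  + by move=> x; rewrite kerE; apply: kernel_ideal.
- move=> n; split.
  + split; first exact: MRn_one.
    by move=> x y; apply: MRn_int_mul.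
  + split; first by rewrite TEn ?Theta_one_degree //; apply: MRn_one.
    move=> x y Rx Ry; have [Rx' Ry'] : MR x /\ MR y by case: Rx; case: Ry.
    rewrite !TE; try by [apply: MR_add|apply: MR_sub|case: (MRn_int_mul Rx Ry)].
    by rewrite ThetaD ThetaB Theta_int_mul.
  + move=> psi /(Theta_surj_degree abG)[x [Rx xE]]; exists x; split=> //.
    by rewrite TEn // xE /rep_in dfwith_in.
  + move=> x; split=> [[Rx]|Jx].
      by rewrite TEn //; apply: kernel_sub_jacobson.
    have Rx : MRn n x by case: Jx.
    by split=> //; rewrite TEn //; apply: jacobson_sub_kernel.
Qed.
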